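(* Let $T=[v_1,v_2,v_3]\subset\mathbb{R}^2$ be a nondegenerate triangle with 12-split $T_{12}$. Let $K=\{v_1^{m_1}\cdots v_{10}^{m_{10}}\}$ be a multiset of vertices of $T_{12}$ with $|K|=8$ and $\mathrm{area}([K])>0$. Then the quintic simplex spline $Q[K]$ belongs to $\mathcal{S}^3_5(T_{12})$ and reduces to a B-spline on the boundary if and only if it lies in the $S_3$ equivalence class of exactly one of the following 20 simplex splines: $$\begin{aligned}&Q_{600101},\ Q_{500201},\ Q_{501200},\ Q_{410102},\ Q_{410201},\ Q_{320201},\ Q_{220211},\ Q_{422000},\ Q_{332000},\ Q_{412100},\\ &Q_{322100},\ Q_{141110},\ Q_{132110},\ Q_{222110},\ Q_{221111},\ Q_{411200},\ Q_{321200},\ Q_{131210},\ Q_{221210},\ Q_{121211}.\end{aligned}$$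
   Context: **12-split.** Let $v_4=\frac{v_1+v_2}2$, $v_5=\frac{v_2+v_3}2$, $v_6=\frac{v_1+v_3}2$, $v_7=\frac{v_4+v_6}2$, $v_8=\frac{v_4+v_5}2$, $v_9=\frac{v_5+v_6}2$, $v_{10}=\frac{v_1+v_2+v_3}3$. The 12-split $T_{12}$ is the triangulation of $T$ into 12 triangles obtained by drawing the segments $[v_1,v_5],[v_2,v_6],[v_3,v_4],[v_4,v_5],[v_5,v_6],[v_4,v_6]$; its vertices are $v_1,\dots,v_{10}$. $\mathcal{S}^3_5(T_{12})$ is the space of $C^3$ functions on $T$ that are polynomials of total degree at most 5 on each of the 12 triangles. **Simplex splines.** For a finite multiset $K=\{v_1^{m_1}\cdots v_{10}^{m_{10}}\}$ ($m_i\ge 0$ multiplicities) let $|K|=\sum m_i$ and $[K]$ its convex hull. For $x$ not on any line through two of the points $v_1,\dots,v_{10}$, define recursively $Q[K](x)=0$ if $\mathrm{area}([K])=0$; $Q[K](x)=\mathbf 1_{[K]}(x)\,\mathrm{area}(T)/\mathrm{area}([K])$ if $\mathrm{area}([K])\ne0$ and $|K|=3$; and $Q[K](x)=\sum_{j=1}^{10}\beta_jQ[K\setminus v_j](x)$ if $\mathrm{area}([K])\neq 0$ and $|K|>3$, where $x=\sum_j\beta_jv_j$, $\sum_j\beta_j=1$, $\beta_j=0$ whenever $m_j=0$, and $K\setminus v_j$ removes one copy of $v_j$ (the value does not depend on the choice of the $\beta_j$). $Q[K]\in\mathcal{S}^3_5(T_{12})$ means that, on $T$ minus these lines, $Q[K]$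 agrees with an element of $\mathcal{S}^3_5(T_{12})$. Write $Q_{ijklmn}:=Q[v_1^iv_2^jv_3^kv_4^lv_5^mv_6^n]$. **Symmetries.** Each permutation of $v_1,v_2,v_3$ extends to an affine map of $T$ permuting $v_1,\dots,v_{10}$; this gives a group $S_3$ of permutations $\sigma$ acting on simplex splines by $Q[K]\mapsto Q[\sigma(K)]$. The $S_3$ equivalence class of $Q[K]$ is $\{Q[\sigma(K)]:\sigma\in S_3\}$. **Reduction to a B-spline on the boundary.** For an edge $[v_i,v_k]$ of $T$ with midpoint $v_j$, the restriction of $Q[K]$ to the edge is $0$ if $m_i+m_j+m_k<|K|-1$, and if $m_i+m_j+m_k=|K|-1$ it is, in the parametrization $t\mapsto(1-t)v_i+tv_k$, equal to $\frac{\mathrm{area}(T)}{\mathrm{area}([K])}B(t)$ with $B$ the univariate B-spline with knot multiset $\{0^{m_i}\,0.5^{m_j}\,1^{m_k}\}$. A quintic simplex spline $Q[K]$ ($|K|=8$) reduces to a B-spline on the boundary if for each of the three edges either $m_i+m_j+m_k<7$, or $m_i+m_j+m_k=7$ and $B$ is one of the 8 consecutive quintic B-splines on the open knot multiset $\{0^6\,0.5^2\,1^6\}$, i.e. $(m_i,m_j,m_k)$ is one of $(6,1,0),(5,2,0),(4,2,1),(3,2,2),(2,2,3),(1,2,4),(0,2,5),(0,1,6)$. *)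

(* Defs.v *)
From HB Require Import structures.
From mathcomp Require Import all_boot all_order all_fingroup all_algebra.
From mathcomp Require Import all_classical all_reals all_analysis.
Set Implicit Arguments.
Unset Strict Implicit.
Unset Printing Implicit Defensive.
Import Order.TTheory GRing.Theory Num.Theory.
Import numFieldNormedType.Exports.
Local Open Scope classical_set_scope.
Local Open Scope ring_scope.

Definition hull (R : realType) (S : set (R * R)%type) : set (R * R)%type :=
  smallest (@convex_set R (R * R)%type) S.

Definition area (R : realType) (S : set (R * R)%type) : R :=
  fine ((@lebesgue_measure R \x @lebesgue_measure R)%E S).

Definition triangle (R : realType) (a b c : R * R) : set (R * R)%type :=
  hull [set a; b; c].

Definition line (R : realType) (a b : R * R) : set (R * R)%type :=
  [set x | exists t : R, x = (1 - t) *: a + t *: b].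

Definition affine_map (R : realType) (f : R * R -> R * R) : Prop :=
  forall (t : R) (x y : R * R),
    f ((1 - t) *: x + t *: y) = (1 - t) *: f x + t *: f y.

(* The ten vertices are numbered from 1; [ix k] is the index of v_k. *)
Definition ix (k : nat) : 'I_10 := inord k.-1.

Definition split12 (R : realType) (v1 v2 v3 : R * R) : 'I_10 -> R * R :=
  let mid (a b : R * R) : R * R := 2^-1 *: (a + b) in
  let v4 := mid v1 v2 in
  let v5 := mid v2 v3 in
  let v6 := mid v1 v3 in
  let v7 := mid v4 v6 in
  let v8 := mid v4 v5 in
  let v9 := mid v5 v6 in
  let v10 : R * R := 3^-1 *: (v1 + v2 + v3) in
  fun j => nth 0 [:: v1; v2; v3; v4; v5; v6; v7; v8; v9; v10] j.

(* The medians cross the sides of the medial triangle [v4,v5,v6] at its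
   midpoints v7, v8, v9 and meet at v10: each corner triangle is cut in two
   (first three lines) and the medial triangle in six. *)
Definition triangles12 : seq (nat * nat * nat) :=
  [:: (1, 4, 7); (1, 7, 6);
      (2, 4, 8); (2, 8, 5);
      (3, 5, 9); (3, 9, 6);
      (4, 7, 10); (7, 6, 10); (6, 9, 10);
      (9, 5, 10); (5, 8, 10); (8, 4, 10)]%N.

(* [C_on k D f]: [f] has partial derivatives of all orders up to [k] in the
   interior of [D], and these extend continuously to [D]. *)
Fixpoint C_on (R : realType) (k : nat) (D : set (R * R)%type)
    (f : R * R -> R) : Prop :=
  {within D, continuous f} /\
  match k with
  | 0%N => True
  | k'.+1 => exists fx fy : R * R -> R,
      [/\ C_on k' D fx, C_on k' D fy &
        forall p, interior D p ->
          is_derive p (1, 0) f (fx p) /\ is_derive p (0, 1) f (fy p)]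
  end.

Definition poly2_on (R : realType) (d : nat) (D : set (R * R)%type)
    (f : R * R -> R) : Prop :=
  exists c : nat -> nat -> R, forall x, D x ->
    f x = \sum_(i < d.+1) \sum_(j < d.+1 | (i + j <= d)%N)
            c i j * x.1 ^+ i * x.2 ^+ j.

(* Only the values of [f] on T matter. *)
Definition S35 (R : realType) (v : 'I_10 -> R * R) : set (R * R -> R) :=
  [set f | C_on 3 (triangle (v (ix 1)) (v (ix 2)) (v (ix 3))) f /\
    forall i j k, (i, j, k) \in triangles12 ->
      poly2_on 5 (triangle (v (ix i)) (v (ix j)) (v (ix k))) f].

(* [K j] is the multiplicity of the vertex of index [j]. *)
Definition mset10 := {ffun 'I_10 -> nat}.

Definition mcard (K : mset10) : nat := \sum_j K j.

Definition mremove (K : mset10) (i : 'I_10) : mset10 :=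
  [ffun j => (K j - (j == i))%N].

Definition mhull (R : realType) (v : 'I_10 -> R * R) (K : mset10) :
    set (R * R)%type :=
  hull (v @` [set j | (0 < K j)%N]).

Definition generic (R : realType) (v : 'I_10 -> R * R) : set (R * R)%type :=
  [set x | forall i j : 'I_10, i != j -> ~ line (v i) (v j) x].

Definition bary (R : realType) (v : 'I_10 -> R * R) (K : mset10) (x : R * R) :
    set {ffun 'I_10 -> R} :=
  [set b | [/\ x = \sum_j b j *: v j, \sum_j b j = 1 &
             forall j, K j = 0%N -> b j = 0]].

(* The recursion is on n = |K| - 3. When area([K]) <> 0 the set [bary v K x]
   is not empty, and [xget] chooses coordinates in it; at generic points the
   value does not depend on the choice. *)
Fixpoint simplex_rec (R : realType) (v : 'I_10 -> R * R) (n : nat)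
    (K : mset10) (x : R * R) : R :=
  if area (mhull v K) == 0 then 0 else
  match n with
  | 0%N => \1_(mhull v K) x
           * area (triangle (v (ix 1)) (v (ix 2)) (v (ix 3)))
           / area (mhull v K)
  | n'.+1 => let b := xget [ffun=> 0] (bary v K x) in
             \sum_j b j * simplex_rec v n' (mremove K j) x
  end.

(* Q[K] is a function on the generic points; it is encoded as a total function
   by the value 0 elsewhere, so that equality of two such total functions is
   equality of the simplex splines. *)
Definition simplex_spline (R : realType) (v : 'I_10 -> R * R) (K : mset10) :
    R * R -> R :=
  fun x => if `[< generic v x >] then simplex_rec v (mcard K - 3) K x else 0.

Definition simplex_spline_in_S35 (R : realType) (v : 'I_10 -> R * R)
    (K : mset10) : Prop :=
  exists2 f : R * R -> R, S35 v f &
    forall x, triangle (v (ix 1)) (v (ix 2)) (v (ix 3)) x -> generic v x ->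
      simplex_spline v K x = f x.

Definition S3_sym (R : realType) (v : 'I_10 -> R * R) : set {perm 'I_10} :=
  [set s : {perm 'I_10} | (forall j : 'I_10, (j < 3)%N -> (s j < 3)%N) /\
    exists2 f : R * R -> R * R, affine_map f & forall j, f (v j) = v (s j)].

Definition mact (s : {perm 'I_10}) (K : mset10) : mset10 :=
  [ffun j => K (s^-1%g j)].

Definition S3_class (R : realType) (v : 'I_10 -> R * R) (K : mset10) :
    set (R * R -> R) :=
  [set simplex_spline v (mact s K) | s in S3_sym v].

(* The knots 0, 1/2, 1 are coded by 0, 1, 2. *)
Definition open_knots : seq nat := nseq 6 0%N ++ nseq 2 1%N ++ nseq 6 2%N.

(* A quintic B-spline is given by 7 consecutive knots, here by the
   multiplicities of 0, 1/2 and 1 among them. *)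
Definition quintic_bsplines : seq (nat * nat * nat) :=
  [seq let w := take 7 (drop i open_knots) in
       (count_mem 0%N w, count_mem 1%N w, count_mem 2%N w) | i <- iota 0 8].

Lemma quintic_bsplinesE : quintic_bsplines =
  [:: (6, 1, 0); (5, 2, 0); (4, 2, 1); (3, 2, 2);
      (2, 2, 3); (1, 2, 4); (0, 2, 5); (0, 1, 6)]%N.
Proof. by []. Qed.

(* (i, j, k): the edge [v_i, v_k] of T with midpoint v_j. *)
Definition edges : seq (nat * nat * nat) := [:: (1, 4, 2); (2, 5, 3); (1, 6, 3)]%N.

Definition reduces_to_bspline (K : mset10) : Prop :=
  forall i j k, (i, j, k) \in edges ->
    let m := (K (ix i) + K (ix j) + K (ix k))%N in
    (m < 7)%N \/
    m = 7%N /\ (K (ix i), K (ix j), K (ix k)) \in quintic_bsplines.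

Definition mset_of (s : seq nat) : mset10 := [ffun j : 'I_10 => nth 0%N s j].

(* [:: i; j; k; l; m; n] stands for v_1^i v_2^j v_3^k v_4^l v_5^m v_6^n. *)
Definition quintic_list : seq (seq nat) :=
  [:: [:: 6; 0; 0; 1; 0; 1]; [:: 5; 0; 0; 2; 0; 1]; [:: 5; 0; 1; 2; 0; 0];
      [:: 4; 1; 0; 1; 0; 2]; [:: 4; 1; 0; 2; 0; 1]; [:: 3; 2; 0; 2; 0; 1];
      [:: 2; 2; 0; 2; 1; 1]; [:: 4; 2; 2; 0; 0; 0]; [:: 3; 3; 2; 0; 0; 0];
      [:: 4; 1; 2; 1; 0; 0]; [:: 3; 2; 2; 1; 0; 0]; [:: 1; 4; 1; 1; 1; 0];
      [:: 1; 3; 2; 1; 1; 0]; [:: 2; 2; 2; 1; 1; 0]; [:: 2; 2; 1; 1; 1; 1];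
      [:: 4; 1; 1; 2; 0; 0]; [:: 3; 2; 1; 2; 0; 0]; [:: 1; 3; 1; 2; 1; 0];
      [:: 2; 2; 1; 2; 1; 0]; [:: 1; 2; 1; 2; 1; 1]]%N.

(* Main.v *)
Require Import Defs.
From HB Require Import structures.
From mathcomp Require Import all_boot all_order all_fingroup all_algebra.
From mathcomp Require Import zify ring lra.
From mathcomp Require Import all_classical all_reals all_analysis measurable_realfun.
Set Implicit Arguments.
Unset Strict Implicit.
Unset Printing Implicit Defensive.
Import Order.TTheory GRing.Theory Num.Theory.
Import numFieldNormedType.Exports.
Local Open Scope classical_set_scope.
Local Open Scope ring_scope.

(** Everything is read off from the jumps of a simplex spline across the lines through
two of the ten points.

Fix the values on triples of points at a generic point [y] and run the recursion at a
variable point [x]. As the recursion does not depend on the barycentric coordinates that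
it uses ([srecE]; this reduces to a relation between the four triangles on four points,
[four_points]), the result is a polynomial in [x], of degree |K| - 3. It agrees with Q[K]
wherever no line separates [x] from [y] ([base_same]). By linearity, the jump of Q[K]
across a line is the output of the same recursion on the jumps of the triples, and these
are simple: a triangle contributes only if one of its edges lies on the line and contains
the point of crossing ([base_jump]). An induction then gives the exact order of the jump
([srec_jump]). Let m be the number of points of K on the line, with multiplicities. If K
has points on the line on both sides of the point of crossing, the jump vanishes exactly
to the order |K| - 1 - m on the line; otherwise there is no jump.

For |K| = 8 the order is 7 - m. So Q[K] belongs to the spline space only if m <= 3 for
each interior edge of the 12-split that K straddles in this sense, and K straddles no
segment inside one of the twelve triangles ([necessity]). If all points of K are among
v1, ..., v6, these conditions are also sufficient ([sufficiency]): there is one polynomial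
on each of the twelve triangles, and the differences of neighbours are divisible by the
fourth power of the form of the common edge, so the pieces glue to a function of class
C^3, by induction on the order of differentiation ([glue_C_on]).

The conditions are decidable, and a search lists the multisets that satisfy them
([smooth_lists]). Inspecting the list shows that those which reduce to a B-spline on the
boundary form the orbits of the twenty given ones, that these orbits are disjoint, and
that their members have all points among v1, ..., v6. The equality of functions Q[K] = Q[L]
also has to be turned into K = L. The orders of the jumps can be recovered from the values of
the function ([same_spline]), and the list shows that they determine a multiset that
satisfies the conditions. Finally, the affine symmetries are the six permutations of the
corners ([symmetry_list], [list_symmetry]). *)


(** * Convex hulls and triangles *)

Section Triangles.
Variable R : realType.
Implicit Types a b c p q x : (R * R)%type.

(** Twice the signed area of the triangle [a, b, c]; barycentric coordinates are
quotients of such determinants ([bary_coord]). *)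
Definition D a b c : R :=
  (b.1 - a.1) * (c.2 - a.2) - (b.2 - a.2) * (c.1 - a.1).

Lemma pairE p q : p.1 = q.1 -> p.2 = q.2 -> p = q.
Proof. by case: p q => ? ? [? ?] /= -> ->. Qed.

Lemma convex_setE (C : set (R * R)%type) :
  @convex_set R (R * R)%type C <->
  forall p q (t : R), 0 <= t -> t <= 1 -> C p -> C q -> C (t *: p + (1 - t) *: q).
Proof.
split => [cC p q t t0 t1 Cp Cq|cC p q t /set_mem Cp /set_mem Cq].
  have h : 0 <= t <= 1 by rewrite t0 t1.
  have := cC p q (Itv01 t0 t1) (mem_set Cp) (mem_set Cq).
  by move/set_mem.
apply/mem_set; apply: cC => //.
Qed.

Lemma hull_sub (S C : set (R * R)%type) :
  @convex_set R (R * R)%type C -> S `<=` C -> hull S `<=` C.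
Proof. by move=> cC SC; apply: smallest_sub. Qed.

Lemma hull_convex (S : set (R * R)%type) : @convex_set R (R * R)%type (hull S).
Proof.
apply/convex_setE => p q t t0 t1 hp hq C [cC SC].
by apply: (convex_setE _).1 => //; [apply: hp|apply: hq].
Qed.

Lemma hull_incl (S : set (R * R)%type) : S `<=` hull S.
Proof. by apply: sub_smallest. Qed.

Lemma D_neq a b c : D a b c != 0 -> [/\ a != b, b != c & c != a].
Proof. by move=> d0; split; apply: contra_neq d0 => ->; rewrite /D; ring. Qed.

Lemma triangleP a b c p : triangle a b c p <->
  exists w : R * R * R, [/\ 0 <= w.1.1, 0 <= w.1.2, 0 <= w.2,
    w.1.1 + w.1.2 + w.2 = 1 & p = w.1.1 *: a + w.1.2 *: b + w.2 *: c].
Proof.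
split.
  move: p; apply: hull_sub.
    apply/convex_setE => p q t t0 t1 [[[x y] z] /= [x0 y0 z0 s ->]].
    move=> [[[x' y'] z'] /= [x0' y0' z0' s' ->]].
    exists (t * x + (1 - t) * x', t * y + (1 - t) * y', t * z + (1 - t) * z') => /=.
    split; try by rewrite addr_ge0// mulr_ge0// subr_ge0.
      have -> : z = 1 - x - y by lra.
      have -> : z' = 1 - x' - y' by lra.
      ring.
    by apply: pairE; rewrite /= /GRing.scale/=; ring.
  move=> p [[->|->]|->]; [exists (1,0,0)|exists (0,1,0)|exists (0,0,1)];
    by split; rewrite /= ?ler01 ?lexx ?addr0 ?add0r ?scale1r ?scale0r ?addr0 ?add0r.
move=> [[[x y] z] /= [x0 y0 z0 s ->]].
have Ta : hull [set a; b; c] a by apply: hull_incl; left; left.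
have Tb : hull [set a; b; c] b by apply: hull_incl; left; right.
have Tc : hull [set a; b; c] c by apply: hull_incl; right.
have [z1|z1] := eqVneq z 1.
  have [-> ->] : x = 0 /\ y = 0 by split; lra.
  by rewrite z1 !scale0r !add0r scale1r.
have zl : 0 < 1 - z by rewrite subr_gt0 lt_neqAle z1; lra.
have -> : x *: a + y *: b + z *: c =
   (1 - z) *: ((x / (1 - z)) *: a + (1 - x / (1 - z)) *: b) + (1 - (1 - z)) *: c.
  have e : 1 - x / (1 - z) = y / (1 - z).
    have -> : y = 1 - z - x by lra.
    by field; rewrite gt_eqF.
  rewrite e scalerDr !scalerA ![_ * (_ / _)]mulrC !divfK ?gt_eqF//.
  by rewrite opprB addrCA subrr addr0.
have H := (convex_setE _).1 (@hull_convex [set a; b; c]).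
apply: (H) => //; [lra|lra|apply: H => //].
  by rewrite divr_ge0// ltW.
by rewrite ler_pdivrMr// mul1r; lra.
Qed.

Lemma bary_coord a b c x : D a b c != 0 ->
  D x b c / D a b c + D a x c / D a b c + D a b x / D a b c = 1 /\
  x = (D x b c / D a b c) *: a + (D a x c / D a b c) *: b + (D a b x / D a b c) *: c.
Proof.
move=> d0; split.
  by rewrite -!mulrDl -[RHS](divff d0); congr (_ / _); rewrite /D; ring.
apply: pairE; rewrite /= /GRing.scale/= mulrAC [_ / _ * _]mulrAC [D a b x / _ * _]mulrAC -!mulrDl;
 apply: (mulIf d0); rewrite divfK// /D; ring.
Qed.
Lemma triangle_DP a b c p : D a b c != 0 -> triangle a b c p <->
  [/\ 0 <= D p b c / D a b c, 0 <= D a p c / D a b c & 0 <= D a b p / D a b c].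
Proof.
move=> d0; split.
  move/triangleP => [[[x y] z] /= [x0 y0 z0 s ->]].
  have -> : D (x *: a + y *: b + z *: c) b c = x * D a b c.
    by rewrite /D /=/GRing.scale/= (_ : x = 1 - y - z); [ring|lra].
  have -> : D a (x *: a + y *: b + z *: c) c = y * D a b c.
    by rewrite /D /=/GRing.scale/= (_ : x = 1 - y - z); [ring|lra].
  have -> : D a b (x *: a + y *: b + z *: c) = z * D a b c.
    by rewrite /D /=/GRing.scale/= (_ : x = 1 - y - z); [ring|lra].
  by rewrite !mulfK.
move=> [h1 h2 h3]; apply/triangleP.
have [s e] := bary_coord p d0.
by exists (D p b c / D a b c, D a p c / D a b c, D a b p / D a b c).
Qed.

Lemma triangleCA a b c : triangle a b c = triangle b a c.
Proof. by rewrite /triangle; congr hull; rewrite (setUC [set a]). Qed.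

Lemma triangleAC a b c : triangle a b c = triangle a c b.
Proof. by rewrite /triangle; congr hull; rewrite -!setUA (setUC [set b]). Qed.
End Triangles.


(** * The area of a triangle *)

Section TriangleSections.
Variable R : realType.
Implicit Types a b c p q : (R * R)%type.
Notation leb := (@lebesgue_measure R).

Lemma integral_linear (k c a b : R) : a <= b ->
  (\int[leb]_(x in `[a, b]) (k * (x - c))%:E =
   (k / 2 * ((b - c) ^+ 2 - (a - c) ^+ 2))%:E)%E.
Proof.
rewrite le_eqVlt => /predU1P[->|ab].
  by rewrite set_itv1 integral_set1 subrr mulr0.
pose F (x : R) : R := k / 2 * (x - c) ^+ 2.
have dF (x : R) : is_derive x 1 F (k * (x - c)).
  apply: is_derive_eq; rewrite /GRing.scale/=.
  by field.
rewrite (@continuous_FTC2 _ _ F)//.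
- by rewrite -EFinB; congr EFin; rewrite /F; ring.
- apply: continuous_subspaceT => x.
  apply: (@differentiable_continuous _ R^o R^o).
  apply/derivable1_diffP.
  have dG (y : R) : is_derive y 1 (fun x : R => k * (x - c)) k.
    by apply: is_derive_eq; rewrite /GRing.scale/=; ring.
  exact: ex_derive.
- split => [x _||].
  + exact: ex_derive.
  + by apply: cvg_at_right_filter; apply: differentiable_continuous;
      apply/derivable1_diffP; apply: ex_derive.
  + by apply: cvg_at_left_filter; apply: differentiable_continuous;
      apply/derivable1_diffP; apply: ex_derive.
- by move=> x _; rewrite derive1E; apply: derive_val.
Qed.

Lemma measurable_halfplane (a b c : R) :
  measurable [set p : R * R | 0 <= a * p.1 + b * p.2 + c].
Proof.
have mf : measurable_fun [set: R * R] (fun p : R * R => a * p.1 + b * p.2 + c).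
  apply: measurable_funD => //; apply: measurable_funD => //; 
  apply: measurable_funM => //.
have := mf measurableT `[0, +oo[%classic (measurable_itv _).
rewrite setTI; congr measurable; apply/seteqP; split => p /=; rewrite in_itv/= andbT//.
Qed.

Lemma measurable_triangle a b c : D a b c != 0 -> measurable (triangle a b c).
Proof.
move=> d0.
have -> : triangle a b c =
   [set p : R * R | 0 <= ((b.2 - c.2) / D a b c) * p.1 + ((c.1 - b.1) / D a b c) * p.2
        + (b.1 * c.2 - b.2 * c.1) / D a b c] `&`
   [set p : R * R | 0 <= ((c.2 - a.2) / D a b c) * p.1 + ((a.1 - c.1) / D a b c) * p.2
        + (c.1 * a.2 - c.2 * a.1) / D a b c] `&`
   [set p : R * R | 0 <= ((a.2 - b.2) / D a b c) * p.1 + ((b.1 - a.1) / D a b c) * p.2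
        + (a.1 * b.2 - a.2 * b.1) / D a b c].
  apply/seteqP; split => p /=.
    move/(triangle_DP _ d0) => [h1 h2 h3].
    by (split; [split|]); [move: h1|move: h2|move: h3]; congr (0 <= _);
      rewrite /D; ring.
  move=> [[h1 h2] h3]; apply/(triangle_DP _ d0).
  by split; [move: h1|move: h2|move: h3]; congr (0 <= _); rewrite /D; ring.
by apply: measurableI; [apply: measurableI|]; apply: measurable_halfplane.
Qed.

(** Between the abscissa of [a] and those of the two other vertices, a vertical
section is bounded by the two sides through [a], so its length is linear. *)
Lemma triangle_section a b c (x : R) : D a b c != 0 ->
  0 < (x - a.1) / (b.1 - a.1) < 1 -> 0 < (x - a.1) / (c.1 - a.1) < 1 ->
  leb (xsection (triangle a b c) x) =
  (`|D a b c / ((b.1 - a.1) * (c.1 - a.1)) * (x - a.1)|)%:E.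
Proof.
move=> d0 /andP[xb0 xb1] /andP[xc0 xc1].
set m := a.2 + (c.2 - a.2) * ((x - a.1) / (c.1 - a.1)).
set g := a.2 + (b.2 - a.2) * ((x - a.1) / (b.1 - a.1)).
have db : b.1 - a.1 != 0 by apply: contraTneq xb0 => ->; rewrite invr0 mulr0 ltxx.
have dc : c.1 - a.1 != 0 by apply: contraTneq xc0 => ->; rewrite invr0 mulr0 ltxx.
have dx : x - a.1 != 0 by apply: contraTneq xc0 => ->; rewrite mul0r ltxx.
have e1 y : D a (x, y) c = (c.1 - a.1) * (m - y) by rewrite /D /m/=; field.
have e2 y : D a b (x, y) = (b.1 - a.1) * (y - g) by rewrite /D /g/=; field.
have e3 : m - g = D a b c / ((b.1 - a.1) * (c.1 - a.1)) * (x - a.1).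
  by rewrite /m /g /D; field; rewrite db dc.
rewrite -e3.
have bc0 : 0 < (b.1 - a.1) / (c.1 - a.1).
  have -> : (b.1 - a.1) / (c.1 - a.1) = ((x - a.1) / (b.1 - a.1))^-1 * ((x - a.1) / (c.1 - a.1)).
    by field; rewrite ?db ?dc ?dx.
  by rewrite mulr_gt0// invr_gt0.
have tri y : triangle a b c (x, y) <->
   0 <= (c.1 - a.1) / D a b c * (m - y) /\ 0 <= (b.1 - a.1) / D a b c * (y - g).
  rewrite -mulrAC -e1 -mulrAC -e2 (triangle_DP _ d0); split=> [[]//|[h1 h2]].
  split=> //.
  have -> : D (x, y) b c / D a b c = 1 - D a (x,y) c / D a b c - D a b (x,y) / D a b c.
    by apply: (mulIf d0); rewrite !mulrBl !divfK// mul1r /D/=; ring.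
  set u := D a _ c / _ in h1 *; set w := D a b (x,y) / _ in h2 *.
  have ex : u * ((b.1 - a.1) / (x - a.1)) + w * ((c.1 - a.1) / (x - a.1)) = 1.
    have d0' := d0; rewrite /D in d0'.
    by rewrite /u /w /D /=; field; rewrite ?dx ?d0'.
  have ub : u <= u * ((b.1 - a.1) / (x - a.1)).
    by rewrite ler_peMr// -[X in _ <= X]invrK invf_div invf_ge1// ltW.
  have wc : w <= w * ((c.1 - a.1) / (x - a.1)).
    by rewrite ler_peMr// -[X in _ <= X]invrK invf_div invf_ge1// ltW.
  lra.
have sgn : 0 < ((c.1 - a.1) / D a b c) * ((b.1 - a.1) / D a b c).
  have -> : ((c.1 - a.1) / D a b c) * ((b.1 - a.1) / D a b c) =
    ((b.1 - a.1) / (c.1 - a.1)) * ((c.1 - a.1) / D a b c) ^+ 2 by field; rewrite ?dc ?d0.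
  by rewrite mulr_gt0// exprn_even_gt0//= mulf_neq0// invr_eq0.
have mg : 0 < (m - g) * ((c.1 - a.1) / D a b c).
  rewrite e3 (_ : _ * _ = (x - a.1) / (b.1 - a.1))//; field; by rewrite ?db ?dc ?d0.
have [c0|c0|c0] := ltrgt0P ((c.1 - a.1) / D a b c); last by rewrite c0 mulr0 ltxx in mg.
- have b0 : 0 < (b.1 - a.1) / D a b c by rewrite -(pmulr_rgt0 _ c0).
  have gm : g < m by rewrite -subr_gt0 -(pmulr_lgt0 _ c0).
  rewrite gtr0_norm ?subr_gt0// (_ : xsection _ _ = `[g, m]%classic).
    by rewrite lebesgue_measure_itv/= lte_fin gm EFinB.
  apply/seteqP; split => y; rewrite /xsection/= in_itv/=.
    by move=> /set_mem/tri; rewrite !pmulr_rge0// !subr_ge0 => -[-> ->].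
  by move=> /andP[? ?]; apply/mem_set/tri; rewrite !pmulr_rge0// !subr_ge0.
- have b0 : (b.1 - a.1) / D a b c < 0 by rewrite -(nmulr_rgt0 _ c0).
  have gm : m < g by rewrite -subr_lt0 -(nmulr_lgt0 _ c0).
  rewrite ltr0_norm ?subr_lt0// (_ : xsection _ _ = `[m, g]%classic).
    by rewrite lebesgue_measure_itv/= lte_fin gm -EFinB opprB.
  apply/seteqP; split => y; rewrite /xsection/= in_itv/=.
    by move=> /set_mem/tri; rewrite !nmulr_rge0// !subr_le0 => -[-> ->].
  by move=> /andP[? ?]; apply/mem_set/tri; rewrite !nmulr_rge0// !subr_le0.
Qed.

End TriangleSections.


Section TriangleMeasure.
Variable R : realType.
Implicit Types a b c p q : (R * R)%type.
Notation leb := (@lebesgue_measure R).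

Lemma xsection_outside a b c (x lo hi : R) :
  (forall p, [\/ p = a, p = b | p = c] -> lo <= p.1 <= hi) ->
  ~~ (lo <= x <= hi) -> xsection (triangle a b c) x = set0.
Proof.
move=> h xlh; apply/seteqP; split => // y; rewrite /xsection/= => /set_mem T.
move/negP: xlh; apply.
pose C := [set p : R * R | lo <= p.1 <= hi].
suff /(_ (x, y) T) : triangle a b c `<=` C by [].
apply: hull_sub.
  apply/convex_setE => p q t t0 t1 /= /andP[p1 p2] /andP[q1 q2].
  rewrite /C /= /GRing.scale/=; nra.
by move=> p [[]|] ->; apply: h; [constructor 1|constructor 2|constructor 3].
Qed.

(** Fubini: the middle abscissa cuts the triangle into two parts, in which the
vertical sections grow linearly from the vertices [a] and [c]. The abscissae of the
vertices are removed from the domain, since [triangle_section] needs strict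
inequalities. *)
Lemma measure_triangle_sorted a b c : D a b c != 0 ->
  a.1 <= b.1 -> b.1 <= c.1 -> a.1 < c.1 ->
  (leb \x leb)%E (triangle a b c) = (`|D a b c| / 2)%:E.
Proof.
move=> d0 ab bc ac.
pose k1 : R := `|D a b c / ((b.1 - a.1) * (c.1 - a.1))|.
pose k2 : R := `|D a b c / ((c.1 - b.1) * (c.1 - a.1))|.
pose f1 : R -> \bar R := fun x => (k1 * (x - a.1))%:E.
pose f2 : R -> \bar R := fun x => (- k2 * (x - c.1))%:E.
have mlin (k d : R) : measurable_fun [set: R] (fun x : R => (k * (x - d))%:E).
  apply/measurable_EFinP; apply: measurable_funM => //; apply: measurable_funB => //.
pose I1 : set R := `[a.1, b.1]%classic; pose I2 : set R := `[b.1, c.1]%classic.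
have mf1 : measurable_fun setT (f1 \_ I1).
  apply/(measurable_restrictT _ _).1; first exact: measurable_itv.
  by apply: measurable_funTS; apply: mlin.
have mf2 : measurable_fun setT (f2 \_ I2).
  apply/(measurable_restrictT _ _).1; first exact: measurable_itv.
  by apply: measurable_funTS; apply: mlin.
have f10 x : (0 <= (f1 \_ I1) x)%E.
  apply: erestrict_ge0 => y; rewrite /I1/= in_itv/= => /andP[? ?].
  by rewrite lee_fin mulr_ge0 ?normr_ge0 ?subr_ge0.
have f20 x : (0 <= (f2 \_ I2) x)%E.
  apply: erestrict_ge0 => y; rewrite /I2/= in_itv/= => /andP[? ?].
  by rewrite lee_fin (_ : - k2 * _ = k2 * (c.1 - y)) ?mulr_ge0 ?normr_ge0 ?subr_ge0//; ring.
pose N : set R := [set a.1; b.1; c.1].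
have mN : measurable N.
  by apply: measurableU; [apply: measurableU|]; apply: measurable_set1.
have N0 : leb N = 0%E.
  have m1 (x : R) : measurable [set x] by exact: measurable_set1.
  have U0 (A B : set R) : measurable A -> measurable B -> leb A = 0%E ->
      leb B = 0%E -> leb (A `|` B) = 0%E.
    by move=> mA mB A0 B0; rewrite measureU0.
  by apply: (U0); [apply: measurableU| |apply: U0|]; rewrite ?lebesgue_measure_set1.
rewrite [LHS](_ : _ = \int[leb]_(x in setT) (leb \o xsection (triangle a b c)) x)%E//.
rewrite (@ge0_negligible_integral _ _ _ leb setT N)//; last first.
  by apply: measurable_fun_xsection; exact: (measurable_triangle d0).
have -> : (\int[leb]_(x in setT `\` N) (leb \o xsection (triangle a b c)) x =
   \int[leb]_(x in setT `\` N) ((f1 \_ I1) x + (f2 \_ I2) x))%E.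
  apply: eq_integral => x /set_mem [_ /= xN].
  have [xa xb xc] : [/\ x != a.1, x != b.1 & x != c.1].
    by split; apply: contra_notN xN => /eqP ->; [left; left|left; right|right].
  have out : ~~ (a.1 <= x <= c.1) -> leb (xsection (triangle a b c) x) = 0%E.
    move=> h; rewrite (xsection_outside _ h) ?measure0// => p.
    by move=> [] ->; rewrite ?lexx ?ab ?bc ?(ltW ac)//=  (le_trans ab bc).
  rewrite /patch /I1 /I2 !mem_setE !in_itv/=.
  have [xA|Ax] := ltP x a.1.
    have -> : (b.1 <= x) = false by apply/negbTE; rewrite -ltNge; lra.
    by rewrite /= adde0; apply: out; rewrite negb_and -ltNge xA.
  have {}Ax : a.1 < x by rewrite lt_neqAle eq_sym xa.
  have [Bx|xB] /= := leP x b.1.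
    have {}Bx : x < b.1 by rewrite lt_neqAle xb.
    rewrite lt_geF//= adde0 triangle_section//.
    - congr EFin; rewrite normrM (gtr0_norm (_ : 0 < x - _)) ?subr_gt0//.
    - by rewrite divr_gt0 ?ltr_pdivrMr ?mul1r ?subr_gt0//; lra.
    - by rewrite divr_gt0 ?ltr_pdivrMr ?mul1r ?subr_gt0//; lra.
  rewrite (ltW xB)/= add0e.
  have [xC|Cx] := leP x c.1; last by apply: out; rewrite negb_and -(ltNge c.1) Cx orbT.
  have {}xC : x < c.1 by rewrite lt_neqAle xc.
  have dE : D c b a = - D a b c by rewrite /D; ring.
  rewrite triangleCA triangleAC triangleCA triangle_section ?dE ?oppr_eq0//.
  - congr EFin; rewrite (_ : (b.1 - c.1) * _ = (c.1 - b.1) * (c.1 - a.1)); last by ring.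
    rewrite normrM mulNr normrN -/k2 (ltr0_norm (_ : x - _ < 0)) ?subr_lt0//.
    by rewrite mulNr mulrN.
  - have -> : (x - c.1) / (b.1 - c.1) = (c.1 - x) / (c.1 - b.1).
      by rewrite -[LHS]mulrNN -invrN !opprB.
    by rewrite divr_gt0 ?ltr_pdivrMr ?mul1r ?subr_gt0//; lra.
  - have -> : (x - c.1) / (a.1 - c.1) = (c.1 - x) / (c.1 - a.1).
      by rewrite -[LHS]mulrNN -invrN !opprB.
    by rewrite divr_gt0 ?ltr_pdivrMr ?mul1r ?subr_gt0//; lra.
rewrite -(@ge0_negligible_integral _ _ _ leb setT N)//; [|exact: emeasurable_funD|
  by move=> x _; rewrite adde_ge0].
rewrite ge0_integralD// -!integral_mkcond !integral_linear//.
rewrite -EFinD; congr EFin; rewrite !subrr /k1 /k2 !normrM !normfV !normrM.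
rewrite (gtr0_norm (_ : 0 < c.1 - a.1)) ?subr_gt0//.
rewrite (ger0_norm (_ : 0 <= b.1 - a.1)) ?subr_ge0//.
rewrite (ger0_norm (_ : 0 <= c.1 - b.1)) ?subr_ge0//.
have ca0 : c.1 - a.1 != 0 by rewrite subr_eq0 gt_eqF.
have [e1|ne1] := eqVneq b.1 a.1.
  by rewrite e1 subrr !mul0r invr0 mulr0 !mul0r add0r; field.
have [e2|ne2] := eqVneq b.1 c.1.
  by rewrite e2 subrr !mul0r invr0 mulr0 oppr0 !mul0r addr0; field.
have cb0 : c.1 - b.1 != 0 by rewrite subr_eq0 eq_sym.
have ba0 : b.1 - a.1 != 0 by rewrite subr_eq0.
by field; rewrite ?ba0 ?cb0 ?ca0.
Qed.

Lemma DCA a b c : D b a c = - D a b c. Proof. by rewrite /D; ring. Qed.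
Lemma DAC a b c : D a c b = - D a b c. Proof. by rewrite /D; ring. Qed.

Lemma measure_triangle a b c : D a b c != 0 ->
  (leb \x leb)%E (triangle a b c) = (`|D a b c| / 2)%:E.
Proof.
have sw1 x y z : (leb \x leb)%E (triangle y x z) = (`|D y x z| / 2)%:E ->
   (leb \x leb)%E (triangle x y z) = (`|D x y z| / 2)%:E.
  by rewrite triangleCA DCA normrN.
have sw2 x y z : (leb \x leb)%E (triangle x z y) = (`|D x z y| / 2)%:E ->
   (leb \x leb)%E (triangle x y z) = (`|D x y z| / 2)%:E.
  by rewrite triangleAC DAC normrN.
have main x y z : D x y z != 0 -> x.1 <= y.1 -> y.1 <= z.1 ->
   (leb \x leb)%E (triangle x y z) = (`|D x y z| / 2)%:E.
  move=> d0 xy yz; apply: measure_triangle_sorted => //.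
  rewrite lt_neqAle (le_trans xy yz) andbT; apply: contraNneq d0 => xz.
  by rewrite /D xz (_ : y.1 = z.1); [apply/eqP; ring|lra].
move=> d0.
have d1 : D a c b != 0 by rewrite DAC oppr_eq0.
have d2 : D b a c != 0 by rewrite DCA oppr_eq0.
have d3 : D b c a != 0 by rewrite DAC oppr_eq0.
have d4 : D c a b != 0 by rewrite DCA oppr_eq0.
have d5 : D c b a != 0 by rewrite DAC oppr_eq0.
case: (leP a.1 b.1) => ab; case: (leP b.1 c.1) => bc; case: (leP a.1 c.1) => ac.
- exact: main.
- exact: main.
- by apply: (sw2); apply: main => //; exact: ltW.
- by apply: (sw2); apply: (sw1); apply: main => //; exact: ltW.
- by apply: (sw1); apply: main => //; exact: ltW.
- by apply: (sw1); apply: (sw2); apply: main => //; exact: ltW.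
- by apply: (sw1); apply: (sw2); apply: (sw1); apply: main => //; lra.
- by apply: (sw1); apply: (sw2); apply: (sw1); apply: main => //; lra.
Qed.

Lemma area_triangle a b c : D a b c != 0 -> area (triangle a b c) = `|D a b c| / 2.
Proof. by move=> d0; rewrite /area measure_triangle. Qed.

(** The sections of a subset of a line are points, unless the line is vertical, and
then only one section is not empty: the double integral vanishes in both cases. *)
Lemma area_line (S : set (R * R)%type) (al be ga : R) : (al, be) != 0 ->
  S `<=` [set p | al * p.1 + be * p.2 = ga] -> area (hull S) = 0.
Proof.
move=> ab0 SL.
have HL : hull S `<=` [set p | al * p.1 + be * p.2 = ga].
  apply: hull_sub => //; apply/convex_setE => p q t t0 t1 /= hp hq.
  rewrite /GRing.scale/= -[RHS](_ : t * ga + (1 - t) * ga = ga); last by ring.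
  by rewrite -{1}hp -hq; ring.
rewrite /area /product_measure1.
have [b0|b0] := eqVneq be 0.
  have a0 : al != 0 by move: ab0; rewrite b0; apply: contraNneq => ->.
  pose A : set R := [set ga / al].
  rewrite (_ : (fun _ => _) = ((leb \o xsection (hull S)) \_ A)).
    by rewrite -integral_mkcond integral_set1.
  apply/funext => x; rewrite /patch; case: ifPn => // /negP xA /=.
  rewrite (_ : xsection _ _ = set0) ?measure0//.
  apply/seteqP; split => // y /set_mem/HL /=; rewrite b0 mul0r addr0 => h.
  by apply: xA; apply/mem_set; rewrite /A/= -h mulrAC divff// mul1r.
rewrite integral0_eq// => x _ /=.
have sub : xsection (hull S) x `<=` [set (ga - al * x) / be].
  by move=> y /set_mem/HL /= <-; rewrite addrAC subrr add0r mulrAC divff// mul1r.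
have [e|/set0P[y hy]] := eqVneq (xsection (hull S) x) set0; first by rewrite e measure0.
rewrite (_ : xsection (hull S) x = [set (ga - al * x) / be]) ?lebesgue_measure_set1//.
by apply/seteqP; split => // z /= ->; rewrite -(sub _ hy).
Qed.
End TriangleMeasure.


(** * Multisets of vertices *)

Section Multisets.
Implicit Types K : mset10.

Lemma mremoveE K i j : mremove K i j = (K j - (j == i))%N.
Proof. by rewrite ffunE. Qed.

Lemma mremoveC K i j : mremove (mremove K i) j = mremove (mremove K j) i.
Proof. by apply/ffunP => l; rewrite !ffunE subnAC. Qed.

Lemma mremove_le K i j : (mremove K i j <= K j)%N.
Proof. by rewrite ffunE leq_subr. Qed.

Lemma mcard_remove K i : (0 < K i)%N -> mcard K = (mcard (mremove K i)).+1.
Proof.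
move=> Ki; rewrite /mcard (bigD1 i)//= [in RHS](bigD1 i)//= ffunE eqxx -addSn subn1.
by rewrite prednK//; congr addn; apply: eq_bigr => j ji; rewrite ffunE (negbTE ji) subn0.
Qed.

Definition mset3 (i j k : 'I_10) : mset10 :=
  [ffun l => ((l == i) + (l == j) + (l == k))%N].

Definition madd K i : mset10 := [ffun l => (K l + (l == i))%N].

Lemma madd_remove K i : (0 < K i)%N -> madd (mremove K i) i = K.
Proof.
move=> Ki; apply/ffunP => l; rewrite !ffunE; case: eqVneq => [->|_] /=; [by rewrite subnK|by rewrite subn0 addn0].
Qed.

Lemma remove_madd K i : mremove (madd K i) i = K.
Proof. by apply/ffunP => l; rewrite !ffunE addnK. Qed.

Lemma mcard_gt0 K n : mcard K = n.+1 -> exists i, (0 < K i)%N.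
Proof.
move=> cK; case: (pickP (fun i => 0 < K i)%N) => [i|h]; first by exists i.
by move: cK; rewrite /mcard big1// => i _; apply/eqP; rewrite -leqn0 leqNgt h.
Qed.

Lemma mcard0 K : mcard K = 0%N -> K = [ffun=> 0%N].
Proof.
by move/eqP; rewrite /mcard sum_nat_eq0 => /forallP h; apply/ffunP => i; rewrite ffunE;
  apply/eqP; exact: h.
Qed.

Lemma mcard3P K : mcard K = 3%N -> exists i j k, K = mset3 i j k.
Proof.
move=> c3; have [i Ki] := mcard_gt0 c3; move: c3; rewrite (mcard_remove Ki) => -[] c2.
have [j Kj] := mcard_gt0 c2; move: c2; rewrite (mcard_remove Kj) => -[] c1.
have [k Kk] := mcard_gt0 c1; move: c1; rewrite (mcard_remove Kk) => -[] /mcard0 c0.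
exists i, j, k; apply/ffunP => l.
rewrite -[in LHS](madd_remove Ki) -(madd_remove Kj) -(madd_remove Kk) c0 !ffunE.
lia.
Qed.

Lemma mcard4P K : mcard K = 4%N -> exists i j k l, K = madd (mset3 i j k) l.
Proof.
move=> c4; have [l Kl] := mcard_gt0 c4; move: c4; rewrite (mcard_remove Kl) => -[].
by move=> /mcard3P [i [j [k e]]]; exists i, j, k, l; rewrite -e madd_remove.
Qed.
End Multisets.

(** * The recursion and its independence of the coordinates *)
Section Recursion.
Variables (R : realType) (v : 'I_10 -> R * R).
Implicit Types (K : mset10) (x y : (R * R)%type) (i j k : 'I_10).

(** The combinatorial form of [area([K]) = 0], see [area_eq0]. *)
Definition degen K : bool := [forall i, forall j, forall k,
  [&& 0 < K i, 0 < K j & 0 < K k]%N ==> (D (v i) (v j) (v k) == 0)].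

Lemma degenPn K : ~~ degen K -> exists i j k,
  [/\ (0 < K i)%N, (0 < K j)%N, (0 < K k)%N & D (v i) (v j) (v k) != 0].
Proof.
rewrite negb_forall => /existsP[i]; rewrite negb_forall => /existsP[j].
rewrite negb_forall => /existsP[k]; rewrite negb_imply => /andP[/and3P[? ? ?] ?].
by exists i, j, k.
Qed.

Lemma degenP K i j k : degen K -> (0 < K i)%N -> (0 < K j)%N -> (0 < K k)%N ->
  D (v i) (v j) (v k) = 0.
Proof.
by move=> /forallP/(_ i)/forallP/(_ j)/forallP/(_ k)/implyP h Ki Kj Kk;
  apply/eqP/h; rewrite Ki Kj.
Qed.

Lemma degen_sub K K' : (forall i, K' i <= K i)%N -> degen K -> degen K'.
Proof.
move=> s dK; do 3 (apply/forallP => ?); apply/implyP => /and3P[h1 h2 h3].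
by apply/eqP/(degenP dK); apply: leq_trans (s _).
Qed.

Lemma degen_remove K i : degen K -> degen (mremove K i).
Proof. by apply: degen_sub => j; exact: mremove_le. Qed.

(** The recursion of [simplex_rec], started from arbitrary values [b] on the multisets
of three points. With values that do not depend on [x] it computes a polynomial, and it
is linear in [b]: the difference of two polynomial pieces of a simplex spline is again
of this form. *)
Fixpoint srec (b : mset10 -> R) (n : nat) K x : R :=
  if degen K then 0 else
  match n with
  | 0%N => b K
  | n'.+1 => let be := xget [ffun=> 0] (bary v K x) in
             \sum_j be j * srec b n' (mremove K j) x
  end.

Lemma srec_degen b n K x : degen K -> srec b n K x = 0.
Proof. by case: n => [|n] /= ->. Qed.

Lemma srecB b b' n K x :
  srec (fun L => b L - b' L) n K x = srec b n K x - srec b' n K x.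
Proof.
elim: n K => [|n IH] K /=; case: ifP => _; rewrite ?subr0//.
by rewrite -sumrB; apply: eq_bigr => j _; rewrite IH mulrBr.
Qed.

Lemma baryP K x (b : {ffun 'I_10 -> R}) : bary v K x b <->
  [/\ x.1 = \sum_j b j * (v j).1, x.2 = \sum_j b j * (v j).2, \sum_j b j = 1 &
      forall j, K j = 0%N -> b j = 0].
Proof.
have s1 : (\sum_j b j *: v j).1 = \sum_j b j * (v j).1.
  by rewrite (big_morph (fun p : R * R => p.1) (id1 := 0) (op1 := +%R)).
have s2 : (\sum_j b j *: v j).2 = \sum_j b j * (v j).2.
  by rewrite (big_morph (fun p : R * R => p.2) (id1 := 0) (op1 := +%R)).
split=> [[-> ? ?]|[x1 x2 ? ?]]; first by rewrite s1 s2.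
by split => //; apply: pairE; rewrite ?s1 ?s2.
Qed.

Definition weights3 i j k (a b c : R) : {ffun 'I_10 -> R} :=
  [ffun l => (l == i)%:R * a + (l == j)%:R * b + (l == k)%:R * c].

Lemma sum_delta i (f : 'I_10 -> R) : \sum_l (l == i)%:R * f l = f i.
Proof.
by rewrite (bigD1 i)//= eqxx mul1r big1 ?addr0// => l /negbTE ->; rewrite mul0r.
Qed.

Lemma sum_weights3 i j k a b c (f : 'I_10 -> R) :
  \sum_l weights3 i j k a b c l * f l = a * f i + b * f j + c * f k.
Proof.
under eq_bigr do rewrite ffunE !mulrDl -!mulrA.
by rewrite !big_split/= !sum_delta.
Qed.

Lemma bary_weights3 K i j k a b c x :
  (0 < K i)%N -> (0 < K j)%N -> (0 < K k)%N -> a + b + c = 1 ->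
  x = a *: v i + b *: v j + c *: v k -> bary v K x (weights3 i j k a b c).
Proof.
move=> Ki Kj Kk s ->; apply/baryP; rewrite !sum_weights3; split => //.
  have := sum_weights3 i j k a b c (fun=> 1).
  by under eq_bigr do rewrite mulr1; move=> ->; rewrite !mulr1.
move=> l Kl; rewrite ffunE; do 3 (case: eqVneq => [e|_]; [by rewrite -e Kl in Ki Kj Kk|]).
by rewrite !mul0r !addr0.
Qed.

Lemma bary_exists K x : ~~ degen K -> exists b, bary v K x b.
Proof.
move=> /degenPn[i [j [k [Ki Kj Kk d0]]]]; have [s e] := bary_coord x d0.
by eexists; apply: (bary_weights3 Ki Kj Kk s e).
Qed.

Definition dependency K (g : 'I_10 -> R) :=
  [/\ \sum_j g j * (v j).1 = 0, \sum_j g j * (v j).2 = 0, \sum_j g j = 0 &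
      forall j, K j = 0%N -> g j = 0].

(** Independence of the coordinates for four points, where two choices of barycentric
coordinates differ by a dependency. It implies independence for all larger multisets
([srecE]). *)
Definition consistent (b : mset10 -> R) := forall K g, mcard K = 4%N ->
  dependency K g -> forall x, \sum_j g j * srec b 0 (mremove K j) x = 0.

Lemma srec_choice b n (P : forall K g, mcard K = n.+4 -> dependency K g ->
    forall x, \sum_j g j * srec b n (mremove K j) x = 0) K x be :
  mcard K = n.+4 -> bary v K x be ->
  srec b n.+1 K x = \sum_j be j * srec b n (mremove K j) x.
Proof.
move=> cK hb /=; case: ifPn => [dK|ndK].
  by rewrite big1// => j _; rewrite srec_degen ?mulr0//; exact: degen_remove.
set c := xget _ _; have hc : bary v K x c by apply: xgetPex; exists be.
apply/eqP; rewrite -subr_eq0 -sumrB; apply/eqP.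
rewrite -[RHS](P K (fun j => c j - be j) cK _ x).
  by apply: eq_bigr => j _; rewrite mulrBl.
move/baryP: hb => [b1 b2 b3 b4]; move/baryP: hc => [c1 c2 c3 c4].
split; try by under eq_bigr do rewrite mulrBl; rewrite sumrB -?b1 -?b2 -?c1 -?c2 subrr.
  by rewrite sumrB b3 c3 subrr.
by move=> j Kj; rewrite b4// c4// subrr.
Qed.

(** Induction on the size of [K]. If [g j] is not zero, the coordinates
[be - (be j / g j) * g] do not involve [j], so they can be used to expand the spline of
[K] without [j]. In the resulting double sum each term changes sign when the two
removed points are exchanged. *)
Lemma srec_dependency b n K g x : consistent b -> mcard K = n.+4 ->
  dependency K g -> \sum_j g j * srec b n (mremove K j) x = 0.
Proof.
move=> cb; elim: n K g x => [|n IH] K g x; first by move=> cK dg; exact: cb.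
move=> cK dg; have [dK|ndK] := boolP (degen K).
  by rewrite big1// => j _; rewrite srec_degen ?mulr0//; exact: degen_remove.
have [be hb] := bary_exists x ndK.
move/baryP: (hb) => [b1 b2 b3 b4]; move: (dg) => [g1 g2 g3 g4].
pose S j i := srec b n (mremove (mremove K j) i) x.
have key j : g j * srec b n.+1 (mremove K j) x =
    \sum_i (g j * be i * S j i - be j * g i * S j i).
  have [Kj|Kj] := posnP (K j).
    by rewrite g4// b4// mul0r big1// => i _; rewrite !mul0r subrr.
  have cj : mcard (mremove K j) = n.+4 by move: cK; rewrite (mcard_remove Kj) => -[].
  have [gj|gj] := eqVneq (g j) 0.
    rewrite gj mul0r; under eq_bigr do rewrite !mul0r sub0r -mulrA -mulrN mulrN.
    rewrite sumrN -mulr_sumr (IH (mremove K j) g)// ?mulr0 ?oppr0//.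
    split=> // i; rewrite mremoveE; case: eqVneq => [->//|_]; rewrite subn0; exact: g4.
  pose bj : {ffun 'I_10 -> R} := [ffun i => be i - be j / g j * g i].
  rewrite (@srec_choice b n (fun K g cK dg x => IH K g x cK dg) _ _ bj)//.
    rewrite mulr_sumr; apply: eq_bigr => i _; rewrite ffunE /S.
    by rewrite mulrA -mulrBl mulrBr; congr ((_ - _) * _); field.
  apply/baryP; split.
  - under eq_bigr do rewrite ffunE mulrBl -(mulrA (be j / g j)).
    by rewrite sumrB -mulr_sumr g1 mulr0 subr0.
  - under eq_bigr do rewrite ffunE mulrBl -(mulrA (be j / g j)).
    by rewrite sumrB -mulr_sumr g2 mulr0 subr0.
  - under eq_bigr do rewrite ffunE.
    by rewrite sumrB -mulr_sumr g3 mulr0 subr0.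
  - move=> i; rewrite mremoveE ffunE; case: eqVneq => [->|_] h; first by field.
    have Ki : K i = 0%N by rewrite -[LHS]subn0.
    by rewrite (g4 _ Ki) (b4 _ Ki) mulr0 subrr.
under eq_bigr do rewrite key sumrB.
rewrite sumrB; apply/eqP; rewrite subr_eq0; apply/eqP; rewrite exchange_big/=.
by apply: eq_bigr => i _; apply: eq_bigr => j _; rewrite /S mremoveC (mulrC (g j)).
Qed.

Lemma srecE b n K x be : consistent b -> mcard K = n.+4 -> bary v K x be ->
  srec b n.+1 K x = \sum_j be j * srec b n (mremove K j) x.
Proof.
by move=> cb; apply: srec_choice => L g cL dg y; exact: srec_dependency.
Qed.

Lemma srec3 b n K x i j k (a c e : R) : consistent b -> mcard K = n.+4 ->
  (0 < K i)%N -> (0 < K j)%N -> (0 < K k)%N -> a + c + e = 1 ->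
  x = a *: v i + c *: v j + e *: v k ->
  srec b n.+1 K x = a * srec b n (mremove K i) x + c * srec b n (mremove K j) x
                    + e * srec b n (mremove K k) x.
Proof.
move=> cb cK Ki Kj Kk s xe.
by rewrite (srecE cb cK (bary_weights3 Ki Kj Kk s xe)) sum_weights3.
Qed.

End Recursion.


(** * Areas of hulls and the values on three points *)

Section ProductMono.
Variable R : realType.
Notation leb := (@lebesgue_measure R).

Lemma lebesgue_measure_mono (A B : set R) : A `<=` B -> (leb A <= leb B)%E.
Proof. by move=> AB; apply: le_mu_ext. Qed.

(** The product measure of an arbitrary set is an integral of nonnegative measures of
sections, and both are monotone without measurability assumptions. This spares a
proof that hulls are measurable. *)
Lemma product_lebesgue_mono (A B : set (R * R)%type) : A `<=` B ->
  ((leb \x leb) A <= (leb \x leb) B)%E.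
Proof.
move=> AB; rewrite /product_measure1 !ge0_integralE//.
apply: ereal_sup_le => _ [h /= hA <-]; exists h => // x; apply: (le_trans (hA x)); rewrite !patch_setT /=.
by apply: lebesgue_measure_mono => y; rewrite /xsection/= => /set_mem/AB/mem_set.
Qed.
End ProductMono.

Section Base.
Variables (R : realType) (v : 'I_10 -> R * R).
Implicit Types (K : mset10) (x y : (R * R)%type) (i j k : 'I_10).
Notation leb := (@lebesgue_measure R).
Notation a1 := (v (ix 1)).
Notation a2 := (v (ix 2)).
Notation a3 := (v (ix 3)).
Notation T := (triangle a1 a2 a3).
Hypothesis D0 : D a1 a2 a3 != 0.
Hypothesis vT : forall j, T (v j).

Lemma area_degen K : degen v K -> area (mhull v K) = 0.
Proof.
move=> dK.
have [[i [j [Ki [Kj nij]]]]|h] := pselect (exists i j, (0 < K i)%N /\ (0 < K j)%N /\ v i != v j).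
  apply: (@area_line _ _ (- ((v j).2 - (v i).2)) ((v j).1 - (v i).1)
     ((v j).1 * (v i).2 - (v j).2 * (v i).1)).
    apply: contra_neq nij => -[/eqP]; rewrite oppr_eq0 !subr_eq0 => /eqP e2 /eqP.
    by rewrite subr_eq0 => /eqP e1; apply: pairE.
  move=> _ /= [k Kk <-]; have := degenP dK Ki Kj Kk; rewrite /D => e.
  by apply/eqP; rewrite -subr_eq0 -[X in _ == X]e; apply/eqP; ring.
have [[i Ki]|h0] := pselect (exists i, (0 < K i)%N).
  apply: (@area_line _ _ 1 0 (v i).1); first by rewrite xpair_eqE oner_eq0.
  move=> _ /= [k Kk <-]; rewrite mul1r mul0r addr0.
  by have [->//|n] := eqVneq (v k) (v i); case: h; exists k, i.
apply: (@area_line _ _ 1 0 0); first by rewrite xpair_eqE oner_eq0.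
by move=> p /= [k Kk _]; case: h0; exists k.
Qed.

(** The hull contains a nondegenerate triangle and is contained in the triangle [T];
the second inclusion makes its measure finite, so that [fine] is faithful. *)
Lemma area_nondegen K : ~~ degen v K -> 0 < area (mhull v K).
Proof.
move=> /degenPn[i [j [k [Ki Kj Kk d0]]]].
have le1 : ((leb \x leb) (triangle (v i) (v j) (v k)) <= (leb \x leb) (mhull v K))%E.
  apply: product_lebesgue_mono; apply: hull_sub; first exact: hull_convex.
  move=> p [[]|] ->; apply: hull_incl; [exists i|exists j|exists k]; done.
have le2 : ((leb \x leb) (mhull v K) <= (leb \x leb) T)%E.
  apply: product_lebesgue_mono; apply: hull_sub; first exact: hull_convex.
  by move=> _ [l _ <-].
move: le1 le2; rewrite !measure_triangle// => le1 le2.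
rewrite /area -lte_fin fineK.
  by apply: lt_le_trans le1; rewrite lte_fin divr_gt0 ?normr_gt0.
apply/fin_real/andP; split.
  by apply: lt_le_trans le1; rewrite ltNyr.
by apply: le_lt_trans le2 _; rewrite ltry.
Qed.

Lemma area_eq0 K : (area (mhull v K) == 0) = degen v K.
Proof.
by have [/area_degen ->|/area_nondegen/gt_eqF //] := boolP (degen v K); rewrite eqxx.
Qed.

Definition base y K : R := \1_(mhull v K) y * area T / area (mhull v K).

Lemma simplex_recE n K x : simplex_rec v n K x = srec v (base x) n K x.
Proof.
elim: n K => [|n IH] K /=; rewrite area_eq0 //.
by case: ifP => // _; apply: eq_bigr => j _; rewrite IH.
Qed.

Lemma mset3_gt0 i j k l : (0 < mset3 i j k l)%N = [|| l == i, l == j | l == k].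
Proof. by rewrite ffunE; do 3 (case: eqVneq => _ //). Qed.

Lemma degen_mset3 i j k : degen v (mset3 i j k) = (D (v i) (v j) (v k) == 0).
Proof.
apply/idP/eqP => [d|d].
  by apply: (degenP d); rewrite mset3_gt0 eqxx ?orbT.
apply/forallP => p; apply/forallP => q; apply/forallP => r; apply/implyP.
move=> /and3P[]; rewrite !mset3_gt0 => hp hq hr; apply/eqP.
move: d; rewrite /D => d.
by move: hp hq hr => /or3P[] /eqP -> /or3P[] /eqP -> /or3P[] /eqP ->; 
  rewrite -?[RHS]d //; lra.
Qed.

Lemma mhull_mset3 i j k : mhull v (mset3 i j k) = triangle (v i) (v j) (v k).
Proof.
rewrite /mhull /triangle; congr hull; apply/seteqP; split => [_ /= [l hl <-]|p].
  move: hl; rewrite /= mset3_gt0 => hl.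
  by case/or3P: hl => /eqP ->; [left; left|left; right|right].
by move=> [[]|] ->; [exists i|exists j|exists k] => //=; rewrite mset3_gt0 eqxx ?orbT.
Qed.

(** The number of turns of the closed path [a, b, c] around [y]. Unlike the indicator
function of the triangle it alternates in [a, b, c], and so it satisfies a linear relation
([winding_cocycle]). *)
Definition winding (y a b c : R * R) : R :=
  if [&& 0 < D y b c, 0 < D a y c & 0 < D a b y] then 1 else
  if [&& D y b c < 0, D a y c < 0 & D a b y < 0] then -1 else 0.

Lemma srec_base3 i j k y x :
  (forall p q, v p != v q -> D y (v p) (v q) != 0) ->
  srec v (base y) 0 (mset3 i j k) x =
  `|D a1 a2 a3| * (winding y (v i) (v j) (v k) / D (v i) (v j) (v k)).
Proof.
move=> gy; rewrite /= degen_mset3; case: eqVneq => [->|d0].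
  by rewrite invr0 !mulr0.
rewrite /base mhull_mset3 !area_triangle//.
have [ij jk ki] := D_neq d0; have ik : v i != v k by rewrite eq_sym.
have e2 : D (v i) y (v k) = - D y (v i) (v k) by rewrite /D; ring.
have e3 : D (v i) (v j) y = D y (v i) (v j) by rewrite /D; ring.
have n1 : D y (v j) (v k) != 0 by exact: gy.
have n2 : D (v i) y (v k) != 0 by rewrite e2 oppr_eq0; exact: gy.
have n3 : D (v i) (v j) y != 0 by rewrite e3; exact: gy.
have s : D y (v j) (v k) + D (v i) y (v k) + D (v i) (v j) y = D (v i) (v j) (v k).
  by rewrite /D; ring.
have -> : (\1_(triangle (v i) (v j) (v k)) y : R) =
    winding y (v i) (v j) (v k) * Num.sg (D (v i) (v j) (v k)).
  rewrite indicE; have -> : (y \in triangle (v i) (v j) (v k)) =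
    [&& 0 <= D y (v j) (v k) / D (v i) (v j) (v k), 
        0 <= D (v i) y (v k) / D (v i) (v j) (v k) &
        0 <= D (v i) (v j) y / D (v i) (v j) (v k)].
    apply/idP/and3P => [/set_mem/(triangle_DP _ d0)[]//|h].
    by apply/mem_set/(triangle_DP _ d0).
  rewrite /winding; case: (ltrgtP (D (v i) (v j) (v k)) 0) d0 s => // dn _ s.
    rewrite ltr0_sg// !ler_ndivlMr// !mul0r !le_eqVlt ?(negbTE n1) ?(negbTE n2) ?(negbTE n3)/=.
    rewrite (_ : [&& 0 < _, 0 < _ & 0 < _] = false).
      by case: ifP => _; rewrite ?mul0r// mulrNN mulr1.
    by apply/negP => /and3P[p1 p2 p3]; lra.
  rewrite gtr0_sg// !ler_pdivlMr// !mul0r !le_eqVlt ![0 == _]eq_sym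
    ?(negbTE n1) ?(negbTE n2) ?(negbTE n3)/=.
  case: ifP => _; rewrite ?mulr1//; case: ifP => // /and3P[p1 p2 p3]; lra.
have -> : (D (v i) (v j) (v k))^-1 =
    Num.sg (D (v i) (v j) (v k)) / `|D (v i) (v j) (v k)|.
  by rewrite [in LHS](numEsg (D _ _ _)) invfM invr_sg.
by field; rewrite normr_eq0.
Qed.

End Base.


(** * The relation between the triangles on four points *)

Section FourPoints.
Variable R : realType.
Implicit Types a b c d y : (R * R)%type.

Definition sign3 (s t u : R) : R :=
  if [&& 0 < s, 0 < t & 0 < u] then 1 else
  if [&& s < 0, t < 0 & u < 0] then -1 else 0.

Lemma sign3_0 s t u : [|| s == 0, t == 0 | u == 0] -> sign3 s t u = 0.
Proof. by move=> /or3P[] /eqP ->; rewrite /sign3 ltxx ?andbF. Qed.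

Lemma sign3_alt s t u : sign3 s (- t) (- u) = - sign3 t (- s) u.
Proof.
by rewrite /sign3 !oppr_gt0 !oppr_lt0; case: (ltrgtP s 0) => _; case: (ltrgtP t 0) => _;
  case: (ltrgtP u 0) => _ //=; rewrite ?oppr0 ?opprK.
Qed.

Lemma sign3_rot s t u : sign3 s t u = sign3 u s t.
Proof.
by rewrite /sign3; case: (ltrgtP s 0) => _; case: (ltrgtP t 0) => _;
  case: (ltrgtP u 0) => _.
Qed.

Ltac mulsign x y :=
  first [have: 0 < x * y by rewrite pmulr_rgt0
        |have: 0 < x * y by rewrite nmulr_rgt0
        |have: x * y < 0 by rewrite pmulr_rlt0
        |have: x * y < 0 by rewrite nmulr_rlt0].

(** Six determinants of four vectors of the plane satisfy the Pluecker relation, which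
excludes the sign patterns that would violate the conclusion. *)
Lemma pluecker_sign (ab ac ad bc bd cd : R) :
  ab != 0 -> ac != 0 -> ad != 0 -> bc != 0 -> bd != 0 -> cd != 0 ->
  ab * cd - ac * bd + ad * bc = 0 ->
  sign3 cd (- bd) bc - sign3 cd (- ad) ac + sign3 bd (- ad) ab - sign3 bc (- ac) ab = 0.
Proof.
rewrite /sign3 !oppr_gt0 !oppr_lt0.
case: (ltrgtP ab 0) => // hab _; case: (ltrgtP ac 0) => // hac _;
case: (ltrgtP ad 0) => // had _; case: (ltrgtP bc 0) => // hbc _;
case: (ltrgtP bd 0) => // hbd _; case: (ltrgtP cd 0) => // hcd _ /= pl; try ring;
  exfalso; move: pl; mulsign ab cd; mulsign ac bd; mulsign ad bc; lra.
Qed.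

Lemma windingE y a b c : winding y a b c = sign3 (D y b c) (- D y a c) (D y a b).
Proof.
rewrite /winding /sign3.
have -> : D a y c = - D y a c by rewrite /D; ring.
by have -> : D a b y = D y a b by rewrite /D; ring.
Qed.

(** The faces of a tetrahedron, projected to the plane, turn zero times around [y] in
total. *)
Lemma winding_cocycle y a b c d :
  (forall p q, p \in [:: a; b; c; d] -> q \in [:: a; b; c; d] -> p != q ->
     D y p q != 0) ->
  winding y b c d - winding y a c d + winding y a b d - winding y a b c = 0.
Proof.
move=> g; rewrite !windingE.
have Dpp p : D y p p = 0 by rewrite /D; ring.
have Dop p q : D y p q = - D y q p by rewrite /D; ring.
have [ia ib ic id] : [/\ a \in [:: a; b; c; d], b \in [:: a; b; c; d],
   c \in [:: a; b; c; d] & d \in [:: a; b; c; d]] by rewrite !inE !eqxx ?orbT.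
have [<-|ab] := eqVneq a b.
  by rewrite Dpp !(@sign3_0 _ _ 0) ?eqxx ?orbT//; ring.
have [<-|ac] := eqVneq a c.
  rewrite Dpp (@sign3_0 (D y a d) _ 0) ?eqxx ?orbT// (@sign3_0 _ (- 0)) ?oppr0 ?eqxx ?orbT//.
  by rewrite (Dop b a) sign3_alt; ring.
have [<-|ad] := eqVneq a d.
  rewrite Dpp oppr0 (@sign3_0 _ 0) ?eqxx ?orbT// (@sign3_0 _ 0) ?eqxx ?orbT//.
  by rewrite (Dop b a) (Dop c a) opprK (sign3_rot (- _)); ring.
have [<-|bc] := eqVneq b c.
  by rewrite Dpp (@sign3_0 _ _ 0) ?eqxx ?orbT// (@sign3_0 0) ?eqxx//; ring.
have [<-|bd] := eqVneq b d.
  rewrite Dpp oppr0 (@sign3_0 _ 0) ?eqxx ?orbT// (@sign3_0 0) ?eqxx//.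
  by rewrite (Dop c b) (sign3_rot (- _)) sign3_alt; ring.
have [<-|cd] := eqVneq c d.
  by rewrite Dpp !(@sign3_0 0) ?eqxx//; ring.
by apply: pluecker_sign; rewrite ?g//; rewrite /D; ring.
Qed.

(** Up to sign, the coefficients of the dependency are proportional to the determinants
of the opposite triangles ([aff] below). Hence the sum is a multiple of the alternating
sum of winding numbers, which vanishes. *)
Lemma four_points y a b c d (ga gb gc gd : R) :
  (forall p q, p \in [:: a; b; c; d] -> q \in [:: a; b; c; d] -> p != q ->
     D y p q != 0) ->
  ga + gb + gc + gd = 0 ->
  ga * a.1 + gb * b.1 + gc * c.1 + gd * d.1 = 0 ->
  ga * a.2 + gb * b.2 + gc * c.2 + gd * d.2 = 0 ->
  ga * (winding y b c d / D b c d) + gb * (winding y a c d / D a c d)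
  + gc * (winding y a b d / D a b d) + gd * (winding y a b c / D a b c) = 0.
Proof.
move=> g s0 s1 s2.
have W p q r : (forall s t, s \in [:: p; q; r] -> t \in [:: p; q; r] -> s != t -> D y s t != 0) ->
    winding y p q r = winding y p q r / D p q r * D p q r.
  move=> gp; have [d0|d0] := eqVneq (D p q r) 0; last by rewrite divfK.
  rewrite d0 mulr0 /winding.
  have s : D y q r + D p y r + D p q y = 0 by rewrite -d0 /D; ring.
  by case: ifP => [/and3P[]|_]; [lra|case: ifP => [/and3P[]|//]; lra].
have gsub (s : seq (R * R)%type) : {subset s <= [:: a; b; c; d]} ->
    forall p q, p \in s -> q \in s -> p != q -> D y p q != 0.
  by move=> ss p q /ss ps /ss qs; apply: g.
have co := winding_cocycle g.
rewrite (W b c d) in co; last by apply: gsub => p; rewrite !inE => ->; rewrite orbT.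
rewrite (W a c d) in co; last by apply: gsub => p; rewrite !inE => /or3P[] ->; rewrite ?orbT.
rewrite (W a b d) in co; last by apply: gsub => p; rewrite !inE => /or3P[] ->; rewrite ?orbT.
rewrite (W a b c) in co; last by apply: gsub => p; rewrite !inE => /or3P[] ->; rewrite ?orbT.
set A := winding y b c d / _; set B := winding y a c d / _.
set C := winding y a b d / _; set E := winding y a b c / _.
rewrite -/A -/B -/C -/E in co.
have aff p q : ga * D a p q + gb * D b p q + gc * D c p q + gd * D d p q = 0.
  have -> : ga * D a p q + gb * D b p q + gc * D c p q + gd * D d p q =
     (p.2 - q.2) * (ga * a.1 + gb * b.1 + gc * c.1 + gd * d.1)
     + (q.1 - p.1) * (ga * a.2 + gb * b.2 + gc * c.2 + gd * d.2)
     + (p.1 * q.2 - p.2 * q.1) * (ga + gb + gc + gd) by rewrite /D; ring.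
  by rewrite s0 s1 s2 !mulr0 !addr0.
have D1 (p q : R * R) : D p p q = 0 by rewrite /D; ring.
have D2 (p q : R * R) : D p q p = 0 by rewrite /D; ring.
have Drot (p q r : R * R) : D p q r = D q r p by rewrite /D; ring.
have := aff c d; rewrite D1 D2 !mulr0 !addr0 => eab.
have := aff b d; rewrite D1 D2 !mulr0 !addr0 (DCA b c d) => eac.
have := aff b c; rewrite D1 D2 !mulr0 !addr0 (Drot d b c) => ead.
have := aff a d; rewrite D1 D2 !mulr0 add0r addr0 (DCA a b d) (DCA a c d) => ebc.
have := aff a c; rewrite D1 D2 !mulr0 add0r addr0 (DCA a b c) (Drot d a c) => ebd.
have := aff a b; rewrite D1 D2 !mulr0 !add0r (Drot c a b) (Drot d a b) => ecd.
have A0 : D b c d = 0 -> A = 0 by rewrite /A => ->; rewrite invr0 mulr0.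
have B0 : D a c d = 0 -> B = 0 by rewrite /B => ->; rewrite invr0 mulr0.
have C0 : D a b d = 0 -> C = 0 by rewrite /C => ->; rewrite invr0 mulr0.
have E0 : D a b c = 0 -> E = 0 by rewrite /E => ->; rewrite invr0 mulr0.
have cancel (u w : R) : u != 0 -> u * w = 0 -> w = 0.
  by move=> u0 /eqP; rewrite mulf_eq0 (negbTE u0) => /eqP.
have [za|za] := eqVneq (D b c d) 0; last first.
  apply: (cancel _ _ za); rewrite -[RHS](mulr0 ga) -co.
  have := congr1 (fun z => z * B) eab; have := congr1 (fun z => z * C) eac.
  have := congr1 (fun z => z * E) ead; rewrite /= !mul0r => h1 h2 h3.
  lra.
have [ga0|ga0] := eqVneq ga 0; last first.
  rewrite B0 ?C0 ?E0 ?A0//; first ring.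
  - by apply: (cancel _ _ ga0); move: ead; rewrite za mulr0 addr0.
  - by apply: (cancel _ _ ga0); move: eac; rewrite za oppr0 mulr0 addr0.
  - by apply: (cancel _ _ ga0); move: eab; rewrite za mulr0 addr0.
have [zb|zb] := eqVneq (D a c d) 0; last first.
  apply: (cancel _ _ zb); rewrite ga0 -[RHS](mulr0 (- gb)) -co A0//.
  have := congr1 (fun z => z * C) ebc; have := congr1 (fun z => z * E) ebd.
  rewrite /= !mul0r => h1 h2; lra.
have [gb0|gb0] := eqVneq gb 0; last first.
  rewrite B0 ?C0 ?E0 ?A0//; first ring.
  - by apply: (cancel _ _ gb0); move: ebd; rewrite zb; lra.
  - by apply: (cancel _ _ gb0); move: ebc; rewrite zb; lra.
have [zc|zc] := eqVneq (D a b d) 0; last first.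
  apply: (cancel _ _ zc); rewrite ga0 gb0 -[RHS](mulr0 gc) -co A0// B0//.
  have := congr1 (fun z => z * E) ecd; rewrite /= !mul0r => h1; lra.
rewrite A0 ?B0 ?C0 ?mulr0 ?add0r//.
have [zd|zd] := eqVneq (D a b c) 0; first by rewrite E0// mulr0.
have gc0 : gc = 0 by apply: (cancel _ _ zd); move: ecd; rewrite zc mulr0 addr0 mulrC.
by rewrite (_ : gd = 0) ?mul0r//; lra.
Qed.

End FourPoints.


(** * The values on three points are consistent *)

Section Consistent.
Variables (R : realType) (v : 'I_10 -> R * R).
Hypothesis D0 : D (v (ix 1)) (v (ix 2)) (v (ix 3)) != 0.
Hypothesis vT : forall j, triangle (v (ix 1)) (v (ix 2)) (v (ix 3)) (v j).

(** The weight of a repeated point is shared equally by its copies. *)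
Lemma sum_split (K : mset10) (g f : 'I_10 -> R) : (forall j, K j = 0%N -> g j = 0) ->
  \sum_j g j * f j = \sum_j (K j)%:R * (g j / (K j)%:R * f j).
Proof.
move=> g0; apply: eq_bigr => j _; have [Kj|Kj] := eqVneq (K j) 0%N.
  by rewrite g0// Kj !mul0r.
by field; rewrite pnatr_eq0.
Qed.

Lemma sum_mset4 i j k l (f : 'I_10 -> R) :
  \sum_m (madd (mset3 i j k) l m)%:R * f m = f i + f j + f k + f l.
Proof.
under eq_bigr do rewrite !ffunE !natrD !mulrDl.
by rewrite !big_split/= !sum_delta.
Qed.

(** Once the copies of a point are labelled separately, with equal weights, this is
[four_points]. *)
Lemma consistent_base y :
  (forall p q, v p != v q -> D y (v p) (v q) != 0) -> consistent v (base v y).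
Proof.
move=> gy K g /mcard4P[i [j [k [l ->]]]] [g1 g2 g3 g4] x.
set K' := madd _ _ in g4 *.
move: g1 g2; rewrite (sum_split _ g4) => g1; rewrite (sum_split _ g4) => g2.
have g3' : \sum_j g j * 1 = 0 by under eq_bigr do rewrite mulr1.
rewrite (sum_split _ g4) in g3'; rewrite (sum_split _ g4).
move: g1 g2 g3'; rewrite !sum_mset4.
have mr p q r s : mremove (madd (mset3 p q r) s) s = mset3 p q r by exact: remove_madd.
have rl : mremove K' l = mset3 i j k by exact: mr.
have rk : mremove K' k = mset3 i j l.
  by rewrite -(mr i j l k); congr mremove; apply/ffunP => m; rewrite !ffunE addnAC.
have rj : mremove K' j = mset3 i k l.
  rewrite -(mr i k l j); congr mremove; apply/ffunP => m; rewrite !ffunE; lia.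
have ri : mremove K' i = mset3 j k l.
  rewrite -(mr j k l i); congr mremove; apply/ffunP => m; rewrite !ffunE; lia.
rewrite rl rk rj ri !(srec_base3 D0)// => g1 g2 g3'.
set gi := g i / _ in g1 g2 g3' *; set gj := g j / _ in g1 g2 g3' *.
set gk := g k / _ in g1 g2 g3' *; set gl := g l / _ in g1 g2 g3' *.
have gen p q : p \in [:: v i; v j; v k; v l] -> q \in [:: v i; v j; v k; v l] ->
    p != q -> D y p q != 0.
  by rewrite !inE => /or4P[] /eqP -> /or4P[] /eqP ->; apply: gy.
have := @four_points R y (v i) (v j) (v k) (v l) gi gj gk gl gen.
rewrite !mulr1 in g3'; move=> /(_ g3' g1 g2) => e.
by rewrite -[RHS](mulr0 `|D (v (ix 1)) (v (ix 2)) (v (ix 3))|) -e; ring.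
Qed.

Lemma consistentB (b b' : mset10 -> R) : consistent v b -> consistent v b' ->
  consistent v (fun L => b L - b' L).
Proof.
move=> cb cb' K g cK dg x; under eq_bigr do rewrite srecB mulrBr.
by rewrite sumrB cb// cb'// subrr.
Qed.
End Consistent.

(** * Polynomial functions of two variables *)
Section Polynomials.
Variable R : realType.
Implicit Types (f g : R * R -> R) (d : nat).

(** Polynomial functions of total degree at most [d], presented by generators so that
properties follow by induction on the construction. *)
Inductive polyfun : nat -> (R * R -> R) -> Prop :=
| polyfun_cst c : polyfun 0 (fun=> c)
| polyfun_fst d f : polyfun d f -> polyfun d.+1 (fun p => p.1 * f p)
| polyfun_snd d f : polyfun d f -> polyfun d.+1 (fun p => p.2 * f p)
| polyfun_add d f g : polyfun d f -> polyfun d g -> polyfun d (fun p => f p + g p)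
| polyfunS d f : polyfun d f -> polyfun d.+1 f.

Lemma polyfun_ext d f g : f =1 g -> polyfun d f -> polyfun d g.
Proof. by move=> /funext ->. Qed.

Lemma polyfun_le d e f : (d <= e)%N -> polyfun d f -> polyfun e f.
Proof. by move=> /subnK <- pf; elim: (e - d)%N => // n; exact: polyfunS. Qed.

Lemma polyfunZ d c f : polyfun d f -> polyfun d (fun p => c * f p).
Proof.
elim=> [c'|{}d {}f _ IH|{}d {}f _ IH|{}d {}f g _ IHf _ IHg|{}d {}f _ IH].
- exact: polyfun_cst.
- by apply: (polyfun_ext _ (polyfun_fst IH)) => p; ring.
- by apply: (polyfun_ext _ (polyfun_snd IH)) => p; ring.
- by apply: (polyfun_ext _ (polyfun_add IHf IHg)) => p; ring.
- exact: polyfunS.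
Qed.

Lemma polyfun_affine d (a b c : R) f : polyfun d f ->
  polyfun d.+1 (fun p => (a * p.1 + b * p.2 + c) * f p).
Proof.
move=> pf; apply: (polyfun_ext _ (polyfun_add (polyfun_add (polyfun_fst (polyfunZ a pf))
  (polyfun_snd (polyfunZ b pf))) (polyfunS (polyfunZ c pf)))) => p.
ring.
Qed.

Lemma polyfunM d e f g : polyfun d f -> polyfun e g -> polyfun (d + e) (fun p => f p * g p).
Proof.
move=> pf pg; elim: pf => [c|{}d {}f _ IH|{}d {}f _ IH|{}d {}f f' _ IHf _ IHg|{}d {}f _ IH].
- by rewrite add0n; exact: polyfunZ.
- by apply: (polyfun_ext _ (polyfun_fst IH)) => p; ring.
- by apply: (polyfun_ext _ (polyfun_snd IH)) => p; ring.
- by apply: (polyfun_ext _ (polyfun_add IHf IHg)) => p; ring.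
- exact: polyfunS.
Qed.

Definition polynomial_fun f := exists d, polyfun d f.

Lemma polynomial_cst c : polynomial_fun (fun=> c).
Proof. by exists 0%N; exact: polyfun_cst. Qed.

Lemma polynomialD f g : polynomial_fun f -> polynomial_fun g -> polynomial_fun (fun p => f p + g p).
Proof.
move=> [d pf] [e pg]; exists (maxn d e).
by apply: polyfun_add; [apply: polyfun_le pf|apply: polyfun_le pg]; rewrite ?leq_maxl ?leq_maxr.
Qed.

Lemma polynomialM f g : polynomial_fun f -> polynomial_fun g -> polynomial_fun (fun p => f p * g p).
Proof. by move=> [d pf] [e pg]; exists (d + e)%N; exact: polyfunM. Qed.

Lemma polynomial_affine (a b c : R) : polynomial_fun (fun p => a * p.1 + b * p.2 + c).
Proof.
exists 1%N; apply: (polyfun_ext _ (polyfun_affine a b c (polyfun_cst 1))) => p.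
by rewrite mulr1.
Qed.

Lemma polynomial_continuous f : polynomial_fun f -> continuous f.
Proof.
move=> [d]; elim=> [c|{}d {}f _ IH|{}d {}f _ IH|{}d {}f g _ IHf _ IHg|//] p.
- exact: cst_continuous.
- by apply: (@cvgM _ _ (nbhs p) _ fst f); [exact: cvg_fst|exact: IH].
- by apply: (@cvgM _ _ (nbhs p) _ snd f); [exact: cvg_snd|exact: IH].
- by apply: (@cvgD _ _ _ (nbhs p) _ f g); [exact: IHf|exact: IHg].
Qed.

Lemma is_derive_lim f (p e : R * R) (l : R) :
  (h^-1 * (f (h *: e + p) - f p) @[h --> 0^'] --> l) -> is_derive p e f l.
Proof.
move=> cl; apply: DeriveDef; first exact: (cvgP l).
exact: (cvg_lim (@Rhausdorff R) cl).
Qed.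

Lemma is_derive_affine f (p e : R * R) (l : R) :
  (forall h, f (h *: e + p) = h * l + f p) -> is_derive p e f l.
Proof.
move=> fE; apply: is_derive_lim.
apply: (@cvg_near_cst _ _ l) => //.
near=> h; rewrite fE addrK mulrA mulVf ?mul1r//.
by near: h; exact: nbhs_dnbhs_neq.
Unshelve. all: by end_near. Qed.

Lemma is_derive_fst (p e : R * R) : is_derive p e (fst : R * R -> R) e.1.
Proof. exact: is_derive_affine. Qed.

Lemma is_derive_snd (p e : R * R) : is_derive p e (snd : R * R -> R) e.2.
Proof. exact: is_derive_affine. Qed.

Lemma polynomial_derive (e : R * R) f : polynomial_fun f ->
  exists2 df, polynomial_fun df & forall p, is_derive p e f (df p).
Proof.
move=> [d]; elim=> [c|{}d {}f pf [g pg dg]|{}d {}f pf [g pg dg]|{}d {}f f' _ [g pg dg] _ [g' pg' dg']|//].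
- by exists (fun=> 0); [exact: polynomial_cst|move=> p; exact: is_derive_cst].
- exists (fun p => p.1 * g p + f p * e.1).
    apply: polynomialD; [apply: polynomialM => //|apply: polynomialM].
    + by exists 1%N; apply: (polyfun_ext _ (polyfun_fst (polyfun_cst 1))) => p; rewrite mulr1.
    + by exists d.
    + exact: polynomial_cst.
  move=> p; exact: (is_deriveM (is_derive_fst p e) (dg p)).
- exists (fun p => p.2 * g p + f p * e.2).
    apply: polynomialD; [apply: polynomialM => //|apply: polynomialM].
    + by exists 1%N; apply: (polyfun_ext _ (polyfun_snd (polyfun_cst 1))) => p; rewrite mulr1.
    + by exists d.
    + exact: polynomial_cst.
  move=> p; exact: (is_deriveM (is_derive_snd p e) (dg p)).
- exists (fun p => g p + g' p); first exact: polynomialD.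
  by move=> p; exact: is_deriveD.
Qed.

Lemma polynomial_line f (x w : R * R) : polynomial_fun f ->
  exists q : {poly R}, forall s : R, f (x + s *: w) = q.[s].
Proof.
move=> [d]; elim=> [c|{}d {}f _ [q hq]|{}d {}f _ [q hq]|{}d {}f g _ [q hq] _ [q' hq']|//].
- by exists c%:P => s; rewrite hornerC.
- exists ((x.1%:P + w.1 *: 'X) * q) => s; rewrite hq !hornerE /= /GRing.scale/=.
  by rewrite (mulrC s).
- exists ((x.2%:P + w.2 *: 'X) * q) => s; rewrite hq !hornerE /= /GRing.scale/=.
  by rewrite (mulrC s).
- by exists (q + q') => s; rewrite hq hq' hornerD.
Qed.

(** In the induction the coefficients vanish outside [i + j <= d], while the sums run
over all large squares: this makes sums for different degrees comparable. *)
Lemma polyfun_poly2_on d f D : polyfun d f -> poly2_on d D f.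
Proof.
suff H : polyfun d f -> exists c : nat -> nat -> R,
   (forall i j, (d < i + j)%N -> c i j = 0) /\
   forall N x, (d <= N)%N -> f x = \sum_(i < N.+1) \sum_(j < N.+1) c i j * x.1 ^+ i * x.2 ^+ j.
  move=> /H[c [c0 fE]]; exists c => x _; rewrite (fE d)//; apply: eq_bigr => i _.
  rewrite [in RHS]big_mkcond/=; apply: eq_bigr => j _; case: leqP => // /c0 ->.
  by rewrite !mul0r.
elim=> [c|{}d {}f _ [c [c0 fE]]|{}d {}f _ [c [c0 fE]]
  |{}d {}f g _ [c [c0 fE]] _ [c' [c0' gE]]|{}d {}f _ [c [c0 fE]]].
- exists (fun i j => if (i == 0%N) && (j == 0%N) then c else 0); split.
    by move=> [|i] [|j].
  move=> N x _; rewrite big_ord_recl big_ord_recl/= !expr0 !mulr1.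
  rewrite big1 => [|j _]; last by rewrite !mul0r.
  by rewrite big1 ?addr0// => i _; rewrite big1// => j _; rewrite !mul0r.
- exists (fun i j => if i is i'.+1 then c i' j else 0); split.
    by move=> [//|i] j; rewrite addSn ltnS; exact: c0.
  move=> [//|N] x dN; rewrite (fE N)// big_distrr/= [RHS]big_ord_recl/=.
  rewrite [X in _ = X + _]big1 ?add0r => [|j _]; last by rewrite !mul0r.
  apply: eq_bigr => i _; rewrite big_distrr/= [RHS]big_ord_recr/=.
  rewrite c0 ?mul0r ?addr0; last by rewrite (leq_trans _ (leq_addl _ _)).
  by apply: eq_bigr => j _; rewrite exprS; ring.
- exists (fun i j => if j is j'.+1 then c i j' else 0); split.
    by move=> i [//|j]; rewrite addnS ltnS; exact: c0.
  move=> [//|N] x dN; rewrite (fE N)// big_distrr/= [RHS]big_ord_recr/=.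
  rewrite [X in _ = _ + X]big1 ?addr0 => [|[[|j] ?] _]; [|by rewrite !mul0r|]; last first.
    by rewrite /= c0 ?mul0r// (leq_trans _ (leq_addr _ _)).
  apply: eq_bigr => i _; rewrite big_distrr/= [RHS]big_ord_recl/= !mul0r add0r.
  by apply: eq_bigr => j _; rewrite /bump/= add1n exprS; ring.
- exists (fun i j => c i j + c' i j); split=> [i j h|N x dN].
    by rewrite c0// c0'// addr0.
  rewrite (fE N)// (gE N)// -big_split; apply: eq_bigr => i _.
  by rewrite -big_split; apply: eq_bigr => j _ /=; rewrite !mulrDl.
- exists c; split=> [i j h|N x dN]; first by rewrite c0// ltnW.
  by rewrite (fE N)// ltnW.
Qed.

End Polynomials.


(** * The jump of a simplex spline across a line *)

Section Jump.
Variables (R : realType) (v : 'I_10 -> R * R).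
Implicit Types (K L : mset10) (x y : (R * R)%type) (i j k l : 'I_10).

Lemma srec_polyfun b n K : consistent v b -> mcard K = n.+3 -> polyfun n (srec v b n K).
Proof.
move=> cb; elim: n K => [|n IH] K cK.
  by apply: (polyfun_ext _ (polyfun_cst (if degen v K then 0 else b K))) => x /=; case: ifP.
have [dK|ndK] := boolP (degen v K).
  apply: (polyfun_ext _ (polyfun_le (leq0n _) (polyfun_cst (0:R)))) => x.
  by rewrite srec_degen.
have [i [j [k [Ki Kj Kk d0]]]] := degenPn ndK.
have c1 l : (0 < K l)%N -> mcard (mremove K l) = n.+3.
  by move=> Kl; move: cK; rewrite (mcard_remove Kl) => -[].
set d := D _ _ _ in d0.
have pa p q l : (0 < K l)%N -> polyfun n.+1 (fun x => D x (v p) (v q) / d * srec v b n (mremove K l) x).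
  move=> Kl; apply: (polyfun_ext _ (polyfun_affine (((v p).2 - (v q).2) / d)
    (((v q).1 - (v p).1) / d) (((v p).1 * (v q).2 - (v p).2 * (v q).1) / d) (IH _ (c1 _ Kl)))).
  by move=> x; rewrite /D; ring.
apply: (polyfun_ext _ (polyfun_add (polyfun_add (pa j k i Ki) (pa k i j Kj)) (pa i j k Kk))) => x.
have [s e] := bary_coord x d0.
rewrite (srec3 cb cK Ki Kj Kk s e) -/d.
by rewrite (_ : D (v i) x (v k) = D x (v k) (v i)) 1?(_ : D (v i) (v j) x = D x (v i) (v j)) // /D; ring.
Qed.

Lemma srec_polynomial b n K : consistent v b -> mcard K = n.+3 -> polynomial_fun (srec v b n K).
Proof. by move=> cb cK; exists n; exact: srec_polyfun. Qed.

Variable b : mset10 -> R.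
Hypothesis cb : consistent v b.
Variables (h1 h2 h3 u1 u2 u3 : R).
Let h (p : R * R) := h1 * p.1 + h2 * p.2 + h3.
Let u (p : R * R) := u1 * p.1 + u2 * p.2 + u3.
Hypothesis hu : h1 * u2 - h2 * u1 != 0.

(** The affine functions [h] and [u] are coordinates whose origin lies on the line
[h = 0]. The triangles of vertices of [K] include one with an edge on this line through
the origin only if [K] straddles it. *)
Definition straddles K : bool := [exists i, exists j,
  [&& (0 < K i)%N, (0 < K j)%N, h (v i) == 0, h (v j) == 0, u (v i) < 0 & 0 < u (v j)]].

Definition on_line K : nat := \sum_(j | h (v j) == 0) K j.

(** Clears the denominators [h (v k)] that come from expanding the recursion at the
points [v k] off the line; its sign makes the leading term of a jump positive. *)
Definition off_product K : R := \prod_(j | h (v j) != 0) h (v j) ^+ K j.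

(* Only multisets with points in [A] are considered: the fewer the points, the fewer
   lines separate the points of the plane. *)
Variable A : pred 'I_10.
Hypothesis uA : forall l, A l -> h (v l) = 0 -> u (v l) != 0.
Let inA K := forall j, (0 < K j)%N -> A j.
Hypothesis b_off : forall K, inA K -> mcard K = 3%N -> ~~ degen v K ->
  ~~ straddles K -> b K = 0.
Hypothesis b_on : forall K, inA K -> mcard K = 3%N -> ~~ degen v K ->
  straddles K -> 0 < b K * off_product K.

Lemma straddlesP K : straddles K <-> exists i j,
  [/\ (0 < K i)%N /\ (0 < K j)%N, h (v i) = 0, h (v j) = 0, u (v i) < 0 & 0 < u (v j)].
Proof.
split=> [/existsP[i /existsP[j /and5P[Ki Kj /eqP hi /eqP hj /andP[ui uj]]]]|].
  by exists i, j.
move=> [i [j [[Ki Kj] hi hj ui uj]]]; apply/existsP; exists i; apply/existsP; exists j.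
by rewrite Ki Kj hi hj eqxx ui uj.
Qed.

Lemma straddles_sub K L : (forall i, L i <= K i)%N -> straddles L -> straddles K.
Proof.
move=> s /straddlesP[i [j [[Ki Kj] hi hj ui uj]]]; apply/straddlesP; exists i, j.
by split => //; split; [exact: leq_trans Ki (s i)|exact: leq_trans Kj (s j)].
Qed.

Lemma inA_remove K i : inA K -> inA (mremove K i).
Proof. by move=> AK j Kj; apply: AK; exact: leq_trans Kj (mremove_le _ _ _). Qed.

Lemma srec_jump0 n K x : inA K -> mcard K = n.+3 -> ~~ straddles K -> srec v b n K x = 0.
Proof.
elim: n K => [|n IH] K AK cK sK /=; case: ifPn => // ndK; first by rewrite b_off.
have [be hb] := bary_exists x ndK.
have /baryP[_ _ _ c4] : bary v K x (xget [ffun=> 0] (bary v K x)) by apply: xgetPex; exists be.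
rewrite big1// => j _; have [Kj|Kj] := posnP (K j); first by rewrite c4// mul0r.
rewrite IH ?mulr0//; first exact: inA_remove.
  by move: cK; rewrite (mcard_remove Kj) => -[].
by apply: contra sK; apply: straddles_sub => i; exact: mremove_le.
Qed.

Lemma D_hu p q r : (h1 * u2 - h2 * u1) * D p q r =
  (h q - h p) * (u r - u p) - (u q - u p) * (h r - h p).
Proof. by rewrite /D /h /u; ring. Qed.

Lemma coordinates_inj p q : h p = h q -> u p = u q -> p = q.
Proof.
move=> eh eu; apply: pairE; apply: (mulfI hu).
  have -> : (h1 * u2 - h2 * u1) * p.1 = u2 * (h p - h3) - h2 * (u p - u3).
    by rewrite /h /u; ring.
  by rewrite eh eu /h /u; ring.
have -> : (h1 * u2 - h2 * u1) * p.2 = h1 * (u p - u3) - u1 * (h p - h3).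
  by rewrite /h /u; ring.
by rewrite eh eu /h /u; ring.
Qed.

Lemma on_line_remove K l : (0 < K l)%N -> h (v l) = 0 ->
  on_line K = (on_line (mremove K l)).+1.
Proof.
move=> Kl hl; rewrite /on_line (bigD1 l) ?hl//= [in RHS](bigD1 l) ?hl//= ffunE eqxx subn1.
rewrite -addSn prednK//; congr addn; apply: eq_bigr => j /andP[_ jl].
by rewrite ffunE (negbTE jl) subn0.
Qed.

Lemma off_product_remove K l : (0 < K l)%N -> h (v l) != 0 ->
  off_product K = h (v l) * off_product (mremove K l).
Proof.
move=> Kl hl; rewrite /off_product (bigD1 l) ?hl//= [in RHS](bigD1 l) ?hl//= ffunE eqxx subn1.
rewrite mulrA -exprS prednK//; congr (_ * _); apply: eq_bigr => j /andP[_ jl].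
by rewrite ffunE (negbTE jl) subn0.
Qed.

Lemma on_line_remove_off K l : h (v l) != 0 -> on_line (mremove K l) = on_line K.
Proof.
move=> hl; apply: eq_bigr => j hj; rewrite ffunE; case: eqVneq => [e|_]; last by rewrite subn0.
by rewrite -e hj in hl.
Qed.

Lemma off_product_remove_on K l : h (v l) = 0 -> off_product (mremove K l) = off_product K.
Proof.
move=> hl; apply: eq_bigr => j hj; rewrite ffunE; case: eqVneq => [e|_]; last by rewrite subn0.
by rewrite e hl eqxx in hj.
Qed.

Lemma mcard_on_line K : mcard K = (on_line K + \sum_(j | h (v j) != 0%R) K j)%N.
Proof. by rewrite /mcard (bigID (fun j => h (v j) == 0)). Qed.

Lemma degenPn_off K : ~~ degen v K -> exists2 k, (0 < K k)%N & h (v k) != 0.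
Proof.
move=> /degenPn[i [j [k [Ki Kj Kk d0]]]].
have [hi|] := eqVneq (h (v i)) 0; last by exists i.
have [hj|] := eqVneq (h (v j)) 0; last by exists j.
have [hk|] := eqVneq (h (v k)) 0; last by exists k.
by move: d0; rewrite -(mulrI_eq0 _ (mulfI hu)) D_hu hi hj hk !subrr mul0r mulr0 subrr eqxx.
Qed.

Lemma on_line_lt n K : mcard K = n.+1 -> ~~ degen v K -> (on_line K <= n)%N.
Proof.
move=> cK /degenPn_off[k Kk hk]; rewrite -ltnS -cK mcard_on_line -[X in (X < _)%N]addn0 ltn_add2l.
by rewrite (bigD1 k)//= addn_gt0 Kk.
Qed.

Lemma degen_on_line n K : straddles K -> degen v K -> mcard K = n -> on_line K = n.
Proof.
move=> /straddlesP[i [j [[Ki Kj] hi hj ui uj]]] dK <-; rewrite mcard_on_line.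
rewrite [X in (_ + X)%N]big1 ?addn0// => k hk; apply/eqP; rewrite -leqn0 leqNgt.
apply: contra hk => Kk; have := D_hu (v i) (v j) (v k).
rewrite (degenP dK)// mulr0 hi hj subrr mul0r sub0r subr0 => /esym/eqP.
by rewrite oppr_eq0 mulf_eq0 subr_eq0 gt_eqF ?(lt_trans ui uj).
Qed.

(** A jump vanishes to the order [n.+2 - on_line K] on the line. Expand the recursion
with respect to two points [i], [j] of [K] on the line around the origin and a point [k]
off the line. The coordinate at [k] is [h x / h (v k)]: removing [k] gains a factor [h],
while removing [i] or [j] lowers [on_line K] by one, so all three terms vanish to the
claimed order. At the origin the coordinates at [i] and [j] are positive, hence no term
is negative there, and one of them is positive by induction. *)
Lemma srec_jump n K x0 : h x0 = 0 -> u x0 = 0 ->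
  inA K -> mcard K = n.+3 -> ~~ degen v K -> straddles K ->
  exists G, [/\ polynomial_fun G, 0 < G x0 & forall x,
    srec v b n K x * off_product K = h x ^+ (n.+2 - on_line K) * G x].
Proof.
move=> hx0 ux0; elim: n K => [|n IH] K AK cK ndK sK.
  have c2 : on_line K = 2%N.
    apply/eqP; rewrite eqn_leq (on_line_lt cK ndK)/=.
    have /straddlesP[i [j [[Ki Kj] hi hj ui uj]]] := sK.
    have ij : j != i by apply: contraTneq uj => ->; rewrite -leNgt ltW.
    rewrite (on_line_remove Ki hi) (on_line_remove (K := mremove K i) (l := j))//.
    by rewrite mremoveE (negbTE ij) subn0.
  exists (fun=> b K * off_product K); split; first exact: polynomial_cst.
    exact: b_on.
  by move=> x; rewrite c2 subnn expr0 mul1r /= (negbTE ndK).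
have /straddlesP[i [j [[Ki Kj] hi hj ui uj]]] := sK.
have [k Kk hk] := degenPn_off ndK.
have uji : u (v j) - u (v i) != 0 by rewrite subr_eq0 gt_eqF// (lt_trans ui).
pose bk x := h x / h (v k).
pose bj x := (u x - u (v i) - bk x * (u (v k) - u (v i))) / (u (v j) - u (v i)).
pose bi x := 1 - bj x - bk x.
have sumb x : bi x + bj x + bk x = 1 by rewrite /bi; ring.
have cR l : (0 < K l)%N -> mcard (mremove K l) = n.+3.
  by move=> Kl; move: cK; rewrite (mcard_remove Kl) => -[].
have xE x : x = bi x *: v i + bj x *: v j + bk x *: v k.
  have eh : h x = h (bi x *: v i + bj x *: v j + bk x *: v k).
    transitivity (bi x * h (v i) + bj x * h (v j) + bk x * h (v k)).
      by rewrite hi hj !mulr0 !add0r /bk divfK.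
    by rewrite /h /bi /= /GRing.scale/=; ring.
  have eu : u x = u (bi x *: v i + bj x *: v j + bk x *: v k).
    transitivity (bi x * u (v i) + bj x * u (v j) + bk x * u (v k)).
      have := divfK uji (u x - u (v i) - bk x * (u (v k) - u (v i))); rewrite -/(bj x) => e.
      by rewrite /bi; lra.
    by rewrite /u /bi /= /GRing.scale/=; ring.
  exact: coordinates_inj eh eu.
have ndR l : l \in [:: i; j] -> straddles (mremove K l) -> ~~ degen v (mremove K l).
  move=> lij sl; apply: contra hk => dl.
  have cl : mcard (mremove K l) = n.+3 by apply: cR; move: lij; rewrite !inE => /orP[] /eqP ->.
  have := degen_on_line sl dl cl; rewrite -{1}cl mcard_on_line => /eqP.
  rewrite -[X in X == _]addn0 eqn_add2l eq_sym sum_nat_eq0 => /forallP/(_ k).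
  case: eqVneq => //= hk'; rewrite mremoveE (_ : (k == l) = false).
    by rewrite subn0 gtn_eqF.
  apply: contraNF hk' => /eqP ->.
  by move: lij; rewrite !inE => /orP[] /eqP ->; rewrite ?hi ?hj.
have onR l : l \in [:: i; j] -> on_line K = (on_line (mremove K l)).+1.
  by rewrite !inE => /orP[] /eqP ->; exact: on_line_remove.
have onK := on_line_lt cK ndK.
have partR l : l \in [:: i; j] -> exists G, [/\ polynomial_fun G,
    straddles (mremove K l) -> 0 < G x0, 0 <= G x0 & forall x,
    srec v b n (mremove K l) x * off_product K = h x ^+ (n.+3 - on_line K) * G x].
  move=> lij; have hl : h (v l) = 0 by move: lij; rewrite !inE => /orP[] /eqP ->.
  have Kl : (0 < K l)%N by move: lij; rewrite !inE => /orP[] /eqP ->.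
  have [sl|nsl] := boolP (straddles (mremove K l)).
    have [G [pG G0 GE]] := IH _ (inA_remove (i:=l) AK) (cR _ Kl) (ndR _ lij sl) sl.
    exists G; split=> //; first exact: ltW.
    move=> x; rewrite -(off_product_remove_on K hl) GE (onR l)// subSS.
  exists (fun=> 0); split=> //; first exact: polynomial_cst.
  by move=> x; rewrite srec_jump0 ?mulr0 ?mul0r//; [exact: inA_remove|exact: cR].
have [Gi [pGi Gi1 Gi0 GiE]] := partR i (mem_head _ _).
have [Gj [pGj Gj1 Gj0 GjE]] : exists G, [/\ polynomial_fun G,
    straddles (mremove K j) -> 0 < G x0, 0 <= G x0 & forall x,
    srec v b n (mremove K j) x * off_product K = h x ^+ (n.+3 - on_line K) * G x].
  by apply: partR; rewrite !inE eqxx orbT.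
have sk : straddles (mremove K k).
  apply/straddlesP; exists i, j; rewrite !mremoveE; split=> //.
  have -> : i == k = false by apply: contraNF hk => /eqP <-; rewrite hi.
  have -> : j == k = false by apply: contraNF hk => /eqP <-; rewrite hj.
  by rewrite !subn0.
have [Gk [pGk Gk1 Gk0 GkE]] : exists G, [/\ polynomial_fun G,
    ~~ degen v (mremove K k) -> 0 < G x0, 0 <= G x0 & forall x,
    srec v b n (mremove K k) x * off_product (mremove K k) * h x
     = h x ^+ (n.+3 - on_line K) * G x].
  have [dk|ndk] := boolP (degen v (mremove K k)).
    exists (fun=> 0); split=> //; first exact: polynomial_cst.
    by move=> x; rewrite srec_degen// !mul0r mulr0.
  have [G [pG G0 GE]] := IH _ (inA_remove (i:=k) AK) (cR _ Kk) ndk sk.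
  exists G; split=> //; first exact: ltW.
  move=> x; rewrite GE on_line_remove_off// mulrAC -exprSr -subSn//.
  by rewrite -(on_line_remove_off K hk); exact: on_line_lt (cR _ Kk) ndk.
exists (fun x => bi x * Gi x + bj x * Gj x + Gk x).
have pbk : polynomial_fun bk.
  have [d pd] := polynomial_affine (h1 / h (v k)) (h2 / h (v k)) (h3 / h (v k)).
  by exists d; apply: (polyfun_ext _ pd) => x; rewrite /bk /h; ring.
have pu : polynomial_fun u by exact: polynomial_affine.
have pbj : polynomial_fun bj.
  have : polynomial_fun (fun x => (u (v j) - u (v i))^-1 * (u x + (- u (v i) + - (u (v k) - u (v i)) * bk x))).
    apply: polynomialM; first exact: polynomial_cst.
    apply: polynomialD => //; apply: polynomialD; first exact: polynomial_cst.
    by apply: polynomialM => //; exact: polynomial_cst.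
  by move=> [d pd]; exists d; apply: (polyfun_ext _ pd) => x; rewrite /bj; ring.
have pbi : polynomial_fun bi.
  have : polynomial_fun (fun x => 1 + (-1) * (bj x + bk x)).
    apply: polynomialD; first exact: polynomial_cst.
    by apply: polynomialM; [exact: polynomial_cst|exact: polynomialD].
  by move=> [d pd]; exists d; apply: (polyfun_ext _ pd) => x; rewrite /bi; ring.
split.
- by apply: polynomialD => //; apply: polynomialD; apply: polynomialM.
- have bk0 : bk x0 = 0 by rewrite /bk hx0 mul0r.
  have bj0 : 0 < bj x0.
    by rewrite /bj bk0 ux0 mul0r subr0 sub0r divr_gt0 ?oppr_gt0// subr_gt0 (lt_trans ui).
  have bi0 : 0 < bi x0.
    rewrite /bi bk0 subr0 /bj bk0 ux0 mul0r subr0 sub0r subr_gt0.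
    by rewrite ltr_pdivrMr ?subr_gt0 ?(lt_trans ui)// mul1r; lra.
  have biG : 0 <= bi x0 * Gi x0 by rewrite mulr_ge0// ltW.
  have bjG : 0 <= bj x0 * Gj x0 by rewrite mulr_ge0// ltW.
  have [dk|ndk] := boolP (degen v (mremove K k)); last by have := Gk1 ndk; lra.
  have onk := degen_on_line sk dk (cR _ Kk).
  have ij : j != i by apply: contraTneq uj => ->; rewrite -leNgt ltW.
  have Kij : (0 < mremove K i j)%N by rewrite mremoveE (negbTE ij) subn0.
  (* with a single point off the line, the line carries a third one *)
  have [l [hl Kl]] : exists l, h (v l) = 0 /\ (0 < mremove (mremove K i) j l)%N.
    have : on_line (mremove (mremove K i) j) != 0%N.
      move: onk; rewrite on_line_remove_off// (on_line_remove Ki hi) (on_line_remove Kij hj).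
      by move=> -[->].
    rewrite sum_nat_eq0 negb_forall => /existsP[l]; rewrite negb_imply -lt0n => /andP[/eqP hl Kl].
    by exists l.
  have Kl' : (0 < K l)%N.
    by apply: leq_trans Kl _; apply: leq_trans (mremove_le _ _ _) (mremove_le _ _ _).
  have := uA (AK _ Kl') hl; rewrite neq_lt => /orP[ul|ul].
    have si : straddles (mremove K i).
      apply/straddlesP; exists l, j; split => //; split => //.
      exact: leq_trans Kl (mremove_le _ _ _).
    by have := mulr_gt0 bi0 (Gi1 si); lra.
  have sj : straddles (mremove K j).
    apply/straddlesP; exists i, l; split => //; split.
      by rewrite mremoveE eq_sym (negbTE ij) subn0.
    by rewrite mremoveC in Kl; exact: leq_trans Kl (mremove_le _ _ _).
  by have := mulr_gt0 bj0 (Gj1 sj); lra.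
- move=> x; rewrite (srec3 cb cK Ki Kj Kk (sumb x) (xE x)).
  move: (bi x) (bj x) => bix bjx; rewrite !mulrDl.
  rewrite mulrDr; congr (_ + _).
    by rewrite mulrDr; congr (_ + _); rewrite -mulrA ?GiE ?GjE; ring.
  rewrite (off_product_remove Kk hk) /bk -GkE.
  by field.
Qed.
End Jump.


(** * The jump of the values on three points *)

Section BaseJump.
Variables (R : realType) (v : 'I_10 -> R * R).
Hypothesis D0 : D (v (ix 1)) (v (ix 2)) (v (ix 3)) != 0.
Implicit Types (K L : mset10) (x y : (R * R)%type) (i j k l : 'I_10).

Lemma same_sign_div (a b d : R) : 0 < a * b -> (0 < a / d) = (0 < b / d).
Proof.
move=> ab; have b0 : b != 0 by apply: contraTneq ab => ->; rewrite mulr0 ltxx.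
have {1}-> : a = (a * b / b ^+ 2) * b by field.
by rewrite -[X in 0 < X]mulrA pmulr_rgt0// divr_gt0// exprn_even_gt0.
Qed.

Definition generic_point y := forall p q, v p != v q -> D y (v p) (v q) != 0.

Definition inside y i j k : bool := let d := D (v i) (v j) (v k) in
  [&& 0 < D y (v j) (v k) / d, 0 < D y (v k) (v i) / d & 0 < D y (v i) (v j) / d].

Lemma base_mset3 y i j k : generic_point y -> D (v i) (v j) (v k) != 0 ->
  base v y (mset3 i j k) = (inside y i j k)%:R *
   (`|D (v (ix 1)) (v (ix 2)) (v (ix 3))| / `|D (v i) (v j) (v k)|).
Proof.
move=> gy d0; rewrite /base mhull_mset3 !area_triangle//.
have [ij jk ki] := D_neq d0.
have e2 : D (v i) y (v k) = D y (v k) (v i) by rewrite /D; ring.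
have e3 : D (v i) (v j) y = D y (v i) (v j) by rewrite /D; ring.
have pos p q : v p != v q -> (0 <= D y (v p) (v q) / D (v i) (v j) (v k)) =
    (0 < D y (v p) (v q) / D (v i) (v j) (v k)).
  by move=> /gy n; rewrite le_eqVlt eq_sym mulf_eq0 invr_eq0 (negbTE n) (negbTE d0).
have -> : (\1_(triangle (v i) (v j) (v k)) y : R) = (inside y i j k)%:R.
  rewrite indicE; congr (_%:R); congr nat_of_bool.
  apply/idP/and3P => [/set_mem/(triangle_DP _ d0)|].
    by rewrite e2 e3 !pos.
  by rewrite -!pos// -e2 -e3 => h; apply/mem_set/(triangle_DP _ d0).
by field; rewrite normr_eq0.
Qed.

Lemma mset3C i j k : mset3 i j k = mset3 j i k.
Proof. by apply/ffunP => l; rewrite !ffunE (addnC (l == i)). Qed.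

Lemma mset3CA i j k : mset3 i j k = mset3 i k j.
Proof. by apply/ffunP => l; rewrite !ffunE addnAC. Qed.

Variables (h1 h2 h3 u1 u2 u3 : R).
Let h (p : R * R) := h1 * p.1 + h2 * p.2 + h3.
Let u (p : R * R) := u1 * p.1 + u2 * p.2 + u3.
Hypothesis hu : h1 * u2 - h2 * u1 != 0.
Notation strad := (straddles v h1 h2 h3 u1 u2 u3).
Notation offp := (off_product v h1 h2 h3).

Variable A : pred 'I_10.
Variables x0 yp ym : R * R.
Hypothesis hx0 : h x0 = 0.
Hypothesis ux0 : u x0 = 0.
Hypothesis hyp : 0 < h yp.
Hypothesis hym : h ym < 0.
Hypothesis gyp : generic_point yp.
Hypothesis gym : generic_point ym.
Hypothesis same : forall p q, A p -> A q -> v p != v q ->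
  (h (v p) != 0) || (h (v q) != 0) ->
  0 < D yp (v p) (v q) * D x0 (v p) (v q) /\ 0 < D ym (v p) (v q) * D x0 (v p) (v q).

Let same_sign p q (d : R) : A p -> A q -> v p != v q ->
  (h (v p) != 0) || (h (v q) != 0) ->
  (0 < D yp (v p) (v q) / d) = (0 < D x0 (v p) (v q) / d) /\
  (0 < D ym (v p) (v q) / d) = (0 < D x0 (v p) (v q) / d).
Proof. by move=> Ap Aq pq hpq; have [? ?] := same Ap Aq pq hpq; split; apply: same_sign_div. Qed.

Notation delta := (fun L => base v yp L - base v ym L).

Let on_edge i j k : A i -> A j -> A k -> D (v i) (v j) (v k) != 0 ->
  h (v i) = 0 -> h (v j) = 0 -> h (v k) != 0 ->
  (~~ strad (mset3 i j k) -> delta (mset3 i j k) = 0) /\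
  (strad (mset3 i j k) -> 0 < delta (mset3 i j k) * offp (mset3 i j k)).
Proof.
move=> Ai Aj Ak d0 hi hj hk.
have [ij jk ki] := D_neq d0.
have dhu : forall p q r, (h1 * u2 - h2 * u1) * D p q r =
  (h q - h p) * (u r - u p) - (u q - u p) * (h r - h p) by exact: D_hu.
have uij : u (v j) - u (v i) != 0.
  apply: contra_neq d0 => e; apply: (mulfI hu); rewrite dhu.
  by rewrite e hi hj subrr !mul0r mulr0 subrr.
have dE : D (v i) (v j) (v k) = - (u (v j) - u (v i)) * h (v k) / (h1 * u2 - h2 * u1).
  by apply: (mulfI hu); rewrite dhu hi hj; field.
have eC y : D y (v i) (v j) / D (v i) (v j) (v k) = h y / h (v k).
  have -> : D y (v i) (v j) = D (v i) (v j) y by rewrite /D; ring.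
  have -> : D (v i) (v j) y = - (u (v j) - u (v i)) * h y / (h1 * u2 - h2 * u1).
    by apply: (mulfI hu); rewrite dhu hi hj; field.
  by rewrite dE; field; rewrite hu uij hk.
have eA : D x0 (v j) (v k) / D (v i) (v j) (v k) = u (v j) / (u (v j) - u (v i)).
  have -> : D x0 (v j) (v k) = - u (v j) * h (v k) / (h1 * u2 - h2 * u1).
    by apply: (mulfI hu); rewrite dhu hj hx0 ux0; field.
  by rewrite dE; field; rewrite hu uij hk.
have eB : D x0 (v k) (v i) / D (v i) (v j) (v k) = - u (v i) / (u (v j) - u (v i)).
  have -> : D x0 (v k) (v i) = u (v i) * h (v k) / (h1 * u2 - h2 * u1).
    by apply: (mulfI hu); rewrite dhu hi hx0 ux0; field.
  by rewrite dE; field; rewrite hu uij hk.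
have [sA1 sA2] := same_sign (D (v i) (v j) (v k)) Aj Ak jk (introT orP (or_intror hk)).
have [sB1 sB2] := same_sign (D (v i) (v j) (v k)) Ak Ai ki (introT orP (or_introl hk)).
have -> : offp (mset3 i j k) = h (v k).
  rewrite /off_product (bigD1 k)//= big1 ?mulr1.
    rewrite ffunE eqxx.
    have -> : k == i = false by apply: contraNF hk => /eqP ->; apply/eqP; exact: hi.
    have -> : k == j = false by apply: contraNF hk => /eqP ->; apply/eqP; exact: hj.
    by rewrite expr1.
  move=> l /andP[hl lk]; rewrite ffunE (negbTE lk).
  have -> : l == i = false by apply: contraNF hl => /eqP ->; apply/eqP; exact: hi.
  have -> : l == j = false by apply: contraNF hl => /eqP ->; apply/eqP; exact: hj.
  by rewrite expr0.
have stE : strad (mset3 i j k) =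
    (0 < u (v j) / (u (v j) - u (v i))) && (0 < - u (v i) / (u (v j) - u (v i))).
  apply/idP/andP => [/straddlesP[p [q [[]]]]|[p1 p2]].
    rewrite !mset3_gt0 => hp hq p0 q0 up uq.
    have {}hp : (p == i) || (p == j).
      by case/or3P: hp p0 => /eqP -> //; rewrite ?eqxx ?orbT// => e; case/eqP: hk.
    have {}hq : (q == i) || (q == j).
      by case/or3P: hq q0 => /eqP -> //; rewrite ?eqxx ?orbT// => e; case/eqP: hk.
    case/orP: hp up => /eqP -> up; case/orP: hq uq => /eqP -> uq.
    - by have := lt_trans up uq; rewrite ltxx.
    - by rewrite !divr_gt0// ?oppr_gt0// subr_gt0 (lt_trans up).
    - have n : (u (v j) - u (v i))^-1 < 0 by rewrite invr_lt0 subr_lt0 (lt_trans up).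
      by rewrite !nmulr_lgt0// oppr_lt0.
    - by have := lt_trans up uq; rewrite ltxx.
  apply/straddlesP; move: uij; rewrite neq_lt => /orP[n|n].
    have n' : (u (v j) - u (v i))^-1 < 0 by rewrite invr_lt0.
    move: p1 p2; rewrite !nmulr_lgt0// oppr_lt0 => p1 p2.
    by exists j, i; rewrite !mset3_gt0 !eqxx !orbT.
  have n' : 0 < (u (v j) - u (v i))^-1 by rewrite invr_gt0.
  move: p1 p2; rewrite !pmulr_lgt0// oppr_gt0 => p1 p2.
  by exists i, j; rewrite !mset3_gt0 !eqxx !orbT.
rewrite !base_mset3// /inside sA1 sA2 sB1 sB2 !eC eA eB stE.
set P := 0 < _ / _ in stE *; set Q := 0 < - _ / _ in stE *.
split=> [/negbTE|/andP[-> ->]/=].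
  by case: P {stE} => //=; case: Q => //= _; rewrite subrr.
have c0 : 0 < `|D (v (ix 1)) (v (ix 2)) (v (ix 3))| / `|D (v i) (v j) (v k)|.
  by rewrite divr_gt0// normr_gt0.
move: hk; rewrite neq_lt => /orP[hk|hk].
  have hk' : (h (v k))^-1 < 0 by rewrite invr_lt0.
  rewrite !nmulr_lgt0// hym (le_gtF (ltW hyp)) mul0r sub0r mul1r.
  by rewrite oppr_lt0.
have hk' : 0 < (h (v k))^-1 by rewrite invr_gt0.
by rewrite !pmulr_lgt0// hyp (le_gtF (ltW hym)) mul0r subr0 mul1r.
Qed.

Let off_edge i j k : A i -> A j -> A k -> D (v i) (v j) (v k) != 0 ->
  (h (v i) != 0) || (h (v j) != 0) -> (h (v j) != 0) || (h (v k) != 0) ->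
  (h (v k) != 0) || (h (v i) != 0) ->
  delta (mset3 i j k) = 0 /\ ~~ strad (mset3 i j k).
Proof.
move=> Ai Aj Ak d0 hij hjk hki.
have [ij jk ki] := D_neq d0.
split.
  have [s1 s1'] := same_sign (D (v i) (v j) (v k)) Ai Aj ij hij.
  have [s2 s2'] := same_sign (D (v i) (v j) (v k)) Aj Ak jk hjk.
  have [s3 s3'] := same_sign (D (v i) (v j) (v k)) Ak Ai ki hki.
  by rewrite !base_mset3// /inside s1 s2 s3 s1' s2' s3' subrr.
apply/negP => /straddlesP[p [q [[]]]]; rewrite !mset3_gt0 => hp hq p0 q0 up uq.
have pq : p != q by apply: contraTneq up => ->; rewrite -leNgt ltW.
move: hp hq p0 q0 pq => /or3P[] /eqP -> /or3P[] /eqP -> /eqP p0 /eqP q0; rewrite ?eqxx// => _;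
  by rewrite ?p0 ?q0 in hij hjk hki.
Qed.

(** When [y] moves across the line near [x0], it enters or leaves a triangle only
through an edge that lies on the line and contains [x0]; the side of the third vertex
decides which of the two happens. *)
Lemma base_jump K : (forall j, (0 < K j)%N -> A j) -> mcard K = 3%N -> ~~ degen v K ->
  (~~ strad K -> delta K = 0) /\ (strad K -> 0 < delta K * offp K).
Proof.
move=> AK /mcard3P[i [j [k e]]]; move: AK; rewrite e => AK ndK.
have [Ai Aj Ak] : [/\ A i, A j & A k].
  by split; apply: AK; rewrite mset3_gt0 eqxx ?orbT.
move: ndK; rewrite degen_mset3 => d0.
have dhu : forall p q r, (h1 * u2 - h2 * u1) * D p q r =
  (h q - h p) * (u r - u p) - (u q - u p) * (h r - h p) by exact: D_hu.
have [hi|hi] := eqVneq (h (v i)) 0; have [hj|hj] := eqVneq (h (v j)) 0;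
  have [hk|hk] := eqVneq (h (v k)) 0.
- move: d0; rewrite -(mulrI_eq0 _ (mulfI hu)) dhu hi hj hk.
  by rewrite !subrr mul0r mulr0 subrr eqxx.
- exact: on_edge.
- rewrite mset3CA; apply: on_edge => //; by rewrite DAC oppr_eq0.
- have := @off_edge i j k Ai Aj Ak d0; rewrite ?hj ?hk ?orbT => /(_ isT isT isT)[-> ns].
  by split=> // s; rewrite s in ns.
- rewrite mset3C mset3CA; apply: on_edge => //; by rewrite DAC DCA opprK.
- have := @off_edge i j k Ai Aj Ak d0; rewrite ?hi ?hk ?orbT => /(_ isT isT isT)[-> ns].
  by split=> // s; rewrite s in ns.
- have := @off_edge i j k Ai Aj Ak d0; rewrite ?hi ?hj ?orbT => /(_ isT isT isT)[-> ns].
  by split=> // s; rewrite s in ns.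
- have := @off_edge i j k Ai Aj Ak d0; rewrite ?hi ?hj ?orbT => /(_ isT isT isT)[-> ns].
  by split=> // s; rewrite s in ns.
Qed.

End BaseJump.


(** * Smoothness along a line *)

Section LinePolynomials.
Variable R : realType.

Lemma poly0_near (p : {poly R}) (eps : R) : 0 < eps ->
  (forall s, 0 < s < eps -> p.[s] = 0) -> p = 0.
Proof.
move=> e0 h; apply/eqP/negPn/negP => p0.
pose rs := [seq eps / (k.+2%:R) | k <- iota 0 (size p)].
have : (size rs < size p)%N.
  apply: (max_poly_roots p0).
    apply/allP => _ /mapP[k _ ->]; apply/eqP; apply: h.
    by rewrite divr_gt0//= ltr_pdivrMr// ltr_pMr// (ltr_nat _ 1 k.+2).
  rewrite map_inj_uniq ?iota_uniq// => k l /(mulfI (lt0r_neq0 e0))/invr_inj/eqP.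
  by rewrite eqr_nat => /eqP [].
by rewrite size_map size_iota ltnn.
Qed.

Lemma is_derive_cvg (V : normedModType R) (f : V -> R) (p e : V) (l : R) :
  is_derive p e f l -> h^-1 *: (f (h *: e + p) - f p) @[h --> 0^'] --> l.
Proof. by move=> [df <-]; exact: df. Qed.

(** The polynomials [pr] and [pl] agree at [0] by continuity. Their derivatives are the
restrictions of a partial derivative of [f], to which the induction hypothesis applies;
this is why [e] has to be a coordinate direction. *)
Lemma C_on_jump k (D : set (R * R)%type) (f : R * R -> R) (x0 e : R * R)
    (pr pl : {poly R}) (eps : R) :
  e = (1, 0) \/ e = (0, 1) -> 0 < eps ->
  (forall s, `|s| < eps -> interior D (x0 + s *: e)) -> C_on k D f ->
  (forall s, 0 < s < eps -> f (x0 + s *: e) = pr.[s]) ->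
  (forall s, 0 < s < eps -> f (x0 + (- s) *: e) = pl.[- s]) ->
  forall i, (i <= k)%N -> pr`_i = pl`_i.
Proof.
move=> he e0 intD.
have cont0 (g : R * R -> R) : {within D, continuous g} -> (g (x0 + s *: e) @[s --> (0:R)] --> g x0).
  move=> cg; move: ((subspace_continuousP D g).1 cg x0).
  have i0 : interior D x0 by have := intD 0; rewrite normr0 scale0r addr0; apply.
  move=> /(_ (interior_subset i0)); rewrite within_interior ?inE//.
  have ce : x0 + s *: e @[s --> (0:R)] --> x0 + (0:R) *: e.
    by apply: cvgD; [exact: cvg_cst|apply: cvgZr_tmp; exact: cvg_id].
  by rewrite scale0r addr0 in ce; exact: cvg_comp ce.
have zero (g : R * R -> R) (qr ql : {poly R}) : {within D, continuous g} ->
   (forall s, 0 < s < eps -> g (x0 + s *: e) = qr.[s]) ->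
   (forall s, 0 < s < eps -> g (x0 + (- s) *: e) = ql.[- s]) -> qr.[0] = ql.[0].
  move=> /cont0 cg gr gl.
  have c1 : qr.[s] @[s --> 0^'+] --> g x0.
    have : g (x0 + s *: e) @[s --> (0:R)^'+] --> g x0 by apply: cvg_at_right_filter.
    apply: cvg_trans; apply: near_eq_cvg; near=> s; rewrite gr//.
    apply/andP; split; first by near: s; exact: nbhs_right_gt.
    by near: s; exact: nbhs_right_lt.
  have c2 : ql.[s] @[s --> 0^'-] --> g x0.
    have : g (x0 + s *: e) @[s --> (0:R)^'-] --> g x0 by apply: cvg_at_left_filter.
    apply: cvg_trans; apply: near_eq_cvg; near=> s; rewrite -[s]opprK gl//.
    apply/andP; split; first by rewrite oppr_gt0; near: s; exact: nbhs_left_lt.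
    by rewrite ltrNl; near: s; apply: nbhs_left_gt; rewrite oppr_lt0.
  have d1 : qr.[s] @[s --> 0^'+] --> qr.[0].
    by apply: cvg_at_right_filter; exact: continuous_horner.
  have d2 : ql.[s] @[s --> 0^'-] --> ql.[0].
    by apply: cvg_at_left_filter; exact: continuous_horner.
  by rewrite -(cvg_unique _ c1 d1)//; exact: (cvg_unique _ c2 d2).
elim: k f pr pl => [|k IH] f pr pl /=.
  by move=> [cf _] fr fl [|//] _; rewrite -!horner_coef0; exact: zero cf fr fl.
move=> [cf [fx [fy [Cx Cy dxy]]]] fr fl [|i].
  by move=> _; rewrite -!horner_coef0; exact: zero cf fr fl.
rewrite ltnS => ik.
have [fe Ce de] : exists2 fe, C_on k D fe & forall p, interior D p -> is_derive p e f (fe p).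
  by case: he => ->; [exists fx|exists fy] => // p /dxy[].
have shift (t h : R) : h *: e + (x0 + t *: e) = x0 + (h + t) *: e.
  by rewrite scalerDl addrCA.
have der (q : {poly R}) (t : R) (I : set R) : nbhs t I -> I t -> 
    (forall s, I s -> f (x0 + s *: e) = q.[s]) -> `|t| < eps -> fe (x0 + t *: e) = q^`().[t].
  move=> nI It fI te; have := is_derive_cvg (de _ (intD _ te)).
  have := is_derive_cvg (is_derive_poly q t) => c1 c2.
  apply: (cvg_unique _ c2 _) => //; apply: cvg_trans c1; apply: near_eq_cvg.
  have nI' : \forall h \near (0:R)^', I (h + t).
    apply: nbhs_dnbhs; have : h + t @[h --> (0:R)] --> t.
      rewrite -[X in _ --> X]add0r; apply: cvgD; [exact: cvg_id|exact: cvg_cst].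
    by move=> /(_ _ nI).
  near=> h; rewrite /= shift fI; last by near: h.
  by rewrite fI// -[X in q.[X + t]]mulr1.
have := IH fe pr^`() pl^`() Ce _ _ i ik; rewrite !coef_deriv => H.
have /eqP : pr`_i.+1 *+ i.+1 = pl`_i.+1 *+ i.+1.
  apply: H => s /andP[s0 se].
  - apply: (der _ _ `]0, eps[%classic).
    + by apply: near_in_itvoo; rewrite in_itv/= s0.
    + by rewrite /= in_itv/= s0.
    + by move=> u /=; rewrite in_itv/=; exact: fr.
    + by rewrite gtr0_norm.
  - apply: (der _ _ `]-eps, 0[%classic).
    + by apply: near_in_itvoo; rewrite in_itv/= oppr_lt0 s0 ltrN2 se.
    + by rewrite /= in_itv/= oppr_lt0 s0 ltrN2 se.
    + move=> u /=; rewrite in_itv/= => /andP[u1 u2]; rewrite -[u]opprK; apply: fl.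
      by rewrite oppr_gt0 u2 ltrNl.
    + by rewrite normrN gtr0_norm.
by rewrite -subr_eq0 -mulrnBl mulrn_eq0 /= subr_eq0 => /eqP.
Unshelve. all: by end_near. Qed.

End LinePolynomials.


(** * Simplex splines near a line *)

Section LocalJump.
Variables (R : realType) (v : 'I_10 -> R * R).
Hypothesis D0 : D (v (ix 1)) (v (ix 2)) (v (ix 3)) != 0.
Hypothesis vT : forall j, triangle (v (ix 1)) (v (ix 2)) (v (ix 3)) (v j).
Hypothesis vinj : injective v.
Implicit Types (K L : mset10) (x y : (R * R)%type) (i j k l : 'I_10).

Lemma line_D (a c x : R * R) : line a c x -> D x a c = 0.
Proof. by move=> [t ->]; rewrite /D /= /GRing.scale/=; ring. Qed.

Lemma D_line (a c x : R * R) : a != c -> D x a c = 0 -> line a c x.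
Proof.
move=> ac d0.
have [e1|n1] := eqVneq c.1 a.1.
  have n2 : c.2 - a.2 != 0.
    by rewrite subr_eq0; apply: contra_neq ac => e2; exact: pairE.
  exists ((x.2 - a.2) / (c.2 - a.2)); apply: pairE; rewrite /= /GRing.scale/=.
    rewrite e1 -mulrDl subrK mul1r; apply: (mulfI n2); move: d0; rewrite /D e1 => d0.
    by apply/eqP; rewrite -subr_eq0 -[X in _ == X]oppr0 -d0; apply/eqP; ring.
  by field.
have n2 : c.1 - a.1 != 0 by rewrite subr_eq0.
exists ((x.1 - a.1) / (c.1 - a.1)); apply: pairE; rewrite /= /GRing.scale/=; first by field.
apply: (mulfI n2); rewrite (_ : (c.1 - a.1) * (_ + _) = (c.1 - a.1) * a.2 + (x.1 - a.1) * (c.2 - a.2)); last by field.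
by apply/eqP; rewrite -subr_eq0 -[X in _ == X]d0; apply/eqP; rewrite /D; ring.
Qed.

Lemma genericP x : generic v x <-> generic_point v x.
Proof.
split=> [gx p q pq|gx p q pq /line_D/eqP].
  apply/eqP => d0; have npq : p != q by apply: contra_neq pq => ->.
  by apply: (gx p q npq); exact: D_line.
by apply/negP/gx; rewrite (inj_eq vinj).
Qed.

Lemma spline_srec K x n : mcard K = n.+3 -> generic_point v x ->
  simplex_spline v K x = srec v (base v x) n K x.
Proof.
move=> cK /genericP gx; rewrite /simplex_spline asboolT// cK !subSS subn0.
by rewrite simplex_recE.
Qed.

(** The value of [base v y] on three points depends only on the sides of their edges on
which [y] lies. *)
Lemma base_same (A : pred 'I_10) x y n K z :
  (forall p q, A p -> A q -> v p != v q -> 0 < D x (v p) (v q) * D y (v p) (v q)) ->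
  generic_point v x -> generic_point v y ->
  (forall j, (0 < K j)%N -> A j) -> mcard K = n.+3 ->
  srec v (base v x) n K z = srec v (base v y) n K z.
Proof.
move=> same gx gy AK cK; apply/eqP; rewrite -subr_eq0 -srecB; apply/eqP.
elim: n K AK cK => [|n IH] K AK cK /=; case: ifPn => // ndK.
  have [i [j [k e]]] := mcard3P cK; move: ndK AK; rewrite e degen_mset3 => d0 AK.
  have [Ai Aj Ak] : [/\ A i, A j & A k] by split; apply: AK; rewrite mset3_gt0 eqxx ?orbT.
  have [ij jk ki] := D_neq d0.
  by rewrite !base_mset3// /inside !(same_sign_div _ (same _ _ _ _ _))// subrr.
have [be hb] := bary_exists z ndK.
have /baryP[_ _ _ c4] : bary v K z (xget [ffun=> 0] (bary v K z)) by apply: xgetPex; exists be.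
rewrite big1// => j _; have [Kj|Kj] := posnP (K j); first by rewrite c4// mul0r.
rewrite IH ?mulr0//.
  by move=> l Kl; apply: AK; exact: leq_trans Kl (mremove_le _ _ _).
by move: cK; rewrite (mcard_remove Kj) => -[].
Qed.

Variables (h1 h2 h3 u1 u2 u3 : R).
Let h (p : R * R) := h1 * p.1 + h2 * p.2 + h3.
Let u (p : R * R) := u1 * p.1 + u2 * p.2 + u3.
Hypothesis hu : h1 * u2 - h2 * u1 != 0.
Notation strad := (straddles v h1 h2 h3 u1 u2 u3).
Notation onl := (on_line v h1 h2 h3).
Variable x0 : R * R.
Hypothesis hx0 : h x0 = 0.
Hypothesis ux0 : u x0 = 0.
Hypothesis u_off : forall l, h (v l) = 0 -> u (v l) != 0.
Hypothesis gx0 : forall p q, v p != v q -> (h (v p) != 0) || (h (v q) != 0) ->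
  D x0 (v p) (v q) != 0.

Lemma h_line w s : h (x0 + s *: w) = s * (h1 * w.1 + h2 * w.2).
Proof. by rewrite -[RHS]addr0 -hx0 /h /= /GRing.scale/=; ring. Qed.

(** The determinants with a pair of vertices not both on the line are nonzero at [x0]
and keep their sign nearby. A pair on the line is handled by [h], which is nonzero off
the line. *)
Lemma near_edge w : h1 * w.1 + h2 * w.2 != 0 -> exists2 eps, 0 < eps &
  forall s, 0 < `|s| < eps -> generic_point v (x0 + s *: w) /\
   forall p q, v p != v q -> (h (v p) != 0) || (h (v q) != 0) ->
     0 < D (x0 + s *: w) (v p) (v q) * D x0 (v p) (v q).
Proof.
move=> hw.
pose F (pq : 'I_10 * 'I_10) : set R := fun s => v pq.1 != v pq.2 ->
    (h (v pq.1) != 0) || (h (v pq.2) != 0) ->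
    0 < D (x0 + s *: w) (v pq.1) (v pq.2) * D x0 (v pq.1) (v pq.2).
have near1 : forall pq, \forall s \near (0 : R), F pq s.
  move=> [p q]; rewrite /F /=.
  have [->|npq] := eqVneq (v p) (v q); first by apply: (@filterE _ (nbhs (0:R))) => s; rewrite ?eqxx.
  have [hpq|] := boolP ((h (v p) != 0) || (h (v q) != 0)); last by move=> nh; apply: (@filterE _ (nbhs (0:R))) => s _; rewrite ?(negbTE nh).
  have d0 := gx0 npq hpq.
  pose c := ((w.2 * ((v p).1 - (v q).1)) + w.1 * ((v q).2 * 1 - (v p).2)) * -1.
  have DE s : D (x0 + s *: w) (v p) (v q) = D x0 (v p) (v q) + s * c.
    by rewrite /D /c /= /GRing.scale/=; ring.
  have e0 : 0 < `|D x0 (v p) (v q)| / (`|c| + 1).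
    by rewrite divr_gt0 ?normr_gt0// ltr_wpDl.
  apply/nbhs_ballP; exists (`|D x0 (v p) (v q)| / (`|c| + 1)) => //= s.
  rewrite /ball/= sub0r normrN => sl _ _; rewrite DE mulrDl -expr2.
  have : `|s * c * D x0 (v p) (v q)| < D x0 (v p) (v q) ^+ 2.
    rewrite normrM normrM -real_normK ?num_real// expr2 ltr_pM2r ?normr_gt0//.
    rewrite ltr_pdivlMr in sl; last by rewrite ltr_wpDl.
    by apply: le_lt_trans sl; rewrite ler_wpM2l// lerDl.
  by rewrite ltr_norml => /andP[]; lra.
have /nbhs_ballP[eps /= e0 H] := filter_forall (nbhs_filter (0:R)) near1; exists eps => // s /andP[s0 se].
have Hs : forall p q, v p != v q -> (h (v p) != 0) || (h (v q) != 0) ->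
     0 < D (x0 + s *: w) (v p) (v q) * D x0 (v p) (v q).
  by move=> p q; apply: (H s _ (p, q)); rewrite /ball/= sub0r normrN.
split=> // p q pq; have [hp|hp] := eqVneq (h (v p)) 0; last first.
  by apply: contraTneq (Hs _ _ pq _) => [->|]; rewrite ?mul0r ?ltxx// hp.
have [hq|hq] := eqVneq (h (v q)) 0; last first.
  by apply: contraTneq (Hs _ _ pq _) => [->|]; rewrite ?mul0r ?ltxx// hq orbT.
have uE := D_hu h1 h2 h3 u1 u2 u3 (x0 + s *: w) (v p) (v q).
apply: contra_neq pq => d0; move: uE; rewrite d0 mulr0.
rewrite -/(h _) -/(h _) -/(h _) -/(u _) -/(u _) -/(u _) hp hq !sub0r => /eqP.
have -> : - h (x0 + s *: w) * (u (v q) - u (x0 + s *: w)) -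
  (u (v p) - u (x0 + s *: w)) * - h (x0 + s *: w) = h (x0 + s *: w) * (u (v p) - u (v q)) by ring.
rewrite eq_sym mulf_eq0 h_line mulf_eq0 (negbTE hw) orbF -normr_eq0 gt_eqF//= subr_eq0 => /eqP eu.
have eh : h (v p) = h (v q) by rewrite hp hq.
exact: (coordinates_inj hu eh eu).
Qed.

Lemma off_product_neq0 K : off_product v h1 h2 h3 K != 0.
Proof. by apply/prodf_neq0 => j hj; rewrite expf_neq0. Qed.

(** [srec_jump] on a transversal to the line: there [h] is proportional to the
parameter, so the order of vanishing is visible in the coefficients. *)
Lemma delta_line n K w yp ym (Q : {poly R}) : mcard K = n.+3 -> ~~ degen v K ->
  h1 * w.1 + h2 * w.2 != 0 -> 0 < h yp -> h ym < 0 -> generic_point v yp -> generic_point v ym ->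
  (forall p q, v p != v q -> (h (v p) != 0) || (h (v q) != 0) ->
    0 < D yp (v p) (v q) * D x0 (v p) (v q) /\ 0 < D ym (v p) (v q) * D x0 (v p) (v q)) ->
  (forall s, Q.[s] = srec v (base v yp) n K (x0 + s *: w) - srec v (base v ym) n K (x0 + s *: w)) ->
  (~~ strad K -> Q = 0) /\
  (strad K -> (forall i : nat, (i < n.+2 - onl K)%N -> Q`_i = 0) /\ Q`_(n.+2 - onl K) != 0).
Proof.
move=> cK ndK hw hyp hym gyp gym same QE.
pose b L := base v yp L - base v ym L.
have cb : consistent v b by apply: consistentB; exact: consistent_base.
pose A : pred 'I_10 := predT.
have b_off L : (forall j, (0 < L j)%N -> A j) -> mcard L = 3%N -> ~~ degen v L ->
    ~~ strad L -> b L = 0.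
  move=> AL cL ndL; apply: (base_jump D0 hu hx0 ux0 hyp hym gyp gym _ AL cL ndL).1.
  by move=> p q _ _; exact: same.
have b_on L : (forall j, (0 < L j)%N -> A j) -> mcard L = 3%N -> ~~ degen v L ->
    strad L -> 0 < b L * off_product v h1 h2 h3 L.
  move=> AL cL ndL; apply: (base_jump D0 hu hx0 ux0 hyp hym gyp gym _ AL cL ndL).2.
  by move=> p q _ _; exact: same.
have bE s : Q.[s] = srec v b n K (x0 + s *: w) by rewrite QE srecB.
split=> sK.
  apply: (@poly0_near _ _ 1) => // s _; rewrite bE.
  by apply: (srec_jump0 b_off) => //.
have [G [pG G0 GE]] := srec_jump cb hu (fun l _ => u_off (l:=l)) b_off b_on hx0 ux0
   (fun j _ => isT) cK ndK sK.
have [g gE] := polynomial_line x0 w pG.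
set r := (n.+2 - onl K)%N in GE *; pose kap := h1 * w.1 + h2 * w.2.
have key : Q * (off_product v h1 h2 h3 K)%:P = 'X^r * (kap ^+ r *: g).
  apply/eqP; rewrite -subr_eq0; apply/eqP; apply: (@poly0_near _ _ 1) => // s _.
  rewrite hornerD hornerN 2!hornerM hornerC bE GE -/(h _) h_line exprMn gE -/kap hornerXn hornerZ; ring.
have co (i : nat) : Q`_i * off_product v h1 h2 h3 K = if (i < r)%N then 0 else kap ^+ r * g`_(i - r).
  by rewrite -coefMC key coefXnM coefZ.
have off0 := off_product_neq0 K.
split=> [i ir|].
  by apply: (mulIf off0); rewrite co ir mul0r.
apply/eqP => q0; have := co r; rewrite q0 mul0r ltnn subnn => /esym/eqP; apply/negP.
by rewrite mulf_neq0 ?expf_neq0// -horner_coef0 -gE scale0r addr0 gt_eqF.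
Qed.

(** The two polynomials are those of one point on either side of the line, and
[base_same] extends them to one-sided neighbourhoods of [x0]. *)
Lemma local_jump n K w : mcard K = n.+3 -> ~~ degen v K -> h1 * w.1 + h2 * w.2 != 0 ->
  exists (eps : R) (pr pl : {poly R}), [/\ 0 < eps,
   forall s, 0 < s < eps -> generic_point v (x0 + s *: w) /\
      simplex_spline v K (x0 + s *: w) = pr.[s],
   forall s, 0 < s < eps -> generic_point v (x0 + (- s) *: w) /\
      simplex_spline v K (x0 + (- s) *: w) = pl.[- s],
   ~~ strad K -> pr = pl &
   strad K -> (forall i : nat, (i < n.+2 - onl K)%N -> pr`_i = pl`_i) /\
     pr`_(n.+2 - onl K) != pl`_(n.+2 - onl K)].
Proof.
move=> cK ndK hw; have [eps e0 H] := near_edge hw.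
pose yr := x0 + (eps / 2) *: w; pose yl := x0 + (- (eps / 2)) *: w.
have [gr sr] : generic_point v yr /\ forall p q, v p != v q -> (h (v p) != 0) || (h (v q) != 0) ->
     0 < D yr (v p) (v q) * D x0 (v p) (v q).
  by apply: H; rewrite gtr0_norm; lra.
have [gl sl] : generic_point v yl /\ forall p q, v p != v q -> (h (v p) != 0) || (h (v q) != 0) ->
     0 < D yl (v p) (v q) * D x0 (v p) (v q).
  by apply: H; rewrite normrN gtr0_norm; lra.
have cr := consistent_base D0 gr; have cl := consistent_base D0 gl.
have [pr prE] := polynomial_line x0 w (srec_polynomial cr cK).
have [pl plE] := polynomial_line x0 w (srec_polynomial cl cK).
have both p q : h (v p) = 0 -> h (v q) = 0 -> forall y,
   (h1 * u2 - h2 * u1) * D y (v p) (v q) = h y * (u (v p) - u (v q)).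
  by move=> hp hq y; rewrite (D_hu h1 h2 h3 u1 u2 u3) -/(h _) -/(h _) -/(h _) hp hq
     -/(u _) -/(u _) -/(u _); ring.
have sq (a c d : R) : 0 < a * c -> 0 < d * c -> 0 < a * d.
  move=> ac dc; have c0 : c != 0 by apply: contraTneq ac => ->; rewrite mulr0 ltxx.
  have -> : a * d = (a * c) * (d * c) / c ^+ 2 by field.
  by rewrite divr_gt0//; [rewrite mulr_gt0|rewrite exprn_even_gt0].
have side (s t : R) : 0 < `|s| < eps -> 0 < `|t| < eps -> 0 < s * t ->
    forall p q, v p != v q -> 0 < D (x0 + s *: w) (v p) (v q) * D (x0 + t *: w) (v p) (v q).
  move=> hs ht st p q pq; have [gs ss] := H s hs; have [gt tt] := H t ht.
  have [hp|hp] := eqVneq (h (v p)) 0; last by apply: sq (ss _ _ pq _) (tt _ _ pq _); rewrite hp.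
  have [hq|hq] := eqVneq (h (v q)) 0; last first.
    by apply: sq (ss _ _ pq _) (tt _ _ pq _); rewrite hq orbT.
  have J2 : 0 < (h1 * u2 - h2 * u1) ^+ 2 by rewrite exprn_even_gt0.
  rewrite -(pmulr_rgt0 _ J2) expr2 mulrACA !both// !h_line.
  have n0 : D (x0 + s *: w) (v p) (v q) != 0 by exact: gs.
  have uu : u (v p) - u (v q) != 0.
    by apply: contra_neq n0 => e; apply: (mulfI hu); rewrite both// e !mulr0.
  have -> : s * (h1 * w.1 + h2 * w.2) * (u (v p) - u (v q)) *
     (t * (h1 * w.1 + h2 * w.2) * (u (v p) - u (v q))) =
     (s * t) * ((h1 * w.1 + h2 * w.2) * (u (v p) - u (v q))) ^+ 2 by ring.
  by rewrite mulr_gt0// exprn_even_gt0//= mulf_neq0.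
have [J0 J1] : (~~ strad K -> pr = pl) /\ (strad K ->
    (forall i : nat, (i < n.+2 - onl K)%N -> pr`_i = pl`_i) /\
    pr`_(n.+2 - onl K) != pl`_(n.+2 - onl K)).
  have hr : h yr = eps / 2 * (h1 * w.1 + h2 * w.2) by exact: h_line.
  have hl : h yl = - (eps / 2 * (h1 * w.1 + h2 * w.2)) by rewrite /yl h_line mulNr.
  move: hw; rewrite neq_lt => /orP[hw|hw].
    have yl0 : 0 < h yl by rewrite hl oppr_gt0 pmulr_rlt0//; lra.
    have yr0 : h yr < 0 by rewrite hr pmulr_rlt0//; lra.
    have QE s : (pl - pr).[s] =
        srec v (base v yl) n K (x0 + s *: w) - srec v (base v yr) n K (x0 + s *: w).
      by rewrite hornerD hornerN prE plE.
    have [d0 d1] := delta_line cK ndK (ltr0_neq0 hw) yl0 yr0 gl gr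
       (fun p q pq hpq => conj (sl p q pq hpq) (sr p q pq hpq)) QE.
    split=> [/d0/eqP|/d1[Q1 Q2]]; first by rewrite subr_eq0 => /eqP ->.
    split=> [i /Q1/eqP|]; first by rewrite coefB subr_eq0 => /eqP ->.
    by move: Q2; rewrite coefB subr_eq0 eq_sym.
  have yr0 : 0 < h yr by rewrite hr mulr_gt0//; lra.
  have yl0 : h yl < 0 by rewrite hl oppr_lt0 mulr_gt0//; lra.
  have QE s : (pr - pl).[s] =
      srec v (base v yr) n K (x0 + s *: w) - srec v (base v yl) n K (x0 + s *: w).
    by rewrite hornerD hornerN prE plE.
  have [d0 d1] := delta_line cK ndK (lt0r_neq0 hw) yr0 yl0 gr gl
     (fun p q pq hpq => conj (sr p q pq hpq) (sl p q pq hpq)) QE.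
  split=> [/d0/eqP|/d1[Q1 Q2]]; first by rewrite subr_eq0 => /eqP ->.
  split=> [i /Q1/eqP|]; first by rewrite coefB subr_eq0 => /eqP ->.
  by move: Q2; rewrite coefB subr_eq0.
exists eps, pr, pl; split => //.
- move=> s /andP[s0 se].
  have hs : 0 < `|s| < eps by rewrite gtr0_norm// s0.
  have [gs _] := H s hs; split=> //; rewrite (spline_srec cK gs) -prE.
  apply: (@base_same predT) => // p q _ _; apply: side => //.
    by rewrite gtr0_norm; lra.
  by rewrite mulr_gt0//; lra.
- move=> s /andP[s0 se].
  have hs : 0 < `|- s| < eps by rewrite normrN gtr0_norm// s0.
  have [gs _] := H _ hs; split=> //; rewrite (spline_srec cK gs) -plE.
  apply: (@base_same predT) => // p q _ _; apply: side => //.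
    by rewrite normrN gtr0_norm; lra.
  by rewrite mulrNN mulr_gt0//; lra.
Qed.
End LocalJump.


(** * The segments cut out by the lines *)

(** Homogeneous barycentric coordinates, or linear forms in them. With integer entries
all statements about the ten points are decided by computation. *)
Definition vec : Type := (int * int * int)%type.

Definition vec_sum (a : vec) : int := a.1.1 + a.1.2 + a.2.
Definition vec_dot (a b : vec) : int := a.1.1 * b.1.1 + a.1.2 * b.1.2 + a.2 * b.2.
Definition vec_det (a b c : vec) : int :=
  a.1.1 * (b.1.2 * c.2 - b.2 * c.1.2) - a.1.2 * (b.1.1 * c.2 - b.2 * c.1.1)
  + a.2 * (b.1.1 * c.1.2 - b.1.2 * c.1.1).

(** The factor 12 clears the denominators 2, 3 and 4 of the barycentric coordinates. *)
Definition vertex_coords : seq vec :=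
  [:: (12, 0, 0); (0, 12, 0); (0, 0, 12); (6, 6, 0); (0, 6, 6); (6, 0, 6);
      (6, 3, 3); (3, 6, 3); (3, 3, 6); (4, 4, 4)]%Z.
Definition vx (j : nat) : vec := nth (0, 0, 0)%Z vertex_coords j.

(** A segment of a line through two of the ten points, bounded by other such lines. It
is described by a kind (0 on the boundary of T, 1 for an interior edge of the 12-split, 2
for a segment inside a triangle of the 12-split), the form [h] of its line, a second form
[u], and the common zero [x] of [h] and [u], which is a point inside the segment. *)
Definition segment : Type := (nat * vec * vec * vec)%type.
Definition Seg k h u x : segment := (k, h, u, x).
Definition seg_kind (s : segment) := s.1.1.1.
Definition seg_h (s : segment) := s.1.1.2.
Definition seg_u (s : segment) := s.1.2.
Definition seg_x (s : segment) := s.2.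

(** All fifteen interior edges, the six edges on the boundary, and nine further segments
which suffice to exclude the lines that are not part of the 12-split. *)
Definition segments : seq segment :=
  [:: Seg 2 (1, 0, -2) (4, -1, 1) (2, 9, 1);
      Seg 2 (2, 0, -1) (1, -1, 4) (1, 9, 2);
      Seg 2 (-1, 2, 0) (4, 1, -1) (2, 1, 9);
      Seg 2 (-2, 1, 0) (1, 4, -1) (1, 2, 9);
      Seg 2 (0, 1, -2) (1, -4, -1) (9, 2, 1);
      Seg 2 (1, 1, -3) (2, -1, -1) (4, 5, 3);
      Seg 2 (0, 2, -1) (1, -1, -4) (9, 1, 2);
      Seg 2 (-1, 3, -1) (2, -1, -1) (4, 3, 5);
      Seg 2 (-3, 1, 1) (-1, 2, -1) (3, 4, 5);
      Seg 1 (1, 0, -1) (1, -1, 5) (1, 6, 1);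
      Seg 1 (1, 0, -1) (7, -7, 3) (7, 10, 7);
      Seg 1 (1, 0, -1) (0, -5, 2) (5, 2, 5);
      Seg 1 (-1, 1, 0) (5, 1, -1) (1, 1, 6);
      Seg 1 (-1, 1, 0) (3, 7, -7) (7, 7, 10);
      Seg 1 (-1, 1, 0) (0, 2, -5) (5, 5, 2);
      Seg 1 (-1, 1, -1) (2, 1, -2) (1, 4, 3);
      Seg 1 (-1, 1, -1) (2, -1, -2) (3, 4, 1);
      Seg 1 (1, 1, -1) (2, -2, 1) (1, 3, 4);
      Seg 1 (1, 1, -1) (2, -2, -1) (3, 1, 4);
      Seg 1 (0, 1, -1) (5, 0, -2) (2, 5, 5);
      Seg 1 (0, 1, -1) (7, -7, -3) (10, 7, 7);
      Seg 1 (0, 1, -1) (1, -1, -5) (6, 1, 1);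
      Seg 1 (-1, 1, 1) (1, 2, -2) (4, 1, 3);
      Seg 1 (-1, 1, 1) (-1, 2, -2) (4, 3, 1);
      Seg 0 (0, 0, -1) (5, -1, 0) (1, 5, 0);
      Seg 0 (0, 0, -1) (1, -5, 0) (5, 1, 0);
      Seg 0 (-1, 0, 0) (0, 5, -1) (0, 1, 5);
      Seg 0 (-1, 0, 0) (0, 1, -5) (0, 5, 1);
      Seg 0 (0, 1, 0) (5, 0, -1) (1, 0, 5);
      Seg 0 (0, 1, 0) (1, 0, -5) (5, 0, 1)]%Z.

Definition on_seg (s : segment) (j : nat) : bool := vec_dot (seg_h s) (vx j) == 0.
Definition left_of (s : segment) : seq nat :=
  [seq j <- iota 0 10 | on_seg s j && (vec_dot (seg_u s) (vx j) < 0)].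
Definition right_of (s : segment) : seq nat :=
  [seq j <- iota 0 10 | on_seg s j && (0 < vec_dot (seg_u s) (vx j))].

Definition inside12 (x : vec) (t : nat * nat * nat) : bool :=
  let a := vx t.1.1.-1 in let b := vx t.1.2.-1 in let c := vx t.2.-1 in
  let d := vec_det a b c in
  [&& 0 < vec_det x b c * d, 0 < vec_det a x c * d & 0 < vec_det a b x * d].

Definition seg_ok (s : segment) : bool :=
  let: (k, h, u, x) := s in
  [&& vec_dot h x == 0, vec_dot u x == 0, 0 < vec_sum x,
      vec_det h u (1, 1, 1) != 0,
      all (fun j => on_seg s j ==> (vec_dot u (vx j) != 0)) (iota 0 10),
      all (fun p => all (fun q => (p == q) || on_seg s p && on_seg s q ||
         (vec_det x (vx p) (vx q) != 0)) (iota 0 10)) (iota 0 10),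
      (0 < k)%N ==> [&& 0 < x.1.1, 0 < x.1.2 & 0 < x.2] &
      (k == 2) ==> has (inside12 x) triangles12].

Lemma segments_ok : all seg_ok segments.
Proof. by vm_compute. Qed.

Section Coordinates.
Variable R : realType.
Variables v1 v2 v3 : R * R.
Hypothesis D0 : D v1 v2 v3 != 0.
Let v := split12 v1 v2 v3.
Implicit Types (a b c x y z : vec) (p : (R * R)%type).

Definition lin_x a : R := (a.1.1%:~R * (v2.2 - v3.2) + a.1.2%:~R * (v3.2 - v1.2)
  + a.2%:~R * (v1.2 - v2.2)) / D v1 v2 v3.
Definition lin_y a : R := (a.1.1%:~R * (v3.1 - v2.1) + a.1.2%:~R * (v1.1 - v3.1)
  + a.2%:~R * (v2.1 - v1.1)) / D v1 v2 v3.
Definition lin_c a : R := (a.1.1%:~R * (v2.1 * v3.2 - v2.2 * v3.1)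
  + a.1.2%:~R * (v3.1 * v1.2 - v3.2 * v1.1)
  + a.2%:~R * (v1.1 * v2.2 - v1.2 * v2.1)) / D v1 v2 v3.
(** The linear form [a], evaluated at the barycentric coordinates of [p]. *)
Definition lin a p : R := lin_x a * p.1 + lin_y a * p.2 + lin_c a.

Definition pt x : R * R := (vec_sum x)%:~R^-1 *:
  (x.1.1%:~R *: v1 + x.1.2%:~R *: v2 + x.2%:~R *: v3).

Lemma lin_pt a x : vec_sum x != 0 -> lin a (pt x) = (vec_dot a x)%:~R / (vec_sum x)%:~R.
Proof.
move=> sx; have sx' : (vec_sum x)%:~R != 0 :> R by rewrite intr_eq0.
apply: (mulIf D0); rewrite /lin /lin_x /lin_y /lin_c /pt /= /GRing.scale/=.
move: sx' D0; rewrite /vec_dot /vec_sum !(rmorphD, rmorphM) /= /D => sx' d0.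
by field; rewrite d0 sx'.
Qed.

Lemma D_pt x y z : vec_sum x != 0 -> vec_sum y != 0 -> vec_sum z != 0 ->
  D (pt x) (pt y) (pt z) = (vec_det x y z)%:~R /
   ((vec_sum x)%:~R * (vec_sum y)%:~R * (vec_sum z)%:~R) * D v1 v2 v3.
Proof.
case: x y z => -[x1 x2] x3 [[y1 y2] y3] [[z1 z2] z3].
rewrite -!(intr_eq0 R) /pt /vec_sum /vec_det /D /= /GRing.scale/= !(intrD, intrB, intrM).
by move=> sx sy sz; field; rewrite sx sy sz.
Qed.

Lemma lin_jacobian a b : lin_x a * lin_y b - lin_x b * lin_y a =
  (vec_det a b (1, 1, 1))%:~R / D v1 v2 v3.
Proof.
case: a b => -[a1 a2] a3 [[b1 b2] b3].
rewrite /lin_x /lin_y /vec_det /= !(intrD, intrB, intrM).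
by move: D0; rewrite /D => d0; field.
Qed.

Lemma split12_pt (j : 'I_10) : v j = pt (vx j).
Proof.
have n12 : (12%:~R : R) != 0 by rewrite intr_eq0.
case: j => -[|[|[|[|[|[|[|[|[|[|//]]]]]]]]]] hj; apply: pairE;
  by rewrite /v /split12 /pt /vx /vec_sum /= /GRing.scale/=; field.
Qed.

Lemma vx_sum (j : 'I_10) : vec_sum (vx j) = 12.
Proof. by case: j => -[|[|[|[|[|[|[|[|[|[|//]]]]]]]]]] hj. Qed.

Lemma lin_v a (j : 'I_10) : lin a (v j) = (vec_dot a (vx j))%:~R / 12.
Proof. by rewrite split12_pt lin_pt vx_sum. Qed.

End Coordinates.


Definition mult_fun (K : mset10) : nat -> nat := fun j => K (inord j).

Definition straddled (s : segment) (m : nat -> nat) : bool :=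
  has (fun j => 0 < m j)%N (left_of s) && has (fun j => 0 < m j)%N (right_of s).

Definition multiplicity (s : segment) (m : nat -> nat) : nat :=
  \sum_(j <- iota 0 10 | on_seg s j) m j.

Section SegmentFacts.
Variable R : realType.
Variables v1 v2 v3 : R * R.
Hypothesis D0 : D v1 v2 v3 != 0.
Notation v := (split12 v1 v2 v3).
Notation T := (triangle v1 v2 v3).

Lemma split12_ix1 : v (ix 1) = v1. Proof. by rewrite /split12 /ix inordK. Qed.
Lemma split12_ix2 : v (ix 2) = v2. Proof. by rewrite /split12 /ix inordK. Qed.
Lemma split12_ix3 : v (ix 3) = v3. Proof. by rewrite /split12 /ix inordK. Qed.

Lemma split12_D0 : D (v (ix 1)) (v (ix 2)) (v (ix 3)) != 0.
Proof. by rewrite split12_ix1 split12_ix2 split12_ix3. Qed.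

Lemma pt_triangle (x : vec) : 0 < vec_sum x -> 0 <= x.1.1 -> 0 <= x.1.2 -> 0 <= x.2 ->
  T (pt v1 v2 v3 x).
Proof.
move=> s0 h1 h2 h3; have s0' : (0 : R) < (vec_sum x)%:~R by rewrite ltr0z.
apply/triangleP; exists (x.1.1%:~R / (vec_sum x)%:~R, x.1.2%:~R / (vec_sum x)%:~R,
  x.2%:~R / (vec_sum x)%:~R) => /=; split; rewrite ?divr_ge0 ?ler0z ?(ltW s0)//.
  by rewrite -!mulrDl -!intrD divff// gt_eqF.
by rewrite /pt !scalerDr !scalerA ![_^-1 * _]mulrC.
Qed.

Lemma split12_T j : triangle (v (ix 1)) (v (ix 2)) (v (ix 3)) (v j).
Proof.
rewrite split12_ix1 split12_ix2 split12_ix3 split12_pt.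
by case: j => -[|[|[|[|[|[|[|[|[|[|//]]]]]]]]]] hj; apply: pt_triangle.
Qed.

Lemma split12_inj : injective v.
Proof.
move=> i j e.
have E a : vec_dot a (vx i) = vec_dot a (vx j).
  have := congr1 (lin v1 v2 v3 a) e; rewrite !lin_v// => /(mulIf _)/eqP.
  by rewrite eqr_int => h; apply/eqP/h; rewrite invr_eq0 pnatr_eq0.
have eV : vx i = vx j.
  have := E (1, 0, 0)%Z; have := E (0, 1, 0)%Z; have := E (0, 0, 1)%Z.
  rewrite /vec_dot /= !mul0r !mul1r !addr0 !add0r => e3 e2 e1.
  by case: (vx i) (vx j) e1 e2 e3 => -[a1 a2] a3 [[b1 b2] b3] /= -> -> ->.
have inj10 : all (fun p => all (fun q => (vx p == vx q) ==> (p == q)) (iota 0 10)) (iota 0 10).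
  by vm_compute.
have mem10 (l : 'I_10) : val l \in iota 0 10 by rewrite mem_iota/= ltn_ord.
have /allP qall := allP inj10 _ (mem10 i).
by have := qall _ (mem10 j); rewrite eV eqxx => /eqP/val_inj.
Qed.

Lemma triangle_interior (a b c p : R * R) : D a b c != 0 ->
  0 < D p b c / D a b c -> 0 < D a p c / D a b c -> 0 < D a b p / D a b c ->
  interior (triangle a b c) p.
Proof.
move=> d0 h1 h2 h3.
have near_pos (f : R * R -> R) : polynomial_fun f -> 0 < f p -> \forall q \near p, 0 < f q.
  by move=> pf f0; have /cvgr_gt := @polynomial_continuous R f pf p; apply.
have n1 : \forall q \near p, 0 < D q b c / D a b c.
  apply: near_pos h1.
  have [d pd] := polynomial_affine ((b.2 - c.2) / D a b c) ((c.1 - b.1) / D a b c)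
    ((b.1 * c.2 - b.2 * c.1) / D a b c).
  by exists d; apply: (polyfun_ext _ pd) => x; rewrite /D; ring.
have n2 : \forall q \near p, 0 < D a q c / D a b c.
  apply: near_pos h2.
  have [d pd] := polynomial_affine ((c.2 - a.2) / D a b c) ((a.1 - c.1) / D a b c)
    ((c.1 * a.2 - c.2 * a.1) / D a b c).
  by exists d; apply: (polyfun_ext _ pd) => x; rewrite /D; ring.
have n3 : \forall q \near p, 0 < D a b q / D a b c.
  apply: near_pos h3.
  have [d pd] := polynomial_affine ((a.2 - b.2) / D a b c) ((b.1 - a.1) / D a b c)
    ((a.1 * b.2 - a.2 * b.1) / D a b c).
  by exists d; apply: (polyfun_ext _ pd) => x; rewrite /D; ring.
rewrite /interior; near=> q; apply/(triangle_DP _ d0); split; apply: ltW; near: q; done.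
Unshelve. all: by end_near. Qed.

Section OneSegment.
Variable s : segment.
Hypothesis s_ok : seg_ok s.
Notation h := (lin v1 v2 v3 (seg_h s)).
Notation u := (lin v1 v2 v3 (seg_u s)).
Notation x0 := (pt v1 v2 v3 (seg_x s)).

Lemma seg_x_sum : 0 < vec_sum (seg_x s).
Proof. by case: s s_ok => -[[k ?] ?] ? /and5P[]. Qed.

Lemma seg_jacobian : lin_x v1 v2 v3 (seg_h s) * lin_y v1 v2 v3 (seg_u s)
  - lin_y v1 v2 v3 (seg_h s) * lin_x v1 v2 v3 (seg_u s) != 0.
Proof.
rewrite [X in _ - X]mulrC lin_jacobian// mulf_neq0 ?invr_eq0// intr_eq0.
by case: s s_ok => -[[k ?] ?] ? /and5P[].
Qed.

Lemma seg_h_x0 : h x0 = 0.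
Proof.
rewrite (lin_pt D0); last by rewrite gt_eqF ?seg_x_sum.
by case: s s_ok => -[[k ?] ?] ? /and5P[/eqP -> _ _ _ _]; rewrite mul0r.
Qed.

Lemma seg_u_x0 : u x0 = 0.
Proof.
rewrite (lin_pt D0); last by rewrite gt_eqF ?seg_x_sum.
by case: s s_ok => -[[k ?] ?] ? /and5P[_ /eqP -> _ _ _]; rewrite mul0r.
Qed.

Lemma seg_h_v (j : 'I_10) : (h (v j) == 0) = on_seg s j.
Proof. by rewrite lin_v// mulf_eq0 invr_eq0 intr_eq0 pnatr_eq0 orbF. Qed.

Lemma seg_u_off (j : 'I_10) : h (v j) = 0 -> u (v j) != 0.
Proof.
move/eqP; rewrite seg_h_v => hj; rewrite lin_v// mulf_neq0 ?invr_eq0 ?pnatr_eq0//.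
move: s_ok hj; case: s => -[[k ?] ?] ? /and5P[_ _ _ _ /and4P[/allP hall _ _ _]] hj.
have := hall (val j); rewrite mem_iota/= ltn_ord => /(_ isT)/implyP hall'.
by rewrite intr_eq0; exact: hall'.
Qed.

Lemma seg_generic (p q : 'I_10) : v p != v q -> (h (v p) != 0) || (h (v q) != 0) ->
  D x0 (v p) (v q) != 0.
Proof.
rewrite (inj_eq split12_inj) !seg_h_v -negb_and => pq hpq.
have s0 : vec_sum (seg_x s) != 0 by rewrite gt_eqF ?seg_x_sum.
rewrite !split12_pt D_pt ?vx_sum// -!mulrA mulf_eq0 intr_eq0 negb_or.
rewrite [X in _ && X]mulf_neq0 ?invr_eq0 ?andbT//; last first.
  by rewrite !mulf_neq0 ?pnatr_eq0 ?intr_eq0.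
move: s_ok hpq; case: s => -[[k ?] ?] ? /and5P[_ _ _ _ /and4P[_ /allP hall _ _]] hpq.
have mem10 (l : 'I_10) : val l \in iota 0 10 by rewrite mem_iota/= ltn_ord.
have /allP hall' := hall _ (mem10 p).
by have := hall' _ (mem10 q); rewrite (inj_eq val_inj) (negbTE pq) (negbTE hpq).
Qed.

Notation hx := (lin_x v1 v2 v3 (seg_h s)).
Notation hy := (lin_y v1 v2 v3 (seg_h s)).
Notation hc := (lin_c v1 v2 v3 (seg_h s)).
Notation ux := (lin_x v1 v2 v3 (seg_u s)).
Notation uy := (lin_y v1 v2 v3 (seg_u s)).
Notation uc := (lin_c v1 v2 v3 (seg_u s)).

Lemma left_ofP (j : 'I_10) : ((j : nat) \in left_of s) = (h (v j) == 0) && (u (v j) < 0).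
Proof.
rewrite mem_filter mem_iota/= ltn_ord andbT seg_h_v lin_v//.
by rewrite pmulr_llt0 ?invr_gt0 ?ltr0n// ltrz0.
Qed.

Lemma right_ofP (j : 'I_10) : ((j : nat) \in right_of s) = (h (v j) == 0) && (0 < u (v j)).
Proof.
rewrite mem_filter mem_iota/= ltn_ord andbT seg_h_v lin_v//.
by rewrite pmulr_lgt0 ?invr_gt0 ?ltr0n// ltr0z.
Qed.

Lemma straddlesE (K : mset10) (m : nat -> nat) : (forall j : 'I_10, m j = K j) ->
  straddles v hx hy hc ux uy uc K = straddled s m.
Proof.
move=> mK.
have ord j (l : seq nat) : j \in [seq j <- iota 0 10 | j \in l] -> exists i : 'I_10, j = i.
  by rewrite mem_filter mem_iota/= => /andP[_ j10]; exists (Ordinal j10).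
apply/idP/andP.
  move=> /straddlesP[i [j [[Ki Kj] hi hj ui uj]]].
  split; apply/hasP; [exists (val i)|exists (val j)]; rewrite ?mK//.
    by rewrite left_ofP; apply/andP; split => //; apply/eqP.
  by rewrite right_ofP; apply/andP; split => //; apply/eqP.
move=> [/hasP[i il mi] /hasP[j jr mj]]; apply/straddlesP.
have i10 : (i < 10)%N by move: il; rewrite mem_filter mem_iota => /andP[].
have j10 : (j < 10)%N by move: jr; rewrite mem_filter mem_iota => /andP[].
exists (Ordinal i10), (Ordinal j10); rewrite -!mK.
move: (left_ofP (Ordinal i10)) (right_ofP (Ordinal j10)) => /=.
by rewrite il jr => /esym/andP[/eqP ? ?] /esym/andP[/eqP ? ?].
Qed.

Lemma on_lineE (K : mset10) (m : nat -> nat) : (forall j : 'I_10, m j = K j) ->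
  on_line v hx hy hc K = multiplicity s m.
Proof.
move=> mK; rewrite /on_line /multiplicity.
transitivity (\sum_(0 <= j < 10 | on_seg s j) m j)%N => //.
by rewrite big_mkord; apply: eq_big => [j|j _]; rewrite ?mK// -seg_h_v.
Qed.

Lemma seg_direction : exists e : R * R, (e = (1, 0) \/ e = (0, 1)) /\ hx * e.1 + hy * e.2 != 0.
Proof.
have [h0|h0] := eqVneq hx 0; last by exists (1, 0); split; [left|rewrite /= mulr1 mulr0 addr0].
exists (0, 1); split; [by right|rewrite /= mulr1 mulr0 add0r].
by apply: contraNneq seg_jacobian => h0'; rewrite h0 h0' !mul0r subrr.
Qed.

Lemma seg_local_jump n K e : mcard K = n.+3 -> ~~ degen v K -> hx * e.1 + hy * e.2 != 0 ->
  exists (eps : R) (pr pl : {poly R}), [/\ 0 < eps,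
   forall t, 0 < t < eps -> generic_point v (x0 + t *: e) /\
      simplex_spline v K (x0 + t *: e) = pr.[t],
   forall t, 0 < t < eps -> generic_point v (x0 + (- t) *: e) /\
      simplex_spline v K (x0 + (- t) *: e) = pl.[- t],
   ~~ straddled s (mult_fun K) -> pr = pl &
   straddled s (mult_fun K) ->
     (forall i : nat, (i < n.+2 - multiplicity s (mult_fun K))%N -> pr`_i = pl`_i) /\
     pr`_(n.+2 - multiplicity s (mult_fun K)) !=
     pl`_(n.+2 - multiplicity s (mult_fun K))].
Proof.
move=> cK ndK he.
have mK (j : 'I_10) : mult_fun K j = K j by rewrite /mult_fun inord_val.
have := local_jump split12_D0 split12_T split12_inj seg_jacobian seg_h_x0 seg_u_x0
  seg_u_off seg_generic cK ndK he.
by rewrite (straddlesE mK) (on_lineE mK).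
Qed.

End OneSegment.
End SegmentFacts.


(** * Necessary conditions *)

(** The jump of a quintic spline across a segment that it straddles vanishes exactly to
the order 7 - m, where m is the multiplicity. An edge of the 12-split requires order 4
at least, and a segment inside one of its triangles admits no jump at all. *)
Definition smooth_ok (m : nat -> nat) : bool :=
  all (fun s => (0 < seg_kind s)%N && straddled s m ==>
       (seg_kind s != 2) && (multiplicity s m <= 3)%N) segments.

Section Necessity.
Variable R : realType.
Variables v1 v2 v3 : R * R.
Hypothesis D0 : D v1 v2 v3 != 0.
Notation v := (split12 v1 v2 v3).
Notation T := (triangle v1 v2 v3).

Lemma poly0_near_left (p : {poly R}) (eps : R) : 0 < eps ->
  (forall s, 0 < s < eps -> p.[- s] = 0) -> p = 0.
Proof.
move=> e0 h; have q0 : p \Po (- 'X) = 0.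
  by apply: (poly0_near e0) => s hs; rewrite horner_comp hornerN hornerX h.
have -> : p = (p \Po (- 'X)) \Po (- 'X).
  by rewrite -comp_polyA rmorphN /= comp_polyX opprK comp_polyXr.
by rewrite q0 comp_poly0.
Qed.

Lemma interior_line (C : set (R * R)%type) (x e : R * R) : e = (1, 0) \/ e = (0, 1) ->
  interior C x -> exists2 eps, 0 < eps & forall t, `|t| < eps -> interior C (x + t *: e).
Proof.
move=> he ix; have : nbhs x (interior C) by exact: nbhs_interior.
move=> /nbhs_ballP[eps /= e0 H]; exists eps => // t te; apply: H.
split; rewrite /ball /= opprD addrA subrr sub0r normrN /GRing.scale/= normrM.
  by case: he => -> /=; rewrite ?normr1 ?normr0 ?mulr1 ?mulr0.
by case: he => -> /=; rewrite ?normr1 ?normr0 ?mulr1 ?mulr0.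
Qed.

Lemma poly2_on_line d (C : set (R * R)%type) f (x e : R * R) : poly2_on d C f ->
  exists q : {poly R}, forall t, C (x + t *: e) -> f (x + t *: e) = q.[t].
Proof.
move=> [c fE].
exists (\sum_(i < d.+1) \sum_(j < d.+1 | (i + j <= d)%N)
   (c i j)%:P * (x.1%:P + e.1 *: 'X) ^+ i * (x.2%:P + e.2 *: 'X) ^+ j) => t Ct.
rewrite fE// horner_sum; apply: eq_bigr => i _; rewrite horner_sum; apply: eq_bigr => j _.
rewrite !hornerM !horner_exp !hornerD !hornerZ !hornerC hornerX /= /GRing.scale/=.
by rewrite !(mulrC t).
Qed.

Lemma split12_ix k : (k.-1 < 10)%N -> v (ix k) = pt v1 v2 v3 (vx k.-1).
Proof. by move=> k10; rewrite split12_pt /ix inordK. Qed.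

Lemma inside12_interior x i j k : 0 < vec_sum x -> (i, j, k) \in triangles12 ->
  inside12 x (i, j, k) -> interior (triangle (v (ix i)) (v (ix j)) (v (ix k))) (pt v1 v2 v3 x).
Proof.
move=> sx tin; rewrite /inside12 /=; set d := vec_det (vx i.-1) (vx j.-1) (vx k.-1).
move=> /and3P[h1 h2 h3].
have bounds : all (fun t : nat * nat * nat =>
   [&& t.1.1.-1 < 10, t.1.2.-1 < 10 & t.2.-1 < 10]%N) triangles12 by vm_compute.
have /and3P[/= i10 j10 k10] := allP bounds _ tin.
have d0 : d != 0 by apply: contraTneq h1 => ->; rewrite mulr0 ltxx.
have s12 l : (l < 10)%N -> vec_sum (vx l) = 12 by move=> hl; exact: (vx_sum (Ordinal hl)).
have s12' l : (l < 10)%N -> vec_sum (vx l) != 0 by move=> /s12 ->.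
have sx' : vec_sum x != 0 by rewrite gt_eqF.
have sxR : (0 : R) < (vec_sum x)%:~R by rewrite ltr0z.
have dR : (d%:~R : R) != 0 by rewrite intr_eq0.
have key (a : int) : 0 < a * d -> 0 < (a%:~R / d%:~R : R).
  move=> ad; have -> : (a%:~R / d%:~R : R) = (a * d)%:~R / d%:~R ^+ 2 by rewrite intrM; field.
  by rewrite divr_gt0 ?ltr0z// exprn_even_gt0.
rewrite !split12_ix//.
have DE : D (pt v1 v2 v3 (vx i.-1)) (pt v1 v2 v3 (vx j.-1)) (pt v1 v2 v3 (vx k.-1)) =
   d%:~R / (12 * 12 * 12) * D v1 v2 v3 by rewrite D_pt ?s12'// !s12.
apply: triangle_interior; rewrite DE.
- by rewrite !mulf_neq0 ?invr_eq0 ?mulf_neq0 ?pnatr_eq0.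
- rewrite D_pt ?s12'// !s12//.
  rewrite (_ : _ / _ = (vec_det x (vx j.-1) (vx k.-1))%:~R / d%:~R * (12 / (vec_sum x)%:~R)).
    by rewrite mulr_gt0 ?key// divr_gt0.
  by field; rewrite dR D0 gt_eqF.
- rewrite D_pt ?s12'// !s12//.
  rewrite (_ : _ / _ = (vec_det (vx i.-1) x (vx k.-1))%:~R / d%:~R * (12 / (vec_sum x)%:~R)).
    by rewrite mulr_gt0 ?key// divr_gt0.
  by field; rewrite dR D0 gt_eqF.
- rewrite D_pt ?s12'// !s12//.
  rewrite (_ : _ / _ = (vec_det (vx i.-1) (vx j.-1) x)%:~R / d%:~R * (12 / (vec_sum x)%:~R)).
    by rewrite mulr_gt0 ?key// divr_gt0.
  by field; rewrite dR D0 gt_eqF.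
Qed.

Lemma pt_interior x : 0 < x.1.1 -> 0 < x.1.2 -> 0 < x.2 -> interior T (pt v1 v2 v3 x).
Proof.
move=> h1 h2 h3; have sx : 0 < vec_sum x by rewrite !addr_gt0.
have sxR : (0 : R) < (vec_sum x)%:~R by rewrite ltr0z.
have sxR' : (vec_sum x)%:~R != 0 :> R by rewrite gt_eqF.
have e : [/\ D (pt v1 v2 v3 x) v2 v3 / D v1 v2 v3 = x.1.1%:~R / (vec_sum x)%:~R,
   D v1 (pt v1 v2 v3 x) v3 / D v1 v2 v3 = x.1.2%:~R / (vec_sum x)%:~R &
   D v1 v2 (pt v1 v2 v3 x) / D v1 v2 v3 = x.2%:~R / (vec_sum x)%:~R].
  move: sxR' D0; rewrite /vec_sum !intrD /D /pt /vec_sum /= !intrD /GRing.scale/= => s0 d0.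
  by split; field; rewrite d0 s0.
by case: e => e1 e2 e3; apply: triangle_interior => //; rewrite ?e1 ?e2 ?e3 divr_gt0// ltr0z.
Qed.

(** On a transversal of a segment, the spline is given by two polynomials, which first
differ in degree 7 - m by [seg_local_jump]. They coincide if the segment lies inside a
triangle of the 12-split, and [C_on_jump] gives agreement up to degree 3 in any case. *)
Lemma necessity K : mcard K = 8%N -> ~~ degen v K -> simplex_spline_in_S35 v K ->
  smooth_ok (mult_fun K).
Proof.
move=> cK ndK [f [Cf Pf] Qf]; rewrite /smooth_ok; apply/allP => s sin; apply/implyP => /andP[k0 st].
have s_ok := allP segments_ok s sin.
have [e [he hde]] := seg_direction D0 s_ok.
have [eps [pr [pl [e0 Qr Ql _ /(_ st)[_ jump]]]]] := seg_local_jump D0 s_ok cK ndK hde.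
move: Cf Qf; rewrite split12_ix1 split12_ix2 split12_ix3 => Cf Qf.
set x0 := pt v1 v2 v3 (seg_x s) in Qr Ql.
have ix0 : interior T x0.
  move: s_ok k0; rewrite /x0; case: s {sin st hde Qr Ql x0 jump} => -[[k h] u] x /= /and5P[_ _ _ _].
  move=> /and4P[_ _ /implyP h2 _] /h2 /and3P[? ? ?].
  exact: pt_interior.
have [d d0 intT] := interior_line he ix0.
pose m := Num.min eps d.
have m0 : 0 < m by rewrite lt_min e0.
have fr t : 0 < t < m -> f (x0 + t *: e) = pr.[t].
  rewrite lt_min => /and3P[t0 te td]; have [|g <-] := Qr t; first by rewrite t0.
  rewrite Qf//; last by apply/genericP => //; exact: split12_inj.
  by apply: interior_subset; apply: intT; rewrite gtr0_norm.
have fl t : 0 < t < m -> f (x0 + (- t) *: e) = pl.[- t].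
  rewrite lt_min => /and3P[t0 te td]; have [|g <-] := Ql t; first by rewrite t0.
  rewrite Qf//; last by apply/genericP => //; exact: split12_inj.
  by apply: interior_subset; apply: intT; rewrite normrN gtr0_norm.
apply/andP; split.
  apply/negP => /eqP k2; move: jump; apply/negP; rewrite negbK; apply/eqP.
  have [[[i j] k] tin xin] : exists2 t, t \in triangles12 & inside12 (seg_x s) t.
    move: s_ok k2; case: s {sin st k0 hde Qr Ql ix0 intT fr fl x0} => -[[k h] u] x /= /and5P[_ _ _ _].
    by move=> /and4P[_ _ _ /implyP h2] kE; apply/hasP/h2/eqP.
  have it := inside12_interior (seg_x_sum s_ok) tin xin.
  have [d' d'0 intt] := interior_line he it.
  have [q qE] := poly2_on_line x0 e (Pf _ _ _ tin).
  pose m' := Num.min m d'.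
  have m'0 : 0 < m' by rewrite lt_min m0.
  have -> : pr = q.
    apply/eqP; rewrite -subr_eq0; apply/eqP/(poly0_near m'0) => t.
    rewrite lt_min => /and3P[t0 tm td]; rewrite hornerD hornerN -fr ?t0// qE ?subrr//.
    by apply: interior_subset; apply: intt; rewrite gtr0_norm.
  have -> : pl = q.
    apply/eqP; rewrite -subr_eq0; apply/eqP/(poly0_near_left m'0) => t.
    rewrite lt_min => /and3P[t0 tm td]; rewrite hornerD hornerN -fl ?t0// qE ?subrr//.
    by apply: interior_subset; apply: intt; rewrite normrN gtr0_norm.
  by [].
rewrite leqNgt; apply/negP => m3; move: jump; apply/negP; rewrite negbK; apply/eqP.
apply: (C_on_jump he m0 _ Cf fr fl).
  by move=> t; rewrite lt_min => /andP[_]; exact: intT.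
by rewrite leq_subLR; exact: leq_add m3 (leqnn 3).
Qed.

Lemma first_diff_uniq (p q : {poly R}) (a b : nat) :
  (forall i : nat, (i < a)%N -> p`_i = q`_i) -> p`_a != q`_a ->
  (forall i : nat, (i < b)%N -> p`_i = q`_i) -> p`_b != q`_b -> a = b.
Proof.
move=> pa na pb nb; case: (ltngtP a b) => // ab.
  by rewrite pb ?eqxx in na.
by rewrite pa ?eqxx in nb.
Qed.

(** Near a segment, the values of the spline show whether there is a jump, and then the
order of its vanishing. *)
Lemma same_spline K L : mcard K = 8%N -> mcard L = 8%N -> ~~ degen v K -> ~~ degen v L ->
  simplex_spline v K = simplex_spline v L ->
  forall s, s \in segments -> straddled s (mult_fun K) = straddled s (mult_fun L) /\
   (straddled s (mult_fun K) -> multiplicity s (mult_fun K) = multiplicity s (mult_fun L)).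
Proof.
move=> cK cL ndK ndL QKL s sin; have s_ok := allP segments_ok s sin.
have [e [he hde]] := seg_direction D0 s_ok.
have [eps [pr [pl [e0 Qr Ql K0 K1]]]] := seg_local_jump D0 s_ok cK ndK hde.
have [eps' [pr' [pl' [e0' Qr' Ql' L0 L1]]]] := seg_local_jump D0 s_ok cL ndL hde.
pose m := Num.min eps eps'; have m0 : 0 < m by rewrite lt_min e0.
have er : pr' = pr.
  apply/eqP; rewrite -subr_eq0; apply/eqP/(poly0_near m0) => t.
  rewrite lt_min => /and3P[t0 te te']; rewrite hornerD hornerN.
  by rewrite -(Qr _ _).2 ?t0// -(Qr' _ _).2 ?t0// QKL subrr.
have el : pl' = pl.
  apply/eqP; rewrite -subr_eq0; apply/eqP/(poly0_near_left m0) => t.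
  rewrite lt_min => /and3P[t0 te te']; rewrite hornerD hornerN.
  by rewrite -(Ql _ _).2 ?t0// -(Ql' _ _).2 ?t0// QKL subrr.
rewrite er el in L0 L1 => {er el Qr Ql Qr' Ql'}.
have [sK|nK] := boolP (straddled s (mult_fun K)); last first.
  split=> //; apply/esym/negbTE; apply/negP => /L1[_].
  by rewrite (K0 nK) eqxx.
have [KA KB] := K1 sK.
have [sL|nL] := boolP (straddled s (mult_fun L)); last by rewrite (L0 nL) eqxx in KB.
have [LA LB] := L1 sL; split=> // _.
have mle M : mcard M = 8%N -> ~~ degen v M -> straddled s (mult_fun M) -> (multiplicity s (mult_fun M) <= 7)%N.
  move=> cM ndM _; have mE (j : 'I_10) : mult_fun M j = M j by rewrite /mult_fun inord_val.
  by rewrite -(on_lineE D0 s mE); exact: (on_line_lt _ 0 (seg_jacobian D0 s_ok) cM ndM).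
have mK := mle K cK ndK sK; have mL := mle L cL ndL sL.
have e7 := first_diff_uniq KA KB LA LB.
by rewrite -(subKn mK) -(subKn mL) e7.
Qed.

End Necessity.


(** * Gluing polynomial pieces *)

Section Gluing.
Variables (R : realType) (N : nat) (cell : 'I_N -> set (R * R)%type) (t0 : 'I_N).
Variable T : set (R * R)%type.
Hypothesis cell_closed : forall t, closed (cell t).
Hypothesis cell_cover : forall x, T x -> exists t, cell t x.
Implicit Types (F : 'I_N -> R * R -> R) (x p q e : (R * R)%type).

Definition agreeing F := forall x t t', cell t x -> cell t' x -> F t x = F t' x.

Definition glue_cells F x : R := F (xget t0 [set t | cell t x]) x.

Lemma glueE F t x : agreeing F -> cell t x -> glue_cells F x = F t x.
Proof.
move=> aF tx; apply: aF (tx).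
exact: (@xgetPex _ t0 [set t | cell t x] (ex_intro _ t tx)).
Qed.

(** The cells that do not contain [p] are finitely many closed sets, so they stay away
from [p]. *)
Lemma near_cell p : T p -> \forall q \near p, T q -> exists t, cell t p /\ cell t q.
Proof.
move=> Tp; have near1 t : \forall q \near p, cell t q -> cell t p.
  have [pt|npt] := pselect (cell t p); first exact: (@filterE _ (nbhs p) _ _ (fun q _ => pt)).
  have : nbhs p (~` cell t).
    by apply: open_nbhs_nbhs; split => //; exact: closed_openC.
  by apply: (@filterS _ (nbhs p)).
have := filter_forall (nbhs_filter p) near1.
apply: (@filterS _ (nbhs p)) => q hq /cell_cover[t tq].
by exists t; split => //; exact: hq.
Qed.

Lemma glue_continuous F : agreeing F -> (forall t, continuous (F t)) ->
  {within T, continuous (glue_cells F)}.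
Proof.
move=> aF cF; apply/subspace_continuousP => p Tp.
apply/cvgrPdist_lt => eps eps0.
have near1 t : \forall q \near p, cell t p -> cell t q -> `|glue_cells F p - glue_cells F q| < eps.
  have [tp|ntp] := pselect (cell t p); last by exact: (@filterE _ (nbhs p) _ _ (fun q tp => False_ind _ (ntp tp))).
  have /cvgrPdist_lt/(_ _ eps0) := cF t p.
  apply: (@filterS _ (nbhs p)) => q hq _ tq.
  by rewrite (glueE aF tp) (glueE aF tq).
have H1 := filter_forall (nbhs_filter p) near1.
have H2 := near_cell Tp.
apply: (@filterS2 _ (nbhs p) _ _ _ _ _ H1 H2) => q h1 h2 Tq.
by have [t [tp tq]] := h2 Tq; exact: h1 tp tq.
Qed.

(** A difference quotient at [p] is, for each small parameter, that of a piece whose cell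
contains [p]; these pieces are finitely many and their derivatives at [p] agree. *)
Lemma glue_derive F dF p e : agreeing F -> agreeing dF -> interior T p ->
  (forall t, is_derive p e (F t) (dF t p)) -> is_derive p e (glue_cells F) (glue_cells dF p).
Proof.
move=> aF adF ip dtF; have Tp := interior_subset ip.
apply: is_derive_lim; apply/cvgrPdist_lt => eps eps0.
have line : h *: e + p @[h --> (0:R)] --> p.
  rewrite -[X in _ --> X](_ : (0:R) *: e + p = p); last by rewrite scale0r add0r.
  by apply: cvgD; [apply: cvgZr_tmp; exact: cvg_id|exact: cvg_cst].
have near1 t : \forall h \near (0:R)^', cell t p -> cell t (h *: e + p) ->
    `|glue_cells dF p - h^-1 * (glue_cells F (h *: e + p) - glue_cells F p)| < eps.
  have [tp|ntp] := pselect (cell t p); last by near=> q => /ntp.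
  have /cvgrPdist_lt/(_ _ eps0) := is_derive_cvg (dtF t).
  apply: (@filterS _ ((0:R)^')) => h hh _ th.
  by rewrite (glueE adF tp) (glueE aF tp) (glueE aF th).
have H1 : \forall h \near (0:R)^', forall t, cell t p -> cell t (h *: e + p) ->
    `|glue_cells dF p - h^-1 * (glue_cells F (h *: e + p) - glue_cells F p)| < eps.
  exact: filter_forall near1.
have H2 : \forall h \near (0:R)^', exists t, cell t p /\ cell t (h *: e + p).
  apply: nbhs_dnbhs; have := near_cell Tp.
  have := ip; rewrite /interior => iT.
  move=> nc; have nc' : \forall q \near p, exists t, cell t p /\ cell t q.
    by near=> q; have : T q by [near: q]; near: q.
  exact: (line _ nc').
near=> h; have [t [tp th]] : exists t, cell t p /\ cell t (h *: e + p) by near: h.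
by move: t tp th; near: h.
Unshelve. all: by end_near. Qed.

(* A wall lies on the zero set of an affine function and separates two cells; pieces
   that agree across every wall agree wherever cells meet. *)
Variable wall : eqType.
Variables (walls : seq wall) (side1 side2 : wall -> 'I_N) (wx wy wc : wall -> R).
Definition wall_fun w p : R := wx w * p.1 + wy w * p.2 + wc w.
Hypothesis walls_agree : forall F,
  (forall w x, w \in walls -> wall_fun w x = 0 -> F (side1 w) x = F (side2 w) x) -> agreeing F.

(** Divisibility of the jumps by a power of the function of the wall expresses
smoothness without reference to points, and survives differentiation. *)
Definition jumps k F := (forall t, polynomial_fun (F t)) /\
  forall w, w \in walls -> exists2 G, polynomial_fun G &
    forall x, F (side1 w) x - F (side2 w) x = wall_fun w x ^+ k * G x.

Lemma jumps_agreeing k F : jumps k.+1 F -> agreeing F.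
Proof.
move=> [_ jF]; apply: walls_agree => w x /jF[G _ GE] wx0.
by apply/eqP; rewrite -subr_eq0 GE wx0 expr0n mul0r.
Qed.

Lemma jumps_derive k F e : jumps k.+1 F -> exists2 dF, jumps k dF &
  forall t p, is_derive p e (F t) (dF t p).
Proof.
move=> [pF jF].
have [dF dFP] : {dF : 'I_N -> R * R -> R | forall t, polynomial_fun (dF t) /\
    forall p, is_derive p e (F t) (dF t p)}.
  have ex t : exists dF, polynomial_fun dF /\ forall p, is_derive p e (F t) (dF p).
    by have [df ? ?] := polynomial_derive e (pF t); exists df.
  exists (fun t => projT1 (cid (ex t))) => t; exact: (projT2 (cid (ex t))).
exists dF; last by move=> t; exact: (dFP t).2.
split=> [t|w /jF[G pG GE]]; first exact: (dFP t).1.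
have [dG pdG dGE] := polynomial_derive e pG.
pose l : R := wx w * e.1 + wy w * e.2.
have dw p : is_derive p e (wall_fun w) l.
  by apply: is_derive_affine => h; rewrite /wall_fun /l /= /GRing.scale/=; ring.
have pw : polynomial_fun (wall_fun w) by exact: polynomial_affine.
exists (fun x => k.+1%:R * l * G x + wall_fun w x * dG x).
  apply: polynomialD; last exact: polynomialM.
  by apply: polynomialM => //; exact: polynomial_cst.
move=> x.
have d1 : is_derive x e (fun x => F (side1 w) x - F (side2 w) x)
    (dF (side1 w) x - dF (side2 w) x).
  by apply: is_deriveB; exact: (dFP _).2.
have d2 := is_deriveM (is_deriveX k.+1 (dw x)) (dGE x).
have E : (fun x => F (side1 w) x - F (side2 w) x) = (wall_fun w ^+ k.+1 * G).
  by apply/funext => z; rewrite GE /GRing.mul /= fctE.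
rewrite E in d1; rewrite -(derive_val (is_derive:=d1)) (derive_val (is_derive:=d2)).
rewrite /GRing.scale /= exprfctE exprS.
have id (A B C E1 E2 E3 : R) : C * A * E1 + E2 * (B * A * E3) = A * (B * E3 * E2 + C * E1).
  by ring.
exact: id.
Qed.

Lemma glue_C_on k F : jumps k.+1 F -> C_on k T (glue_cells F).
Proof.
elim: k F => [|k IH] F jF /=.
  split => //; apply: glue_continuous; first exact: jumps_agreeing jF.
  by move=> t; apply: polynomial_continuous; exact: jF.1.
split.
  apply: glue_continuous; first exact: jumps_agreeing jF.
  by move=> t; apply: polynomial_continuous; exact: jF.1.
have [Fx jx dx] := jumps_derive (1, 0) jF.
have [Fy jy dy] := jumps_derive (0, 1) jF.
exists (glue_cells Fx), (glue_cells Fy); split; [exact: IH|exact: IH|move=> p ip].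
split; apply: glue_derive => //; first [exact: jumps_agreeing jF
  |exact: jumps_agreeing jx|exact: jumps_agreeing jy].
Qed.

End Gluing.


(** * The cells of the 12-split *)

(** For each triangle of the 12-split, the linear forms that are nonnegative on it; the
order is that of the opposite vertices. *)
Definition cell_sides : seq (seq vec) :=
  [:: [:: (1, -1, -1); (0, 1, -1); (0, 0, 1)];
      [:: (1, -1, -1); (0, 1, 0); (0, -1, 1)];
      [:: (-1, 1, -1); (1, 0, -1); (0, 0, 1)];
      [:: (-1, 1, -1); (1, 0, 0); (-1, 0, 1)];
      [:: (-1, -1, 1); (-1, 1, 0); (1, 0, 0)];
      [:: (-1, -1, 1); (0, 1, 0); (1, -1, 0)];
      [:: (0, 1, -1); (1, -1, 0); (-1, 1, 1)];
      [:: (1, 0, -1); (0, -1, 1); (-1, 1, 1)];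
      [:: (1, -1, 0); (-1, 0, 1); (1, 1, -1)];
      [:: (0, -1, 1); (-1, 1, 0); (1, 1, -1)];
      [:: (-1, 0, 1); (0, 1, -1); (1, -1, 1)];
      [:: (-1, 1, 0); (1, 0, -1); (1, -1, 1)]]%Z.

(** A point inside each cell, on no line through two of the ten points. *)
Definition cell_points : seq vec :=
  [:: (5, 3, 1); (5, 1, 3); (3, 5, 1); (1, 5, 3); (1, 3, 5); (3, 1, 5); (6, 5, 2);
      (6, 2, 5); (5, 2, 6); (2, 5, 6); (2, 6, 5); (5, 6, 2)]%Z.

(** The fifteen interior edges: the form of the line, then the cells on its positive and
on its negative side. *)
Definition walls : seq (vec * (nat * nat)) :=
  [:: ((1, 0, -1)%Z, (2, 3));
      ((1, 0, -1)%Z, (11, 10));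
      ((1, 0, -1)%Z, (7, 8));
      ((-1, 1, 0)%Z, (4, 5));
      ((-1, 1, 0)%Z, (9, 8));
      ((-1, 1, 0)%Z, (11, 6));
      ((-1, 1, -1)%Z, (3, 10));
      ((-1, 1, -1)%Z, (2, 11));
      ((1, 1, -1)%Z, (9, 4));
      ((1, 1, -1)%Z, (8, 5));
      ((0, 1, -1)%Z, (10, 9));
      ((0, 1, -1)%Z, (6, 7));
      ((0, 1, -1)%Z, (0, 1));
      ((-1, 1, 1)%Z, (7, 1));
      ((-1, 1, 1)%Z, (6, 0))]%N.

Definition cell_side (t i : nat) : vec := nth (0, 0, 0)%Z (nth [::] cell_sides t) i.
Definition cell_point (t : nat) : vec := nth (0, 0, 0)%Z cell_points t.
Definition cell_vertices (t : nat) : nat * nat * nat := nth (1, 1, 1)%N triangles12 t.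

Definition same_sign (a b : int) : bool := [&& a != 0, b != 0 & (0 < a) == (0 < b)].
Definition compatible_sign (a b : int) : bool := (0 <= a) && (0 <= b) || (a <= 0) && (b <= 0).

(** The table of cells is correct. By the last two conditions no line through two of
v1, ..., v6 separates points of the cell, so that [base_same] applies in it. *)
Definition cell_ok (t : nat) : bool :=
  let: (i, j, k) := cell_vertices t in
  let a := vx i.-1 in let b := vx j.-1 in let c := vx k.-1 in
  let ha := cell_side t 0 in let hb := cell_side t 1 in let hc := cell_side t 2 in
  let y := cell_point t in
  [&& [&& i.-1 < 10, j.-1 < 10 & k.-1 < 10]%N, vec_det a b c != 0,
    [&& 0 < vec_dot ha a, vec_dot ha b == 0 & vec_dot ha c == 0],
    [&& vec_dot hb a == 0, 0 < vec_dot hb b & vec_dot hb c == 0],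
    [&& vec_dot hc a == 0, vec_dot hc b == 0 & 0 < vec_dot hc c],
    0 < vec_sum y,
    all (fun p => all (fun q => (p == q) || (vec_det y (vx p) (vx q) != 0)) (iota 0 10)) (iota 0 10) &
    all (fun p => all (fun q => all (fun z =>
      compatible_sign (vec_det z (vx p) (vx q)) (vec_det y (vx p) (vx q))) [:: a; b; c]) (iota 0 6)) (iota 0 6)].

Lemma cells_ok : all cell_ok (iota 0 12).
Proof. by vm_compute. Qed.

(** Seen from the chosen points of the two cells and from the middle of the wall, pairs
of points among v1, ..., v6 have the same orientation, unless both lie on the wall. This
is the hypothesis of [base_jump]. *)
Definition wall_of (w : vec * (nat * nat)) (s : segment) : bool :=
  let: (h, (t, t')) := w in let y := cell_point t in let y' := cell_point t' in
  let x := seg_x s in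
  if (seg_kind s == 1%N) && (seg_h s == h) then
  [&& (t < 12)%N, (t' < 12)%N, 0 < vec_dot h y, vec_dot h y' < 0 &
   all (fun p => all (fun q => (p == q) || on_seg s p && on_seg s q ||
     same_sign (vec_det y (vx p) (vx q)) (vec_det x (vx p) (vx q)) &&
     same_sign (vec_det y' (vx p) (vx q)) (vec_det x (vx p) (vx q))) (iota 0 6)) (iota 0 6)]
  else false.

Lemma walls_ok : all (fun w => has (wall_of w) segments) walls.
Proof. by vm_compute. Qed.

Definition in_cell (R : realType) (l1 l2 l3 : R) (t : nat) : bool :=
  all (fun a : vec => 0 <= a.1.1%:~R * l1 + a.1.2%:~R * l2 + a.2%:~R * l3)
    (nth [::] cell_sides t).

Lemma cells_cover (R : realType) (l1 l2 l3 : R) : 0 <= l1 -> 0 <= l2 -> 0 <= l3 ->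
  exists2 t, (t < 12)%N & in_cell l1 l2 l3 t.
Proof.
move=> h1 h2 h3; rewrite /in_cell.
have [a|a] := leP l2 l1; have [b|b] := leP l3 l2; have [c|c] := leP l3 l1.
- have [d|d] := leP (l2 + l3) l1; [exists 0%N|exists 6%N] => //=; apply/and4P; split=> //; lra.
- by exfalso; lra.
- have [d|d] := leP (l2 + l3) l1; [exists 1%N|exists 7%N] => //=; apply/and4P; split=> //; lra.
- have [d|d] := leP (l1 + l2) l3; [exists 5%N|exists 8%N] => //=; apply/and4P; split=> //; lra.
- have [d|d] := leP (l1 + l3) l2; [exists 2%N|exists 11%N] => //=; apply/and4P; split=> //; lra.
- have [d|d] := leP (l1 + l3) l2; [exists 3%N|exists 10%N] => //=; apply/and4P; split=> //; lra.
- by exfalso; lra.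
- have [d|d] := leP (l1 + l2) l3; [exists 4%N|exists 9%N] => //=; apply/and4P; split=> //; lra.
Qed.

(** Two cells with a common point [x] are joined by walls through [x]. The inner cells 6
to 11 correspond to the orders of the three coordinates, and two of them meet where
coordinates are equal; a corner cell meets its inner neighbour where one coordinate is
the sum of the others. *)
Lemma cells_agree (R : realType) (l1 l2 l3 : R) (f : nat -> R) :
  (forall w, w \in walls -> w.1.1.1%:~R * l1 + w.1.1.2%:~R * l2 + w.1.2%:~R * l3 = 0 ->
     f w.2.1 = f w.2.2) ->
  forall t t', (t < 12)%N -> (t' < 12)%N -> in_cell l1 l2 l3 t -> in_cell l1 l2 l3 t' ->
  f t = f t'.
Proof.
have z0 : l1 = l3 -> (1)%Z%:~R * l1 + (0)%Z%:~R * l2 + (-1)%Z%:~R * l3 = 0 :> R by move=> ->; ring.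
have z1 : l1 = l2 -> (-1)%Z%:~R * l1 + (1)%Z%:~R * l2 + (0)%Z%:~R * l3 = 0 :> R by move=> ->; ring.
have z2 : l2 = l3 -> (0)%Z%:~R * l1 + (1)%Z%:~R * l2 + (-1)%Z%:~R * l3 = 0 :> R by move=> ->; ring.
have z3 : l2 = l1 + l3 -> (-1)%Z%:~R * l1 + (1)%Z%:~R * l2 + (-1)%Z%:~R * l3 = 0 :> R by move=> ->; ring.
have z4 : l3 = l1 + l2 -> (1)%Z%:~R * l1 + (1)%Z%:~R * l2 + (-1)%Z%:~R * l3 = 0 :> R by move=> ->; ring.
have z5 : l1 = l2 + l3 -> (-1)%Z%:~R * l1 + (1)%Z%:~R * l2 + (1)%Z%:~R * l3 = 0 :> R by move=> ->; ring.
have c0 : in_cell l1 l2 l3 0 -> [/\ 0 <= l3, l3 <= l2 & l2 + l3 <= l1].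
  by clear; move=> /= /and4P[] /= ? ? ? _; split; lra.
have c1 : in_cell l1 l2 l3 1 -> [/\ 0 <= l2, l2 <= l3 & l3 + l2 <= l1].
  by clear; move=> /= /and4P[] /= ? ? ? _; split; lra.
have c2 : in_cell l1 l2 l3 2 -> [/\ 0 <= l3, l3 <= l1 & l1 + l3 <= l2].
  by clear; move=> /= /and4P[] /= ? ? ? _; split; lra.
have c3 : in_cell l1 l2 l3 3 -> [/\ 0 <= l1, l1 <= l3 & l3 + l1 <= l2].
  by clear; move=> /= /and4P[] /= ? ? ? _; split; lra.
have c4 : in_cell l1 l2 l3 4 -> [/\ 0 <= l1, l1 <= l2 & l2 + l1 <= l3].
  by clear; move=> /= /and4P[] /= ? ? ? _; split; lra.
have c5 : in_cell l1 l2 l3 5 -> [/\ 0 <= l2, l2 <= l1 & l1 + l2 <= l3].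
  by clear; move=> /= /and4P[] /= ? ? ? _; split; lra.
have c6 : in_cell l1 l2 l3 6 -> [/\ l3 <= l2, l2 <= l1, l3 <= l1 & l1 <= l2 + l3].
  by clear; move=> /= /and4P[] /= ? ? ? _; split; lra.
have c7 : in_cell l1 l2 l3 7 -> [/\ l2 <= l3, l3 <= l1, l2 <= l1 & l1 <= l3 + l2].
  by clear; move=> /= /and4P[] /= ? ? ? _; split; lra.
have c8 : in_cell l1 l2 l3 8 -> [/\ l2 <= l1, l1 <= l3, l2 <= l3 & l3 <= l1 + l2].
  by clear; move=> /= /and4P[] /= ? ? ? _; split; lra.
have c9 : in_cell l1 l2 l3 9 -> [/\ l1 <= l2, l2 <= l3, l1 <= l3 & l3 <= l2 + l1].
  by clear; move=> /= /and4P[] /= ? ? ? _; split; lra.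
have c10 : in_cell l1 l2 l3 10 -> [/\ l1 <= l3, l3 <= l2, l1 <= l2 & l2 <= l3 + l1].
  by clear; move=> /= /and4P[] /= ? ? ? _; split; lra.
have c11 : in_cell l1 l2 l3 11 -> [/\ l3 <= l1, l1 <= l2, l3 <= l2 & l2 <= l1 + l3].
  by clear; move=> /= /and4P[] /= ? ? ? _; split; lra.
move=> H.
have W a b c t t' : ((a, b, c), (t, t')) \in walls ->
   a%:~R * l1 + b%:~R * l2 + c%:~R * l3 = 0 -> f t = f t' by exact: H.
have a2_3 : l1 = l3 -> f 2%N = f 3%N by move/z0; exact: W.
have a11_10 : l1 = l3 -> f 11%N = f 10%N by move/z0; exact: W.
have a7_8 : l1 = l3 -> f 7%N = f 8%N by move/z0; exact: W.
have a4_5 : l1 = l2 -> f 4%N = f 5%N by move/z1; exact: W.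
have a9_8 : l1 = l2 -> f 9%N = f 8%N by move/z1; exact: W.
have a11_6 : l1 = l2 -> f 11%N = f 6%N by move/z1; exact: W.
have a3_10 : l2 = l1 + l3 -> f 3%N = f 10%N by move/z3; exact: W.
have a2_11 : l2 = l1 + l3 -> f 2%N = f 11%N by move/z3; exact: W.
have a9_4 : l3 = l1 + l2 -> f 9%N = f 4%N by move/z4; exact: W.
have a8_5 : l3 = l1 + l2 -> f 8%N = f 5%N by move/z4; exact: W.
have a10_9 : l2 = l3 -> f 10%N = f 9%N by move/z2; exact: W.
have a6_7 : l2 = l3 -> f 6%N = f 7%N by move/z2; exact: W.
have a0_1 : l2 = l3 -> f 0%N = f 1%N by move/z2; exact: W.
have a7_1 : l1 = l2 + l3 -> f 7%N = f 1%N by move/z5; exact: W.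
have a6_0 : l1 = l2 + l3 -> f 6%N = f 0%N by move/z5; exact: W.
clear H W z0 z1 z2 z3 z4 z5.
have inner t t' : (6 <= t < 12)%N -> (6 <= t' < 12)%N ->
    in_cell l1 l2 l3 t -> in_cell l1 l2 l3 t' -> f t = f t'.
  have [[e12 e23]|ne] := pselect (l1 = l2 /\ l2 = l3).
    have e13 : l1 = l3 by rewrite e12.
    have E u : (6 <= u < 12)%N -> f u = f 6.
      move: u => [|[|[|[|[|[|[|[|[|[|[|[|u]]]]]]]]]]]] // _.
      - by rewrite a6_7.
      - by rewrite -a7_8// a6_7.
      - by rewrite a9_8// -a7_8// a6_7.
      - by rewrite -a11_10// a11_6.
      - exact: a11_6.
    by move=> ht ht' _ _; rewrite (E t)// (E t').
  have ne1 : l1 = l2 -> l1 = l3 -> False by move=> e e'; apply: ne; rewrite -e e'.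
  have ne2 : l1 = l3 -> l2 = l3 -> False by move=> e e'; apply: ne; rewrite e e'.
  have ne3 : l1 = l2 -> l2 = l3 -> False by move=> e e'; exact: ne.
  have le_eq (a b : R) : a <= b -> b <= a -> a = b by move=> h h'; apply/le_anti/andP.
  move: t t' => [|[|[|[|[|[|[|[|[|[|[|[|t]]]]]]]]]]]] //
    [|[|[|[|[|[|[|[|[|[|[|[|t']]]]]]]]]]]] // _ _;
    do [move/c6|move/c7|move/c8|move/c9|move/c10|move/c11] => -[h1 h2 h3 _];
    do [move/c6|move/c7|move/c8|move/c9|move/c10|move/c11] => -[h4 h5 h6 _] //;
    first [(first [apply: a6_7|apply: a7_8|apply: a9_8|apply: a10_9|apply: a11_10|apply: a11_6
        |apply/esym/a6_7|apply/esym/a7_8|apply/esym/a9_8|apply/esym/a10_9|apply/esym/a11_10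
        |apply/esym/a11_6]); apply: le_eq; assumption
      |exfalso; (first [apply: ne1; [apply: le_eq; assumption|apply: le_eq; assumption]
        |apply: ne2; [apply: le_eq; assumption|apply: le_eq; assumption]
        |apply: ne3; [apply: le_eq; assumption|apply: le_eq; assumption]])].
have [[r1 r2 r3]|ne] := pselect [/\ l1 <= l2 + l3, l2 <= l1 + l3 & l3 <= l1 + l2].
  (* Under the triangle inequalities a point of a corner cell lies on the wall to the
     inner neighbour. *)
  have in_inner t : (t < 12)%N -> in_cell l1 l2 l3 t ->
      exists2 u, (6 <= u < 12)%N & in_cell l1 l2 l3 u /\ f u = f t.
    have [t6|t6] := leqP 6 t; first by move=> t12 ht; exists t; rewrite ?t6.
    move=> _; move: t t6 => [|[|[|[|[|[|//]]]]]] _.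
    - move/c0 => -[h1 h2 h3]; exists 6%N => //; split; last first.
        by apply: a6_0; apply: le_anti; apply/andP; split=> //; clear -r1 r2 r3 h1 h2 h3; lra.
      by apply/and4P; split=> //=; clear -r1 r2 r3 h1 h2 h3; lra.
    - move/c1 => -[h1 h2 h3]; exists 7%N => //; split; last first.
        by apply: a7_1; apply: le_anti; apply/andP; split=> //; clear -r1 r2 r3 h1 h2 h3; lra.
      by apply/and4P; split=> //=; clear -r1 r2 r3 h1 h2 h3; lra.
    - move/c2 => -[h1 h2 h3]; exists 11%N => //; split; last first.
        by apply: esym; apply: a2_11; apply: le_anti; apply/andP; split=> //; clear -r1 r2 r3 h1 h2 h3; lra.
      by apply/and4P; split=> //=; clear -r1 r2 r3 h1 h2 h3; lra.
    - move/c3 => -[h1 h2 h3]; exists 10%N => //; split; last first.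
        by apply: esym; apply: a3_10; apply: le_anti; apply/andP; split=> //; clear -r1 r2 r3 h1 h2 h3; lra.
      by apply/and4P; split=> //=; clear -r1 r2 r3 h1 h2 h3; lra.
    - move/c4 => -[h1 h2 h3]; exists 9%N => //; split; last first.
        by apply: a9_4; apply: le_anti; apply/andP; split=> //; clear -r1 r2 r3 h1 h2 h3; lra.
      by apply/and4P; split=> //=; clear -r1 r2 r3 h1 h2 h3; lra.
    - move/c5 => -[h1 h2 h3]; exists 8%N => //; split; last first.
        by apply: a8_5; apply: le_anti; apply/andP; split=> //; clear -r1 r2 r3 h1 h2 h3; lra.
      by apply/and4P; split=> //=; clear -r1 r2 r3 h1 h2 h3; lra.
  move=> t t' t12 t'12 /(in_inner _ t12)[u hu [iu <-]] /(in_inner _ t'12)[u' hu' [iu' <-]].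
  exact: inner.
have corner t : (6 <= t < 12)%N -> ~ in_cell l1 l2 l3 t.
  move: t => [|[|[|[|[|[|[|[|[|[|[|[|t]]]]]]]]]]]] // _;
    do [move/c6|move/c7|move/c8|move/c9|move/c10|move/c11] => -[h1 h2 h3 h4];
    apply: ne; clear -h1 h2 h3 h4; split; lra.
move=> t t' t12 t'12 ht ht'.
have t6 : (t < 6)%N by rewrite ltnNge; apply/negP => h; apply: (corner t); rewrite ?h.
have t'6 : (t' < 6)%N by rewrite ltnNge; apply/negP => h; apply: (corner t'); rewrite ?h.
move: t t' t6 t'6 ht ht' {t12 t'12} => [|[|[|[|[|[|//]]]]]] [|[|[|[|[|[|//]]]]]] _ _;
    do [move/c0|move/c1|move/c2|move/c3|move/c4|move/c5] => -[h1 h2 h3];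
    do [move/c0|move/c1|move/c2|move/c3|move/c4|move/c5] => -[h4 h5 h6] //;
  first [(first [apply: a0_1|apply: a2_3|apply: a4_5|apply/esym/a0_1|apply/esym/a2_3|apply/esym/a4_5]);
      apply: le_anti; apply/andP; split; assumption
    |exfalso; apply: ne; clear -h1 h2 h3 h4 h5 h6; split; lra].
Qed.


Section Cells.
Variable R : realType.
Variables v1 v2 v3 : R * R.
Hypothesis D0 : D v1 v2 v3 != 0.
Notation v := (split12 v1 v2 v3).
Notation T := (triangle v1 v2 v3).
Notation form := (lin v1 v2 v3).
Notation point := (pt v1 v2 v3).

Definition cell12 (t : 'I_12) : set (R * R)%type :=
  let: (i, j, k) := cell_vertices t in triangle (v (ix i)) (v (ix j)) (v (ix k)).

Lemma lin_comb a (x y z : R) (p q r : R * R) : x + y + z = 1 ->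
  form a (x *: p + y *: q + z *: r) = x * form a p + y * form a q + z * form a r.
Proof.
move=> s; have -> : x = 1 - y - z by lra.
by rewrite /lin /= /GRing.scale/=; ring.
Qed.

Lemma lin_basis a p : form a p = a.1.1%:~R * form (1, 0, 0) p + a.1.2%:~R * form (0, 1, 0) p
  + a.2%:~R * form (0, 0, 1) p.
Proof. by rewrite /lin /lin_x /lin_y /lin_c /=; ring. Qed.

Notation in_cell_at x t := (in_cell (form (1, 0, 0) x) (form (0, 1, 0) x) (form (0, 0, 1) x) t).

Lemma in_cellE (t : 'I_12) x : in_cell_at x t =
  [&& 0 <= form (cell_side t 0) x, 0 <= form (cell_side t 1) x & 0 <= form (cell_side t 2) x].
Proof.
rewrite !(lin_basis (cell_side _ _)) /in_cell.
by case: t => -[|[|[|[|[|[|[|[|[|[|[|[|//]]]]]]]]]]]] ?; rewrite /= andbT.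
Qed.

Lemma cellP t x : cell12 t x <-> in_cell_at x t.
Proof.
rewrite in_cellE /cell12.
have : cell_ok t by apply: (allP cells_ok); rewrite mem_iota/= ltn_ord.
rewrite /cell_ok; case: (cell_vertices t) => -[i j] k.
move=> /and5P[/and3P[i10 j10 k10] d0 /and3P[aa /eqP ab /eqP ac] /and3P[/eqP ba bb /eqP bc]].
move=> /and4P[/and3P[/eqP ca /eqP cb cc] _ _ _].
have lv a l : (l.-1 < 10)%N -> form a (v (ix l)) = (vec_dot a (vx l.-1))%:~R / 12.
  by move=> hl; rewrite lin_v// /ix inordK.
have lpos a l : (l.-1 < 10)%N -> 0 < vec_dot a (vx l.-1) -> 0 < form a (v (ix l)).
  by move=> hl p; rewrite lv// divr_gt0 ?ltr0z.
have l0 a l : (l.-1 < 10)%N -> vec_dot a (vx l.-1) = 0 -> form a (v (ix l)) = 0.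
  by move=> hl p; rewrite lv// p mul0r.
have {aa} aa := lpos _ _ i10 aa; have {bb} bb := lpos _ _ j10 bb; have {cc} cc := lpos _ _ k10 cc.
have {ab} ab := l0 _ _ j10 ab; have {ac} ac := l0 _ _ k10 ac.
have {ba} ba := l0 _ _ i10 ba; have {bc} bc := l0 _ _ k10 bc.
have {ca} ca := l0 _ _ i10 ca; have {cb} cb := l0 _ _ j10 cb.
split.
  move=> /triangleP[w [w1 w2 w3 sw ->]]; rewrite !lin_comb// ab ac ba bc ca cb.
  by rewrite !mulr0 !addr0 !add0r !mulr_ge0// ltW.
have s12 l : (l.-1 < 10)%N -> vec_sum (vx l.-1) = 12 by move=> hl; exact: (vx_sum (Ordinal hl)).
have DE : D (v (ix i)) (v (ix j)) (v (ix k)) != 0.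
  rewrite !split12_ix// D_pt ?s12//.
  by rewrite !mulf_neq0 ?invr_eq0 ?mulf_neq0 ?intr_eq0.
have [s1 xE] := bary_coord x DE.
rewrite {1 2 3}xE !lin_comb// ab ac ba bc ca cb !mulr0 !addr0 !add0r => /and3P[h1 h2 h3].
by apply/triangle_DP => //; split; [move: h1|move: h2|move: h3]; rewrite pmulr_lge0.
Qed.

Lemma cell_closed t : closed (cell12 t).
Proof.
have -> : cell12 t = \bigcap_(a in [set` [:: cell_side t 0; cell_side t 1; cell_side t 2]])
    [set x | 0 <= form a x].
  rewrite eqEsubset; split=> x.
    move=> /cellP; rewrite in_cellE => /and3P[h1 h2 h3] a /=.
    by rewrite !inE => /or3P[] /eqP ->.
  move=> h; apply/cellP; rewrite in_cellE; apply/and3P.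
  by split; apply: (h (cell_side t _)); rewrite /= !inE eqxx ?orbT.
apply: closed_bigI => a _.
have pa : polynomial_fun (form a) by exact: polynomial_affine.
apply: (@closed_comp _ _ (form a) [set y | 0 <= y]); last exact: closed_ge.
by move=> x _; exact: (@polynomial_continuous R _ pa x).
Qed.

Lemma cell_cover x : T x -> exists t, cell12 t x.
Proof.
move=> /triangleP[w [w1 w2 w3 sw xE]].
have lE a : form a x = w.1.1 * a.1.1%:~R + w.1.2 * a.1.2%:~R + w.2 * a.2%:~R.
  have lv i : (i < 3)%N -> form a (v (inord i)) = (vec_dot a (vx i))%:~R / 12.
    by move=> hi; rewrite lin_v// inordK// (leq_trans hi).
  have := lv 0%N isT; have := lv 1%N isT; have := lv 2%N isT.
  rewrite -[inord 2]/(ix 3) -[inord 1]/(ix 2) -[inord 0]/(ix 1).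
  rewrite split12_ix1 split12_ix2 split12_ix3 => e3 e2 e1.
  rewrite xE lin_comb// e1 e2 e3 /vec_dot /= !mulr0 !addr0 !add0r !intrM.
  by field.
have [] := @cells_cover R (form (1, 0, 0) x) (form (0, 1, 0) x) (form (0, 0, 1) x).
- by rewrite lE /= !mulr0 !addr0 mulr1.
- by rewrite lE /= !mulr0 !addr0 add0r mulr1.
- by rewrite lE /= !mulr0 !add0r mulr1.
- by move=> t t12 ht; exists (Ordinal t12); apply/cellP.
Qed.

Definition wall_side1 (w : vec * (nat * nat)) : 'I_12 := inord w.2.1.
Definition wall_side2 (w : vec * (nat * nat)) : 'I_12 := inord w.2.2.

Lemma walls_agree (F : 'I_12 -> R * R -> R) :
  (forall w x, w \in walls -> form w.1 x = 0 -> F (wall_side1 w) x = F (wall_side2 w) x) ->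
  agreeing cell12 F.
Proof.
move=> H x t t' /cellP ht /cellP ht'.
have := @cells_agree R _ _ _ (fun t => F (inord t) x) _ t t' (ltn_ord t) (ltn_ord t') ht ht'.
rewrite !inord_val; apply=> w ww w0; apply: H => //.
by rewrite lin_basis.
Qed.

End Cells.


(** * Sufficiency of the conditions *)

Section Sufficiency.
Variable R : realType.
Variables v1 v2 v3 : R * R.
Hypothesis D0 : D v1 v2 v3 != 0.
Notation v := (split12 v1 v2 v3).
Notation T := (triangle v1 v2 v3).
Notation form := (lin v1 v2 v3).
Notation point := (pt v1 v2 v3).
Notation cell := (cell12 v1 v2 v3).

Lemma D_sign x y (p q : 'I_10) : 0 < vec_sum x -> 0 < vec_sum y ->
  exists2 c : R, 0 < c & D (point x) (v p) (v q) * D (point y) (v p) (v q) =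
    c * (vec_det x (vx p) (vx q) * vec_det y (vx p) (vx q))%:~R.
Proof.
move=> sx sy; have sx' := gt_eqF sx; have sy' := gt_eqF sy.
rewrite !split12_pt !D_pt ?vx_sum ?sx' ?sy'// intrM.
have sxR : (0 : R) < (vec_sum x)%:~R by rewrite ltr0z.
have syR : (0 : R) < (vec_sum y)%:~R by rewrite ltr0z.
exists ((D v1 v2 v3 / (12 * 12)) ^+ 2 / ((vec_sum x)%:~R * (vec_sum y)%:~R)).
  apply: divr_gt0; last exact: mulr_gt0.
  by rewrite exprn_even_gt0//= mulf_neq0 ?invr_eq0 ?mulf_neq0 ?pnatr_eq0.
by field; rewrite !gt_eqF.
Qed.

Lemma same_sign_gt0 x y (p q : 'I_10) : 0 < vec_sum x -> 0 < vec_sum y ->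
  same_sign (vec_det x (vx p) (vx q)) (vec_det y (vx p) (vx q)) ->
  0 < D (point x) (v p) (v q) * D (point y) (v p) (v q).
Proof.
move=> sx sy; have [c c0 ->] := D_sign p q sx sy; rewrite pmulr_rgt0// ltr0z.
by case/and3P; case: ltgtP => // a0 _; case: ltgtP => // b0 _ _;
  [exact: mulr_gt0|rewrite nmulr_rgt0].
Qed.

Lemma compatible_sign_ge0 x y (p q : 'I_10) : 0 < vec_sum x -> 0 < vec_sum y ->
  compatible_sign (vec_det x (vx p) (vx q)) (vec_det y (vx p) (vx q)) ->
  0 <= D (point x) (v p) (v q) * D (point y) (v p) (v q).
Proof.
move=> sx sy; have [c c0 ->] := D_sign p q sx sy; rewrite pmulr_rge0// ler0z.
by case/orP => /andP[a0 b0]; [exact: mulr_ge0|exact: mulr_le0].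
Qed.

Lemma mem_iota_ord n m (p : 'I_m) : (p < n)%N -> val p \in iota 0 n.
Proof. by rewrite mem_iota. Qed.

Lemma cell_point_sum (t : 'I_12) : 0 < vec_sum (cell_point t).
Proof. by case: t => -[|[|[|[|[|[|[|[|[|[|[|[|//]]]]]]]]]]]] ?. Qed.

Lemma cell_point_generic (t : 'I_12) : generic_point v (point (cell_point t)).
Proof.
have : cell_ok t by apply: (allP cells_ok); exact: mem_iota_ord.
rewrite /cell_ok; case: (cell_vertices t) => -[i j] k.
move=> /and5P[_ _ _ _ /and4P[_ _ /allP H _]] p q.
rewrite (inj_eq (split12_inj D0)) => pq; rewrite !split12_pt D_pt ?vx_sum//; last first.
  by rewrite gt_eqF// cell_point_sum.
have := allP (H _ (mem_iota_ord (ltn_ord p))) _ (mem_iota_ord (ltn_ord q)).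
rewrite (inj_eq val_inj) (negbTE pq)/= => d0.
by rewrite !mulf_neq0 ?invr_eq0 ?mulf_neq0 ?intr_eq0// gt_eqF// cell_point_sum.
Qed.

(** The determinant is affine in [x], so its sign on a cell is the one at the vertices of
the cell. *)
Lemma cell_sign (t : 'I_12) x (p q : 'I_10) : cell t x -> (p < 6)%N -> (q < 6)%N ->
  0 <= D x (v p) (v q) * D (point (cell_point t)) (v p) (v q).
Proof.
have : cell_ok t by apply: (allP cells_ok); exact: mem_iota_ord.
rewrite /cell_ok /cell12; case: (cell_vertices t) => -[i j] k.
move=> /and5P[/and3P[i10 j10 k10] _ _ _ /and4P[_ _ _ /allP H]].
move=> /triangleP[w [w1 w2 w3 sw ->]] p6 q6; rewrite !split12_ix//.
have := allP (H _ (mem_iota_ord p6)) _ (mem_iota_ord q6); rewrite /= andbT.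
have s12 l : (l.-1 < 10)%N -> 0 < vec_sum (vx l.-1).
  by move=> hl; rewrite (vx_sum (Ordinal hl)).
have sy := cell_point_sum t.
move=> /and3P[h1 h2 h3].
have := compatible_sign_ge0 (s12 _ i10) sy h1.
have := compatible_sign_ge0 (s12 _ j10) sy h2.
have := compatible_sign_ge0 (s12 _ k10) sy h3.
set y := point (cell_point t); set a := point (vx k.-1); set b := point (vx j.-1); set c := point (vx i.-1) => ha hb hc.
have -> : D (w.1.1 *: c + w.1.2 *: b + w.2 *: a) (v p) (v q) =
  w.1.1 * D c (v p) (v q) + w.1.2 * D b (v p) (v q) + w.2 * D a (v p) (v q).
  have -> : w.1.1 = 1 - w.1.2 - w.2 by lra.
  by rewrite /D /= /GRing.scale/=; ring.
by rewrite !mulrDl -!mulrA; do 2?apply: addr_ge0; apply: mulr_ge0.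
Qed.

Definition piece L (t : 'I_12) : R * R -> R := srec v (base v (point (cell_point t))) 5 L.

Variable L : mset10.
Hypothesis cL : mcard L = 8%N.
Hypothesis ndL : ~~ degen v L.
Hypothesis L6 : forall j : 'I_10, (0 < L j)%N -> (j < 6)%N.
Hypothesis okL : smooth_ok (mult_fun L).

Lemma piece_polyfun t : polyfun 5 (piece L t).
Proof.
apply: srec_polyfun => //; apply: (consistent_base (split12_D0 D0)).
exact: cell_point_generic.
Qed.

(** Either there is no jump, or it is a multiple of the power 7 - m >= 4 of the form of
the wall. *)
Lemma piece_wall w : w \in walls -> exists2 G, polynomial_fun G &
  forall x, piece L (wall_side1 w) x - piece L (wall_side2 w) x = form w.1 x ^+ 4 * G x.
Proof.
move=> ww; have /hasP[s sin] := allP walls_ok w ww.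
rewrite /wall_of; case: w ww => h [t t'] ww; case: ifPn => // /andP[/eqP k1 /eqP hE].
move=> /and5P[t12 t'12 hy hy' /allP same].
have s_ok := allP segments_ok s sin.
have s_x := seg_x_sum s_ok.
rewrite /piece /wall_side1 /wall_side2 -[(h, _).1]/h -[(h, _).2.1]/t -[(h, _).2.2]/t' !inordK// -hE.
set yp := point _; set ym := point _.
have syp : 0 < vec_sum (cell_point t) := cell_point_sum (Ordinal t12).
have sym : 0 < vec_sum (cell_point t') := cell_point_sum (Ordinal t'12).
have gyp : generic_point v yp := cell_point_generic (Ordinal t12).
have gym : generic_point v ym := cell_point_generic (Ordinal t'12).
have hyp : 0 < form (seg_h s) yp.
  by rewrite (lin_pt D0) ?gt_eqF// divr_gt0 ?ltr0z// hE.
have hym : form (seg_h s) ym < 0.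
  by rewrite (lin_pt D0) ?gt_eqF// pmulr_llt0 ?invr_gt0 ?ltr0z// ltrz0 hE.
pose A : pred 'I_10 := fun j => (j < 6)%N.
have sameA p q : A p -> A q -> v p != v q ->
    (form (seg_h s) (v p) != 0) || (form (seg_h s) (v q) != 0) ->
    0 < D yp (v p) (v q) * D (point (seg_x s)) (v p) (v q) /\
    0 < D ym (v p) (v q) * D (point (seg_x s)) (v p) (v q).
  move=> Ap Aq; rewrite (inj_eq (split12_inj D0)) !(seg_h_v D0 s) -negb_and => pq hpq.
  have := allP (same _ (mem_iota_ord Ap)) _ (mem_iota_ord Aq).
  rewrite (inj_eq val_inj) (negbTE pq) (negbTE hpq) /= => /andP[s1 s2].
  by split; apply: same_sign_gt0.
have J := base_jump (split12_D0 D0) (seg_jacobian D0 s_ok) (seg_h_x0 D0 s_ok) (seg_u_x0 D0 s_ok)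
  hyp hym gyp gym sameA.
pose b K := base v yp K - base v ym K.
have cb : consistent v b.
  by apply: consistentB; apply: (consistent_base (split12_D0 D0)).
have b_off (K : mset10) : (forall j, (0 < K j)%N -> A j) -> mcard K = 3%N -> ~~ degen v K -> _ :=
  fun AK cK ndK => (J K AK cK ndK).1.
have b_on (K : mset10) : (forall j, (0 < K j)%N -> A j) -> mcard K = 3%N -> ~~ degen v K -> _ :=
  fun AK cK ndK => (J K AK cK ndK).2.
have mE (j : 'I_10) : mult_fun L j = L j by rewrite /mult_fun inord_val.
have sok := allP okL s sin; rewrite k1 /= in sok.
have [sL|nL] := boolP (straddled s (mult_fun L)); last first.
  exists (fun=> 0) => [|x]; first exact: polynomial_cst.
  rewrite mulr0 -srecB; apply: (srec_jump0 b_off) => //.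
  by rewrite (straddlesE D0 s mE).
have m3 : (multiplicity s (mult_fun L) <= 3)%N by move: sok; rewrite sL.
have stL := sL; rewrite -(straddlesE D0 s mE) in stL.
have [G [pG _ GE]] := srec_jump cb (seg_jacobian D0 s_ok)
  (fun l _ => seg_u_off D0 s_ok (j:=l)) b_off b_on (seg_h_x0 D0 s_ok) (seg_u_x0 D0 s_ok)
  L6 cL ndL stL.
set off := off_product _ _ _ _ _ in GE.
have off0 : off != 0 by exact: off_product_neq0.
rewrite (on_lineE D0 s mE) in GE.
exists (fun x => off^-1 * (form (seg_h s) x ^+ (3 - multiplicity s (mult_fun L)) * G x)).
  apply: polynomialM; [exact: polynomial_cst|apply: polynomialM => //].
  elim: (3 - _)%N => [|r IH]; first exact: polynomial_cst.
  under eq_fun do rewrite exprS.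
  by apply: polynomialM => //; exact: polynomial_affine.
move=> x; rewrite -srecB; apply: (mulIf off0); rewrite GE.
have -> : (7 - multiplicity s (mult_fun L) = 4 + (3 - multiplicity s (mult_fun L)))%N.
  by rewrite addnBA.
by rewrite exprD -[RHS]mulrA [off^-1 * _]mulrC divfK// mulrA.
Qed.

(** As the points of [L] are among v1, ..., v6, no line other than those of the 12-split
matters, and the spline coincides with the glued pieces. *)
Lemma sufficiency : simplex_spline_in_S35 v L.
Proof.
have J : jumps walls wall_side1 wall_side2 (fun w => lin_x v1 v2 v3 w.1)
    (fun w => lin_y v1 v2 v3 w.1) (fun w => lin_c v1 v2 v3 w.1) 4 (piece L).
  split; first by move=> t; exists 5; exact: piece_polyfun.
  exact: piece_wall.
have agr : agreeing cell (piece L).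
  by apply: (jumps_agreeing _ J) => F; exact: walls_agree.
exists (glue_cells cell ord0 (piece L)).
  split.
    rewrite split12_ix1 split12_ix2 split12_ix3.
    apply: (glue_C_on _ (cell_closed D0) (cell_cover D0) _ J) => F.
    exact: walls_agree.
  move=> i j k tin; have := tin; rewrite -index_mem => t12.
  have cE : cell (Ordinal t12) = triangle (v (ix i)) (v (ix j)) (v (ix k)).
    by rewrite /cell12 /cell_vertices nth_index.
  have [c fE] := polyfun_poly2_on (cell (Ordinal t12)) (piece_polyfun (Ordinal t12)).
  by exists c => x; rewrite -cE => cx; rewrite (glueE _ agr cx) fE.
rewrite split12_ix1 split12_ix2 split12_ix3 => x Tx /(genericP (split12_inj D0)) gx.
have [t tx] := cell_cover D0 Tx; rewrite (glueE _ agr tx) (spline_srec (split12_D0 D0) (@split12_T R v1 v2 v3) (split12_inj D0) cL gx).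
apply: (base_same (split12_D0 D0) (A := fun j : 'I_10 => (j < 6)%N)) => //.
  move=> p q p6 q6 pq; rewrite lt_neqAle cell_sign// andbT eq_sym mulf_neq0//.
    exact: gx.
  exact: cell_point_generic.
exact: cell_point_generic.
Qed.

End Sufficiency.


(** * Enumeration of the smooth multisets *)

Definition seg_row : Type := (nat * seq nat * seq nat * seq nat)%type.

Definition row_of (s : segment) : seg_row :=
  (seg_kind s, [seq j <- iota 0 10 | on_seg s j], left_of s, right_of s).

(** What the conditions need of the table [segments]: the kind, the points on the line,
and those of them on either side of the segment. Listing them avoids recomputing them
for every multiset. *)
Definition seg_rows : seq seg_row := Eval vm_compute in [seq row_of s | s <- segments].

Lemma seg_rowsE : seg_rows = [seq row_of s | s <- segments].
Proof. by vm_compute. Qed.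

Definition row_straddled (m : nat -> nat) (r : seg_row) : bool :=
  has (fun j => 0 < m j)%N r.1.2 && has (fun j => 0 < m j)%N r.2.
Definition row_multiplicity (m : nat -> nat) (r : seg_row) : nat := sumn [seq m j | j <- r.1.1.2].
Definition row_ok (m : nat -> nat) (r : seg_row) : bool :=
  if r.1.1.1 == 0%N then true else if row_straddled m r then
    if r.1.1.1 == 2 then false else (row_multiplicity m r <= 3)%N else true.
Definition rows_ok (m : nat -> nat) : bool := all (row_ok m) seg_rows.
Definition row_signature (m : nat -> nat) (r : seg_row) : option nat :=
  if row_straddled m r then Some (row_multiplicity m r) else None.
(** What a simplex spline reveals about its multiset by [same_spline]. *)
Definition signature (m : nat -> nat) : seq (option nat) := [seq row_signature m r | r <- seg_rows].

Lemma row_straddledE m s : row_straddled m (row_of s) = straddled s m.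
Proof. by []. Qed.

Lemma row_multiplicityE m s : row_multiplicity m (row_of s) = multiplicity s m.
Proof. by rewrite /multiplicity -big_filter -(big_map m predT id) -sumnE. Qed.

Lemma rows_okE m : rows_ok m = smooth_ok m.
Proof.
rewrite /rows_ok seg_rowsE all_map; apply: eq_all => s.
transitivity (row_ok m (row_of s)) => //; rewrite /row_ok row_straddledE row_multiplicityE.
by rewrite -[X in X == 0%N]/(seg_kind s) -[X in X == 2]/(seg_kind s);
  case: (seg_kind s) => [|[|[|k]]]; case: straddled.
Qed.

Lemma signature_eq m m' :
  (forall s, s \in segments -> straddled s m = straddled s m' /\
     (straddled s m -> multiplicity s m = multiplicity s m')) -> signature m = signature m'.
Proof.
move=> H; rewrite /signature seg_rowsE -!map_comp; apply/eq_in_map => s /H[e1 e2].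
rewrite /comp /row_signature !row_straddledE !row_multiplicityE -e1.
by case: straddled e2 => // ->.
Qed.

Lemma seg_rows_lt10 r : r \in seg_rows ->
  {subset r.1.1.2 <= gtn 10} /\ {subset r.1.2 <= gtn 10} /\ {subset r.2 <= gtn 10}.
Proof.
have : all (fun r : seg_row => all (gtn 10) r.1.1.2 && all (gtn 10) r.1.2 && all (gtn 10) r.2) seg_rows.
  by vm_compute.
by move=> /allP H /H/andP[/andP[/allP ? /allP ?] /allP ?].
Qed.

Lemma row_straddled_ext m m' r : (forall j, (j < 10)%N -> m j = m' j) -> r \in seg_rows ->
  row_straddled m r = row_straddled m' r.
Proof.
move=> e /seg_rows_lt10[_ [h2 h3]]; congr andb; apply: eq_in_has => j hj; rewrite e//.
  exact: h2.
exact: h3.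
Qed.

Lemma row_multiplicity_ext m m' r : (forall j, (j < 10)%N -> m j = m' j) -> r \in seg_rows ->
  row_multiplicity m r = row_multiplicity m' r.
Proof.
move=> e /seg_rows_lt10[h1 _]; congr sumn; apply/eq_in_map => j hj; apply: e; exact: h1.
Qed.

Lemma signature_ext m m' : (forall j, (j < 10)%N -> m j = m' j) -> signature m = signature m'.
Proof.
move=> e; apply/eq_in_map => r rin; rewrite /row_signature.
by rewrite (row_straddled_ext e rin) (row_multiplicity_ext e rin).
Qed.

Lemma rows_ok_ext m m' : (forall j, (j < 10)%N -> m j = m' j) -> rows_ok m = rows_ok m'.
Proof.
move=> e; apply: eq_in_all => r rin; rewrite /row_ok.
by rewrite (row_straddled_ext e rin) (row_multiplicity_ext e rin).
Qed.

Lemma rows_ok_le m m' : (forall j, m j <= m' j)%N -> rows_ok m' -> rows_ok m.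
Proof.
move=> le /allP H; apply/allP => r /H; rewrite /row_ok; case: eqP => // _.
have [st|//] := boolP (row_straddled m r).
have -> : row_straddled m' r.
  case/andP: st => /hasP[i ir mi] /hasP[j jr mj]; apply/andP; split; apply/hasP.
    by exists i => //; exact: leq_trans (le i).
  by exists j => //; exact: leq_trans (le j).
case: eqP => // _; apply: leq_trans; rewrite /row_multiplicity.
by elim: r.1.1.2 => //= j s IH; exact: leq_add.
Qed.

(** Lists of the last [n] multiplicities. Removing points never creates a violation
([rows_ok_le]), so a list that violates a condition when padded by zeros needs no
extension. *)
Fixpoint tails (n : nat) : seq (seq nat) :=
  if n is n'.+1 then
    flatten [seq [seq x :: t | x <- [seq x <- iota 0 (9 - sumn t) |
        rows_ok (nth 0%N (nseq (10 - n) 0%N ++ x :: t))]] | t <- tails n']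
  else [:: [::]].

Lemma tailsP n l : (n <= 10)%N -> size l = n -> (sumn l <= 8)%N ->
  rows_ok (nth 0%N (nseq (10 - n) 0%N ++ l)) -> l \in tails n.
Proof.
elim: n l => [|n IH] [|x t]//= n10 [st] sl ok.
apply/flatten_mapP; exists t.
  apply: IH => //; [exact: ltnW|exact: leq_trans (leq_addl _ _) sl|].
  apply: rows_ok_le ok => j.
  have -> : (10 - n = (10 - n.+1) + 1)%N by rewrite addn1 -subSn.
  rewrite nseqD -catA /= !nth_cat; case: ifP => // _.
  by case: (_ - _)%N.
apply/map_f; rewrite mem_filter ok mem_iota /= add0n ltn_subRL.
by rewrite addnC ltnS.
Qed.

Definition noncollinear (l : seq nat) : bool :=
  has (fun i => if (0 < nth 0 l i)%N then
    has (fun j => if (0 < nth 0 l j)%N then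
      has (fun k => if (0 < nth 0 l k)%N then vec_det (vx i) (vx j) (vx k) != 0 else false)
        (iota 0 10) else false) (iota 0 10) else false) (iota 0 10).

Definition smooth_lists : seq (seq nat) :=
  [seq l <- tails 10 | if sumn l == 8%N then noncollinear l else false].

Definition reduces (l : seq nat) : bool :=
  all (fun e : nat * nat * nat => let: (i, j, k) := e in
    let m := (nth 0 l i.-1 + nth 0 l j.-1 + nth 0 l k.-1)%N in
    if (m < 7)%N then true else if m == 7 then
      (nth 0 l i.-1, nth 0 l j.-1, nth 0 l k.-1)%N \in quintic_bsplines else false) edges.

(** The permutations of the ten points induced by those of v1, v2, v3. *)
Definition symmetries : seq (seq nat) :=
  [:: [:: 0; 1; 2; 3; 4; 5; 6; 7; 8; 9]; [:: 1; 0; 2; 3; 5; 4; 7; 6; 8; 9];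
      [:: 0; 2; 1; 5; 4; 3; 6; 8; 7; 9]; [:: 2; 1; 0; 4; 3; 5; 8; 7; 6; 9];
      [:: 1; 2; 0; 4; 5; 3; 7; 8; 6; 9]; [:: 2; 0; 1; 5; 3; 4; 8; 6; 7; 9]]%N.

(** Multiplicities move with the points, hence the inverse permutation. *)
Definition permute (p l : seq nat) : seq nat := [seq nth 0%N l (index j p) | j <- iota 0 10].

(** A smooth multiset can be recovered from its simplex spline. *)
Lemma smooth_lists_uniq : uniq [seq signature (nth 0%N l) | l <- smooth_lists].
Proof. by vm_compute. Qed.

Lemma smooth_lists_reduces : all (fun l => reduces l ==>
  has (fun p => has (fun s => l == permute p s) quintic_list) symmetries) smooth_lists.
Proof. by vm_compute. Qed.

Lemma quintic_smooth : all (fun p => all (fun s => let l := permute p s in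
  [&& l \in smooth_lists, reduces l & all (fun j => nth 0%N l j == 0%N) (iota 6 4)])
   quintic_list) symmetries.
Proof. by vm_compute. Qed.

Lemma quintic_orbits_disjoint : all (fun p => all (fun s => all (fun p' => all (fun s' =>
  if permute p s == permute p' s' then s == s' else true) quintic_list) symmetries)
  quintic_list) symmetries.
Proof. by vm_compute. Qed.


Definition mult_list (K : mset10) : seq nat := mkseq (mult_fun K) 10.

Lemma nth_mult_list K (j : 'I_10) : nth 0%N (mult_list K) j = K j.
Proof. by rewrite nth_mkseq// /mult_fun inord_val. Qed.

Lemma nth_mult_list_fun K j : (j < 10)%N -> nth 0%N (mult_list K) j = mult_fun K j.
Proof. by move=> j10; rewrite nth_mkseq. Qed.

Lemma mult_list_inj : injective mult_list.
Proof. by move=> K L e; apply/ffunP => j; rewrite -!nth_mult_list e. Qed.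

Lemma sumn_mult_list K : sumn (mult_list K) = mcard K.
Proof.
rewrite sumnE /mult_list /mkseq big_map -[iota 0 10]/(index_iota 0 10) big_mkord.
by apply: eq_bigr => j _; rewrite /mult_fun inord_val.
Qed.

Lemma signature_mult_list K : signature (nth 0%N (mult_list K)) = signature (mult_fun K).
Proof. by apply: signature_ext => j; exact: nth_mult_list_fun. Qed.

Lemma reducesP K : reduces (mult_list K) <-> reduces_to_bspline K.
Proof.
have E i : (0 < i)%N -> (i.-1 < 10)%N -> nth 0%N (mult_list K) i.-1 = K (ix i).
  by move=> i0 hi; rewrite nth_mult_list_fun.
have e1 : forall e : nat * nat * nat, e \in edges ->
   [/\ nth 0%N (mult_list K) e.1.1.-1 = K (ix e.1.1), nth 0%N (mult_list K) e.1.2.-1 = K (ix e.1.2)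
     & nth 0%N (mult_list K) e.2.-1 = K (ix e.2)].
  have : all (fun e : nat * nat * nat => [&& 0 < e.1.1, 0 < e.1.2, 0 < e.2, e.1.1.-1 < 10, e.1.2.-1 < 10 & e.2.-1 < 10]%N) edges by [].
  by move=> /allP H e /H/and5P[? ? ? ? /andP[? ?]]; rewrite !E.
split.
  move=> /allP H i j k ein; have := H _ ein; have [/= -> -> ->] := e1 _ ein.
  by case: ifP => [_ _|_]; [left|case: eqP => // m7 ?; right].
move=> H; apply/allP => -[[i j] k] ein; have [/= -> -> ->] := e1 _ ein.
by case: (H _ _ _ ein) => [->//|[m7 b]]; case: ifP => // _; rewrite m7 eqxx.
Qed.

Lemma permuteE (s : {perm 'I_10}) p l : uniq p -> size p = 10 ->
  (forall j : 'I_10, s j = nth 0%N p j :> nat) -> mult_list (Defs.mact s (mset_of l)) = permute p l.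
Proof.
move=> up sp sE; apply/eq_in_map => j; rewrite mem_iota => /= j10.
rewrite /mult_fun !ffunE; congr nth.
have := sE (s^-1%g (inord j)); rewrite permKV inordK// => e.
by rewrite [in RHS]e index_uniq ?sp.
Qed.

Section Geometry.
Variable R : realType.
Variables v1 v2 v3 : R * R.
Hypothesis D0 : D v1 v2 v3 != 0.
Notation v := (split12 v1 v2 v3).
Notation lin := (lin v1 v2 v3).

Lemma noncollinearE K : noncollinear (mult_list K) = ~~ degen v K.
Proof.
have DE (i j k : 'I_10) : (D (v i) (v j) (v k) == 0) = (vec_det (vx i) (vx j) (vx k) == 0).
  rewrite !split12_pt D_pt ?vx_sum// mulf_eq0 (negbTE D0) orbF mulf_eq0 intr_eq0.
  by rewrite [X in _ || X]negbTE ?orbF// invr_eq0 !mulf_neq0 ?intr_eq0.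
rewrite /noncollinear; apply/idP/idP.
  move=> /hasP[i]; rewrite mem_iota => i10; case: ifP => // Ki.
  move=> /hasP[j]; rewrite mem_iota => j10; case: ifP => // Kj.
  move=> /hasP[k]; rewrite mem_iota => k10; case: ifP => // Kk d0.
  move: i10 j10 k10; rewrite !leq0n !add0n !andTb => i10 j10 k10.
  apply/negP => dK; move: d0; have := DE (Ordinal i10) (Ordinal j10) (Ordinal k10).
  move: Ki Kj Kk; rewrite (nth_mult_list K (Ordinal i10)) (nth_mult_list K (Ordinal j10)).
  rewrite (nth_mult_list K (Ordinal k10)) => Ki Kj Kk.
  by rewrite (degenP dK Ki Kj Kk) eqxx => <-.
move=> /degenPn[i [j [k [Ki Kj Kk d0]]]].
apply/hasP; exists (val i); first exact: mem_iota_ord.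
rewrite nth_mult_list Ki; apply/hasP; exists (val j); first exact: mem_iota_ord.
rewrite nth_mult_list Kj; apply/hasP; exists (val k); first exact: mem_iota_ord.
by rewrite nth_mult_list Kk -DE.
Qed.

Lemma mem_smooth_lists K : mcard K = 8%N ->
  (mult_list K \in smooth_lists) = ~~ degen v K && smooth_ok (mult_fun K).
Proof.
move=> cK; have ext : rows_ok (nth 0%N (mult_list K)) = smooth_ok (mult_fun K).
  by rewrite -rows_okE; apply: rows_ok_ext => j; exact: nth_mult_list_fun.
rewrite mem_filter sumn_mult_list cK eqxx noncollinearE; congr andb.
rewrite -ext; apply/idP/idP => [|ok]; last by apply: tailsP; rewrite ?size_mkseq ?sumn_mult_list ?cK.
move=> /flatten_mapP[t _ /mapP[x]]; rewrite mem_filter => /andP[ok _] e.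
by rewrite e.
Qed.
End Geometry.


(** * The affine symmetries *)

(** The factor 12 compensates the scaling of the coordinates [c]. *)
Definition is_comb (k : nat) (c a b d : vec) : bool :=
  [&& 12 * (vx k).1.1 == c.1.1 * a.1.1 + c.1.2 * b.1.1 + c.2 * d.1.1,
      12 * (vx k).1.2 == c.1.1 * a.1.2 + c.1.2 * b.1.2 + c.2 * d.1.2 &
      12 * (vx k).2 == c.1.1 * a.2 + c.1.2 * b.2 + c.2 * d.2].

(** The point with the barycentric coordinates of the j-th one relative to the permuted
corners is the p(j)-th one, and no other. *)
Lemma symmetries_comb : all (fun p => all (fun j => all (fun k =>
  is_comb k (vx j) (vx (nth 0 p 0)) (vx (nth 0 p 1)) (vx (nth 0 p 2)) == (k == nth 0 p j))
  (iota 0 10)) (iota 0 10)) symmetries.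
Proof. by vm_compute. Qed.

Lemma symmetries_perm : all (fun p => [&& size p == 10, uniq p, all (gtn 10) p &
  all (gtn 3) (take 3 p)]) symmetries.
Proof. by vm_compute. Qed.

Lemma symmetries_total : all (fun a => all (fun b => all (fun c =>
  uniq [:: a; b; c] ==> has (fun p => take 3 p == [:: a; b; c]) symmetries)
  (iota 0 3)) (iota 0 3)) (iota 0 3).
Proof. by vm_compute. Qed.

Section Symmetries.
Variable R : realType.
Variables v1 v2 v3 : R * R.
Hypothesis D0 : D v1 v2 v3 != 0.
Notation v := (split12 v1 v2 v3).
Notation form := (lin v1 v2 v3).

Lemma affine_map3 (f : R * R -> R * R) (x y z : R) (a b c : R * R) : affine_map f ->
  x + y + z = 1 -> z != 1 ->
  f (x *: a + y *: b + z *: c) = x *: f a + y *: f b + z *: f c.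
Proof.
move=> fA s z1; have z1' : 1 - z != 0 by rewrite subr_eq0 eq_sym.
have key (p q r : R * R) : x *: p + y *: q + z *: r =
    (1 - z) *: ((1 - y / (1 - z)) *: p + (y / (1 - z)) *: q) + z *: r.
  have -> : x = 1 - y - z by lra.
  by apply: pairE; rewrite /= /GRing.scale/=; field.
by rewrite key !fA -key.
Qed.

Lemma split12_comb (j : 'I_10) : v j = ((vx j).1.1%:~R / 12) *: v (ix 1)
  + ((vx j).1.2%:~R / 12) *: v (ix 2) + ((vx j).2%:~R / 12) *: v (ix 3).
Proof.
rewrite split12_ix1 split12_ix2 split12_ix3 split12_pt /pt vx_sum.
by rewrite !scalerDr !scalerA ![_^-1 * _]mulrC.
Qed.

Lemma vx_weights (j : 'I_10) :
  (vx j).1.1%:~R / 12 + (vx j).1.2%:~R / 12 + (vx j).2%:~R / 12 = 1 :> R.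
Proof.
by rewrite -!mulrDl -!intrD -[_ + _ + _]/(vec_sum (vx j)) vx_sum divff// pnatr_eq0.
Qed.

Lemma clear12 (a b b' c c' d d' : R) :
  a / 12 = b / 12 * (b' / 12) + c / 12 * (c' / 12) + d / 12 * (d' / 12) ->
  12%:~R * a = b * b' + c * c' + d * d'.
Proof. by move=> h; lra. Qed.

(** An affine map is determined by its values at the corners. *)
Lemma symmetry_list (s : {perm 'I_10}) : S3_sym v s ->
  exists2 p, p \in symmetries & forall j : 'I_10, s j = nth 0%N p j :> nat.
Proof.
move=> [s3 [f fA fv]].
have i3 k : (0 < k <= 3)%N -> (s (ix k) < 3)%N.
  by move=> /andP[k0 k3]; apply: s3; rewrite /ix inordK; lia.
have mem3 k : (0 < k <= 3)%N -> (s (ix k) : nat) \in iota 0 3 by move=> /i3; rewrite mem_iota.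
have us : uniq [:: (s (ix 1) : nat); (s (ix 2) : nat); (s (ix 3) : nat)].
  rewrite -[[:: _; _; _]]/(map (val \o s) [:: ix 1; ix 2; ix 3]) map_inj_uniq.
    by rewrite /= !inE /ix -!val_eqE /= !inordK.
  by move=> a b /val_inj/perm_inj.
have /implyP/(_ us)/hasP[p pin /eqP e] :=
  allP (allP (allP symmetries_total _ (mem3 1%N isT)) _ (mem3 2%N isT)) _ (mem3 3%N isT).
exists p => // j.
have [e0 e1 e2] : [/\ nth 0%N p 0 = s (ix 1), nth 0%N p 1 = s (ix 2) & nth 0%N p 2 = s (ix 3)].
  by rewrite -!(@nth_take 3 _ 0%N _ _ p)// e.
have main : v (s j) = ((vx j).1.1%:~R / 12) *: v (s (ix 1))
  + ((vx j).1.2%:~R / 12) *: v (s (ix 2)) + ((vx j).2%:~R / 12) *: v (s (ix 3)).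
  have [j2|j2] := eqVneq ((vx j).2%:~R / 12 : R) 1.
    have -> : j = ix 3.
      have {}j2 : (vx j).2 = 12.
        by apply/eqP; rewrite -(eqr_int R) -[_%:~R](@divfK _ 12) ?pnatr_eq0// j2 mul1r.
      apply: val_inj; rewrite /= /ix inordK//.
      by case: j j2 => -[|[|[|[|[|[|[|[|[|[|//]]]]]]]]]] ?.
    by rewrite /ix inordK//= !mul0r !scale0r !add0r divff ?scale1r// pnatr_eq0.
  by rewrite -!fv {1}split12_comb affine_map3// vx_weights.
have coord a : 12 * vec_dot a (vx (s j)) = (vx j).1.1 * vec_dot a (vx (s (ix 1)))
   + (vx j).1.2 * vec_dot a (vx (s (ix 2))) + (vx j).2 * vec_dot a (vx (s (ix 3))).
  apply/eqP; rewrite -(eqr_int R) !intrD !intrM; apply/eqP.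
  have := congr1 (form a) main; rewrite lin_comb ?vx_weights// !lin_v//.
  exact: clear12.
apply/esym/eqP; rewrite eq_sym.
have := allP (allP (allP symmetries_comb _ pin) _ (mem_iota_ord (ltn_ord j))) _ (mem_iota_ord (ltn_ord (s j))).
rewrite e0 e1 e2 => /eqP <-.
have := coord (1, 0, 0); have := coord (0, 1, 0); have := coord (0, 0, 1).
rewrite /vec_dot /= !mul0r !mul1r !addr0 !add0r => h3 h2 h1.
by apply/and3P; split; apply/eqP.
Qed.

(** The affine map with the given values at the corners permutes the ten points, by
[symmetries_comb]. *)
Lemma list_symmetry p : p \in symmetries ->
  exists2 s : {perm 'I_10}, S3_sym v s & forall j : 'I_10, s j = nth 0%N p j :> nat.
Proof.
move=> pin; have /and4P[/eqP sp up p10 p3] := allP symmetries_perm _ pin.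
have plt (j : 'I_10) : (nth 0%N p j < 10)%N by apply: (allP p10); rewrite mem_nth ?sp.
have pinj : injective (fun j : 'I_10 => Ordinal (plt j)).
  by move=> i j /(congr1 val)/eqP; rewrite /= nth_uniq ?sp// => /eqP/val_inj.
exists (perm pinj) => [|j]; last by rewrite permE.
split=> [j j3|]; first by rewrite permE /= -(@nth_take 3)//; apply: (allP p3); rewrite mem_nth// size_take sp.
pose f (x : R * R) : R * R := form (1, 0, 0) x *: v (perm pinj (ix 1))
  + form (0, 1, 0) x *: v (perm pinj (ix 2)) + form (0, 0, 1) x *: v (perm pinj (ix 3)).
exists f => [t x y|j].
  by rewrite /f /lin; apply: pairE; rewrite /= /GRing.scale/=; ring.
have := allP (allP (allP symmetries_comb _ pin) _ (mem_iota_ord (ltn_ord j))) _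
  (mem_iota_ord (ltn_ord (Ordinal (plt j)))).
rewrite /= eqxx => /eqP/and3P[/eqP h1 /eqP h2 /eqP h3].
rewrite /f !lin_v// !permE !split12_pt /= /ix !inordK//=.
rewrite /pt (vx_sum (Ordinal (plt j))).
have s12 k : (k < 10)%N -> vec_sum (vx k) = 12 by move=> hk; exact: (vx_sum (Ordinal hk)).
have pk k : (k < 3)%N -> (nth 0%N p k < 10)%N.
  by move=> hk; exact: (plt (Ordinal (leq_trans hk (isT : 3 <= 10)%N))).
rewrite !s12 ?pk//.
have toR (a b : int) : a = b -> a%:~R = b%:~R :> R by move=> ->.
move: (toR _ _ h1) (toR _ _ h2) (toR _ _ h3); rewrite !intrD !intrM /vec_dot /= !mul0r !mul1r !addr0 !add0r.
set c1 := (vx (nth 0 p j)).1.1%:~R; set c2 := (vx (nth 0 p j)).1.2%:~R; set c3 := (vx (nth 0 p j)).2%:~R.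
move=> e1 e2 e3.
have n12 : (12%:~R : R) != 0 by rewrite intr_eq0.
have -> : c1 = 12%:~R^-1 * (12%:~R * c1) by rewrite mulKf.
have -> : c2 = 12%:~R^-1 * (12%:~R * c2) by rewrite mulKf.
have -> : c3 = 12%:~R^-1 * (12%:~R * c3) by rewrite mulKf.
rewrite e1 e2 e3.
by apply: pairE; rewrite /= /GRing.scale/=; field.
Qed.

End Symmetries.


(** * The classification *)

Lemma area_triangle_D (R : realType) (v1 v2 v3 : R * R) :
  0 < area (triangle v1 v2 v3) -> D v1 v2 v3 != 0.
Proof.
have -> : triangle v1 v2 v3 = mhull (split12 v1 v2 v3) (mset3 (ix 1) (ix 2) (ix 3)).
  by rewrite mhull_mset3 split12_ix1 split12_ix2 split12_ix3.
apply: contraTneq => d0; rewrite area_degen ?ltxx//.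
by rewrite degen_mset3 split12_ix1 split12_ix2 split12_ix3 d0.
Qed.

Lemma uniq_map_inj (S T : eqType) (f : S -> T) (l : seq S) x y : uniq [seq f z | z <- l] ->
  x \in l -> y \in l -> f x = f y -> x = y.
Proof.
move=> u xl yl e; rewrite -(nth_index x xl) -[RHS](nth_index x yl).
have [x1 y1] : (index x l < size (map f l))%N /\ (index y l < size (map f l))%N.
  by rewrite size_map !index_mem.
congr nth; apply/eqP; rewrite -(nth_uniq (f x) x1 y1 u) !(nth_map x) ?index_mem//.
by rewrite !nth_index// e.
Qed.

Section Classification.
Variable R : realType.
Variables v1 v2 v3 : R * R.
Hypothesis D0 : D v1 v2 v3 != 0.
Notation v := (split12 v1 v2 v3).

Lemma class_mult_list s (t : {perm 'I_10}) : S3_sym v t -> s \in quintic_list ->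
  let L := Defs.mact t (mset_of s) in
  [/\ exists2 p, p \in symmetries & mult_list L = permute p s, mcard L = 8%N,
    ~~ degen v L, smooth_ok (mult_fun L) & reduces_to_bspline L
      /\ forall j : 'I_10, (0 < L j)%N -> (j < 6)%N].
Proof.
move=> /(symmetry_list D0)[p pin pE] sin L.
have /and4P[/eqP sp up _ _] := allP symmetries_perm _ pin.
have LE : mult_list L = permute p s by exact: permuteE.
have /and3P[gl rl /allP l6] := allP (allP quintic_smooth _ pin) _ sin.
have cL : mcard L = 8%N.
  rewrite -sumn_mult_list LE; move: gl; rewrite mem_filter => /andP[+ _].
  by case: eqP.
move: gl; rewrite -LE (mem_smooth_lists D0 cL) => /andP[ndL okL].
split=> //; first by exists p.
split; first by apply/reducesP; rewrite LE.
move=> j Lj; rewrite ltnNge; apply/negP => j6; move: Lj.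
rewrite -nth_mult_list LE (eqP (l6 j _))// mem_iota j6 /=; exact: ltn_ord.
Qed.

(** Distinct smooth multisets have distinct signatures, by enumeration. *)
Lemma same_spline_eq K L : mcard K = 8%N -> mcard L = 8%N -> ~~ degen v K -> ~~ degen v L ->
  smooth_ok (mult_fun K) -> smooth_ok (mult_fun L) ->
  simplex_spline v K = simplex_spline v L -> K = L.
Proof.
move=> cK cL ndK ndL okK okL QKL; apply: mult_list_inj.
have gK : mult_list K \in smooth_lists by rewrite (mem_smooth_lists D0 cK) ndK.
have gL : mult_list L \in smooth_lists by rewrite (mem_smooth_lists D0 cL) ndL.
apply: (uniq_map_inj smooth_lists_uniq) => //.
rewrite !signature_mult_list; apply: signature_eq; exact: (same_spline D0).
Qed.

End Classification.

Theorem theorem4 (R : realType) (v1 v2 v3 : R * R)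
    (nondeg : 0 < area (triangle v1 v2 v3))
    (K : mset10) (cardK : mcard K = 8%N)
    (areaK : 0 < area (mhull (split12 v1 v2 v3) K)) :
  let v := split12 v1 v2 v3 in
  (simplex_spline_in_S35 v K /\ reduces_to_bspline K) <->
  (exists! s : seq nat,
     s \in quintic_list /\ S3_class v (mset_of s) (simplex_spline v K)).
Proof.
move=> v; have D0 := area_triangle_D nondeg.
have ndK : ~~ degen v K by apply: contraTN areaK => /area_degen ->; rewrite ltxx.
split.
  move=> [SK rK]; have okK := necessity D0 cardK ndK SK.
  have gK : mult_list K \in smooth_lists by rewrite (mem_smooth_lists D0 cardK) ndK.
  have /implyP := allP smooth_lists_reduces _ gK.
  move=> /(_ (proj2 (reducesP K) rK))/hasP[p pin /hasP[s sin /eqP KE]].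
  have [t tS tp] := list_symmetry D0 pin.
  have /and4P[/eqP sp up _ _] := allP symmetries_perm _ pin.
  have KL : K = Defs.mact t (mset_of s).
    by apply: mult_list_inj; rewrite KE (permuteE _ up sp tp).
  exists s; split; first by split=> //; exists t => //; rewrite -KL.
  move=> s' [s'in [t' t'S QL]].
  have [[p' p'in LE] cL ndL okL _] := class_mult_list D0 t'S s'in.
  have KL' := same_spline_eq D0 cardK cL ndK ndL okK okL (esym QL).
  have := allP (allP (allP (allP quintic_orbits_disjoint _ pin) _ sin) _ p'in) _ s'in.
  by rewrite -KE -LE -KL' eqxx => /eqP.
move=> [s [[sin [t tS QL]] _]].
have [_ cL ndL okL [rL L6]] := class_mult_list D0 tS sin.
(* membership in the spline space is a property of the function alone *)
have SK : simplex_spline_in_S35 v K.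
  have [f Sf fE] := sufficiency D0 cL ndL L6 okL.
  by exists f => // x Tx gx; rewrite -QL; exact: fE.
have okK := necessity D0 cardK ndK SK.
by split=> //; rewrite (same_spline_eq D0 cardK cL ndK ndL okK okL (esym QL)).
Qed.
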